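(* Let $$\Lambda_0=\frac{\Gamma(\frac14)^4}{32\pi^2}=0.5471\ldots$$ and let $F$ be the function on $Q=[-\pi,\pi]^2$ defined by the Fourier series $$F(\tau)=\sum_{m\in\mathbb{Z}^2,\,m\ne0}\frac{m_2^2-m_1^2}{2\pi|m|^4}\,e^{im\cdot\tau}.$$ Then there exists $\Lambda_+\ge\Lambda_0$ such that $F(Q)=[-\Lambda_+,\Lambda_+]$.
   Context: The Fourier series is not absolutely convergent; it converges in $L^2(Q)$, and $F$ denotes the representative of the sum that is continuous on $Q\setminus\{0\}$ (such a representative exists), with $F(0)=0$. *)

(* Defs.v *)
(* MathComp-Analysis *)
From HB Require Import structures.
From mathcomp Require Import all_boot all_order all_algebra finmap complex.
From mathcomp Require Import all_classical all_reals all_analysis.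
From mathcomp Require summability.

Set Implicit Arguments.
Unset Strict Implicit.
Unset Printing Implicit Defensive.

Import Order.TTheory GRing.Theory Num.Theory.
Import numFieldNormedType.Exports.

Local Open Scope classical_set_scope.
Local Open Scope ring_scope.

(* Euler's integral; it converges for s > 0. *)
Definition Gamma {R : realType} (s : R) : R :=
  \int[@lebesgue_measure R]_(t in `]0, +oo[) (t `^ (s - 1) * expR (- t)).

Definition Lambda0 (R : realType) : R := Gamma (1 / 4 : R) ^+ 4 / (32 * pi ^+ 2).

Definition Q (R : realType) : set (R * R) :=
  `[- pi, pi]%classic `*` `[- pi, pi]%classic.

Definition normsq (m : int * int) : int := m.1 ^+ 2 + m.2 ^+ 2.

Definition dotp {R : realType} (m : int * int) (t : R * R) : R :=
  m.1%:~R * t.1 + m.2%:~R * t.2.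

Definition expi {R : realType} (x : R) : R[i] := (cos x +i* sin x)%C.

Definition Fcoef (R : realType) (m : int * int) : R :=
  (m.2 ^+ 2 - m.1 ^+ 2)%:~R / (2 * pi * (normsq m)%:~R ^+ 2).

Definition Fpartial (R : realType) (A : {fset int * int}) (t : R * R) : R[i] :=
  \sum_(m <- A | m != (0, 0)) (Fcoef R m)%:C%C * expi (dotp m t).

(* Squared L^2(D)-distance, w.r.t. the Lebesgue measure of the plane. *)
Definition L2distsq (R : realType) (D : set (R * R)) (f g : R * R -> R[i]) :
    \bar R :=
  (\int[lebesgue_measure \x lebesgue_measure]_(t in D)
     (Normc.normc (f t - g t) ^+ 2)%:E)%E.

(* The sums over the finite subsets of Z^2 \ {0}, directed by inclusion,
   converge to F in L^2(Q).  The two other conditions determine F on Q, since a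
   class of functions modulo null sets has at most one representative that is
   continuous on Q \ {0}.  Values outside Q are irrelevant. *)
Definition is_F (R : realType) (F : R * R -> R) : Prop :=
  [/\ (fun A => L2distsq (@Q R) (Fpartial A) (fun t => (F t)%:C%C))
        @ summability.totally --> (0 : \bar R)%E,
      {within @Q R `\ (0, 0), continuous F} &
      F (0, 0) = 0].

(* Main.v *)
Require Import Defs.
From HB Require Import structures.
From mathcomp Require Import all_boot all_order all_algebra finmap complex.
From mathcomp Require Import all_classical all_reals all_analysis.
From mathcomp Require Import measurable_realfun gauss_integral.
From mathcomp Require Import ring lra zify.

Set Implicit Arguments.
Unset Strict Implicit.
Unset Printing Implicit Defensive.

Import Order.TTheory GRing.Theory Num.Theory.
Import numFieldNormedType.Exports.
Local Open Scope classical_set_scope.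
Local Open Scope ring_scope.

(* Exchanging the two coordinates changes the sign of [F]. Summing the Fourier series
   over [m_1] first represents [F], away from the axis [t_1 = 0], by an explicit
   function [Gf]: an elementary term plus a series with exponentially small terms.
   Near the origin [|F|] is at most [1/2 + o(1)], and [1/2 < Lambda0]; so [F]
   attains its maximum over [Q] away from the origin, and by antisymmetry and
   connectedness [F(Q)] is the symmetric interval given by this maximum. It remains to
   show that [F(pi, 0) = Lambda0].

   [F(pi, 0)] is [pi/12 + pi * \sum_(k >= 1) cosh(k pi) / sinh(k pi)^2]. Let
   [D(x) = \sum_n sech(x + n pi)] and [M = D(0)]. Partial fractions in the double series
   of [D^2] and of [D * \sum_n sech(x + n pi)^2] give [D'' = g D - 2 D^3] with a constant
   [g]. The duplication formulas for sech^2 and csch^2, together with [F(pi, pi) = 0],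
   give [g = 3/2 M^2] and [F(pi, 0) = pi M^2 / 8]. The amplitude [phi], with [phi' = D]
   and [phi(0) = 0], satisfies [phi(pi) = pi], because its series telescopes, and
   [D^2 = M^2 / 2 * (1 + cos^2 phi)]. Hence [s = tan(phi(x) / 2)] as a function of
   [y = tan(x / 2)] transforms [ds / sqrt(1 + s^4)] into [M dy / (1 + y^2)], so that
   the integral of the former over the half-line is [pi M / 2]. Finally
   [Gamma(1/4)^2 = 4 sqrt(pi)] times this integral, by Fubini. *)

(** * Derivatives and series *)

(** The Fourier series converges only conditionally, and [is_F] gives only [L^2] convergence along
    finite sets. The value of [F] at a point is recovered from a cofinal family of partial sums that
    is uniformly close to a continuous candidate near that point: the boxes [box K N] with [K]
    chosen after [N]. Transposed boxes serve the points of the axis [t.1 = 0] other than the origin,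
    and comparing the two representations is what proves the antisymmetry of [F]. The constant [g]
    is where [Gamma (1 / 4)] comes from: [M dn(M x)] with modulus [k] satisfies the equation with
    [g = (2 - k^2) M^2], so [g = 3/2 M^2] is the lemniscatic case [k^2 = 1/2]. The symmetry of the
    square forces it, through [F(pi, pi) = 0]. Lattice sums are limits over the symmetric windows
    [-N..N], because partial fractions break summable double series into pieces that are not
    absolutely summable. The decimal bounds on [Lambda0] are part of the claim and also serve the
    argument: [5471 / 10^4] has to exceed the explicit bound [54 / 100] for [|F|] near the
    origin. *)

Section real_analysis.
Context {R : realType}.
Implicit Types (f g : R -> R) (u v : nat -> R).

Lemma cvgnP u (l : R) : (u @ \oo --> l) <->
  (forall e : R, 0 < e -> exists N, forall n, (N <= n)%N -> `|u n - l| <= e).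
Proof.
split=> [/cvgrPdist_le ul e e0|H].
  have [N _ HN] := ul e e0; exists N => n Nn.
  by rewrite distrC; apply: HN.
apply/cvgrPdist_le => e e0; have [N HN] := H e e0.
by exists N => // n /= Nn; rewrite distrC; apply: HN.
Qed.

Lemma cvg_uniq (T : Type) (Fl : set_system T) {FF : ProperFilter Fl} (h : T -> R) (l m : R) :
  h @ Fl --> l -> h @ Fl --> m -> l = m.
Proof. by move=> hl hm; rewrite -(cvg_lim _ hl)// -(cvg_lim _ hm). Qed.

Lemma cvgn_uniq u (l m : R) : u @ \oo --> l -> u @ \oo --> m -> l = m.
Proof. exact: cvg_uniq. Qed.

Lemma is_derive_fin f (x a : R) : is_derive x 1 f a <->
  (forall e : R, 0 < e -> exists2 d : R, 0 < d & forall h : R, `|h| < d ->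
     `|f (x + h) - f x - h * a| <= e * `|h|).
Proof.
split=> [[/derivable_nbhsP H1 <-] e e0|H].
  move: H1 => /eqaddoP /(_ e e0) [d d0 H]; exists d => // h hd.
  have := H h; rewrite /= sub0r normrN => /(_ hd).
  by rewrite !fctE /= [X in _ - (_ + X)]mulrC opprD addrA addrC /= [h *: 1]mulr1
     (addrC h x) => ?; rewrite addrC (mulrC h).
have C : h^-1 *: ((f \o shift x) (h *: 1) - f x) @[h --> 0^'] --> a.
  apply/cvgrPdist_le => e e0; have [d d0 Hd] := H e e0.
  near=> h.
  have h0 : h != 0 by near: h; exact: nbhs_dnbhs_neq.
  have hd : `|h| < d.
    by near: h; apply: dnbhs0_lt.
  have := Hd h hd; rewrite /= [h *: 1]mulr1 (addrC h x) => Hh.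
  rewrite -(ler_pM2r (x := `|h|)) ?normr_gt0// -normrM.
  rewrite (_ : (a - _) * h = - (f (x + h) - f x - h * a)) ?normrN//.
  by rewrite /GRing.scale /=; field.
by apply: DeriveDef; [apply/cvg_ex; exists a | apply/cvg_lim].
Unshelve. all: by end_near. Qed.

Lemma is_derive_cont f (x a : R) : is_derive x 1 f a -> {for x, continuous f}.
Proof. by case=> H _; apply/differentiable_continuous/derivable1_diffP. Qed.

Lemma is_derive_within f (a b : R) (df : R -> R) :
  (forall t, a <= t <= b -> is_derive t 1 f (df t)) ->
  {within `[a, b], continuous f}.
Proof.
move=> H; apply: derivable_within_continuous => t; rewrite in_itv /= => tab.
by case: (H t tab).
Qed.

Lemma mvt_ex f (df : R -> R) (a b : R) : a <= b ->
  (forall t, a <= t <= b -> is_derive t 1 f (df t)) ->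
  exists2 c, a <= c <= b & f b - f a = df c * (b - a).
Proof.
move=> ab H; have [|c] := @MVT_segment R f df a b ab _ (is_derive_within H).
  by move=> x; rewrite in_itv /= => /andP[/ltW ? /ltW ?]; apply: H; apply/andP.
by rewrite in_itv /= => ? ?; exists c.
Qed.

Lemma mvt_le f (df : R -> R) (a b C : R) : a <= b ->
  (forall t, a <= t <= b -> is_derive t 1 f (df t)) ->
  (forall t, a <= t <= b -> `|df t| <= C) -> `|f b - f a| <= C * (b - a).
Proof.
move=> ab H HC; have [c cab ->] := mvt_ex ab H.
by rewrite normrM (ger0_norm (_ : 0 <= b - a)) ?subr_ge0// ler_wpM2r ?subr_ge0// HC.
Qed.

Lemma mvt_mono f (df : R -> R) (a b : R) : a <= b ->
  (forall t, a <= t <= b -> is_derive t 1 f (df t)) ->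
  (forall t, a <= t <= b -> 0 <= df t) -> f a <= f b.
Proof.
move=> ab H HC; have [c cab e] := mvt_ex ab H.
by rewrite -subr_ge0 e mulr_ge0 ?HC ?subr_ge0.
Qed.

Lemma mvt_cst f (df : R -> R) (a b : R) : a <= b ->
  (forall t, a <= t <= b -> is_derive t 1 f (df t)) ->
  (forall t, a <= t <= b -> df t = 0) -> f a = f b.
Proof.
move=> ab H H0; have [c cab /eqP] := mvt_ex ab H.
by rewrite H0// mul0r subr_eq0 => /eqP.
Qed.

(* An alias that type class resolution does not see through: the rules below then
   apply to an unknown derivative [a]. *)
Definition isd f (x a : R) : Prop := is_derive x 1 f a.

Lemma derive_conv f (x a b : R) : isd f x a -> a = b -> is_derive x 1 f b.
Proof. by move=> H <-. Qed.

Lemma dcst (c x : R) : isd (fun=> c) x 0.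
Proof. exact: is_derive_cst. Qed.
Lemma did (x : R) : isd (fun t : R => t) x 1.
Proof. exact: is_derive_id. Qed.
Lemma dadd f g (x a b : R) : isd f x a -> isd g x b ->
  isd (fun t => f t + g t) x (a + b).
Proof. by move=> *; exact: is_deriveD. Qed.
Lemma dopp f (x a : R) : isd f x a -> isd (fun t => - f t) x (- a).
Proof. by move=> *; exact: is_deriveN. Qed.
Lemma dmul f g (x a b : R) : isd f x a -> isd g x b ->
  isd (fun t => f t * g t) x (a * g x + f x * b).
Proof.
move=> fa gb; apply: (is_derive_eq (is_deriveM fa gb)).
by rewrite addrC /GRing.scale /= (mulrC a).
Qed.
Lemma dinv f (x a : R) : f x != 0 -> isd f x a ->
  isd (fun t => (f t)^-1) x (- a / f x ^+ 2).
Proof.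
move=> fx fa; apply: (is_derive_eq (is_deriveV fx fa)).
by rewrite /GRing.scale /= !mulNr mulrC.
Qed.
Lemma dpow f n (x a : R) : isd f x a ->
  isd (fun t => f t ^+ n) x (n%:R * f x ^+ n.-1 * a).
Proof.
move=> fa; elim: n => [|n IH]; first by rewrite !mul0r; exact: dcst.
rewrite (_ : (fun t => _) = (fun t => f t * f t ^+ n)); last first.
  by apply/funext => t; rewrite exprS.
apply: (is_derive_eq (dmul fa IH)).
case: n {IH} => [|n] /=; first by rewrite !expr0; ring.
by rewrite !exprS; ring.
Qed.
Lemma dcomp f g (x a b : R) : isd f (g x) a -> isd g x b ->
  isd (fun t => f (g t)) x (a * b).
Proof. by move=> fa gb; exact: (is_derive1_comp fa gb). Qed.
Lemma dexpR f (x a : R) : isd f x a ->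
  isd (fun t => expR (f t)) x (expR (f x) * a).
Proof. by move=> fa; exact: (dcomp (is_derive_expR _) fa). Qed.
Lemma dcos f (x a : R) : isd f x a ->
  isd (fun t => cos (f t)) x (- sin (f x) * a).
Proof. by move=> fa; exact: (dcomp (is_derive_cos _) fa). Qed.
Lemma dsin f (x a : R) : isd f x a ->
  isd (fun t => sin (f t)) x (cos (f x) * a).
Proof. by move=> fa; exact: (dcomp (is_derive_sin _) fa). Qed.
Lemma datan f (x a : R) : isd f x a ->
  isd (fun t => atan (f t)) x ((1 + f x ^+ 2)^-1 * a).
Proof. by move=> fa; exact: (dcomp (is_derive1_atan _) fa). Qed.
Lemma dsum (I : Type) (r : seq I) (F dF : I -> R -> R) (x : R) :
  (forall i, isd (F i) x (dF i x)) ->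
  isd (fun t => \sum_(i <- r) F i t) x (\sum_(i <- r) dF i x).
Proof.
move=> H; elim: r => [|i r IH].
  rewrite (_ : (fun t => _) = fun=> 0); last by apply/funext => t; rewrite big_nil.
  by rewrite big_nil; exact: dcst.
rewrite (_ : (fun t => _) = fun t => F i t + \sum_(i <- r) F i t).
  by rewrite big_cons; apply: dadd.
by apply/funext => t; rewrite big_cons.
Qed.

Definition sums (V : nat -> R) (l : R) := series V @ \oo --> l.

Lemma sums_lim u l : sums u l -> limn (series u) = l.
Proof. exact: cvg_lim. Qed.

Lemma sums_cvg u l : sums u l -> cvgn (series u).
Proof. by move=> h; apply/cvg_ex; exists l. Qed.

Lemma sums_unique u l m : sums u l -> sums u m -> l = m.
Proof. by move=> ul um; rewrite -(sums_lim ul) (sums_lim um). Qed.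

Lemma sumsD u v l m : sums u l -> sums v m -> sums (fun k => u k + v k) (l + m).
Proof.
move=> ul vm; rewrite /sums (_ : series _ = fun n => series u n + series v n).
  exact: cvgD.
by apply/funext => n; rewrite /series /= big_split.
Qed.

Lemma sumsZ u (c : R) l : sums u l -> sums (fun k => c * u k) (c * l).
Proof.
move=> ul; rewrite /sums (_ : series _ = fun n => c * series u n).
  by apply: cvgM => //; exact: cvg_cst.
by apply/funext => n; rewrite /series /= mulr_sumr.
Qed.

Lemma sumsN u l : sums u l -> sums (fun k => - u k) (- l).
Proof.
move=> ul; rewrite /sums (_ : series _ = fun n => - series u n).
  exact: cvgN.
by apply/funext => n; rewrite /series /= sumrN.
Qed.

Lemma sumsB u v l m : sums u l -> sums v m -> sums (fun k => u k - v k) (l - m).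
Proof. by move=> ul vm; apply: sumsD => //; exact: sumsN. Qed.

Lemma sums_eq u v l : u =1 v -> sums u l -> sums v l.
Proof. by move=> /funext ->. Qed.

Lemma abs_cvg_series u v : (forall n, `|u n| <= v n) -> cvgn (series v) ->
  cvgn (series u).
Proof.
move=> uv cv; apply: normed_cvg; apply: series_le_cvg cv => // n.
  exact: normr_ge0.
by apply: le_trans (uv n); exact: normr_ge0.
Qed.

Lemma series_tail u v N : (forall n, `|u n| <= v n) -> cvgn (series v) ->
  `|limn (series u) - series u N| <= limn (series v) - series v N.
Proof.
move=> uv cv; have cu := abs_cvg_series uv cv.
have H n : (N <= n)%N -> `|series u n - series u N| <= series v n - series v N.
  move=> Nn; rewrite !sub_series_geq//.
  apply: (le_trans (ler_norm_sum _ _ _)).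
  by apply: ler_sum => i _; exact: uv.
have C1 : `|series u n - series u N| @[n --> \oo] --> `|limn (series u) - series u N|.
  by apply: cvg_norm; apply: cvgB => //; exact: cvg_cst.
have C2 : series v n - series v N @[n --> \oo] --> limn (series v) - series v N.
  by apply: cvgB => //; exact: cvg_cst.
apply: (ler_cvg_to C1 C2); near=> n; apply: H; near: n; exact: nbhs_infty_ge.
Unshelve. all: by end_near. Qed.

Lemma series_tail_small v (e : R) : cvgn (series v) -> 0 < e -> exists N,
  limn (series v) - series v N <= e.
Proof.
move=> /cvgnP /(_ e) cv /cv[N HN]; exists N.
have := HN N (leqnn _); rewrite distrC; apply: le_trans; exact: ler_norm.
Qed.

(** By the mean value theorem the increments of [F k] are at most [|h| * M k], so the tails of the
    difference quotients are small uniformly in [h]; a finite sum is left to differentiate. *)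
Lemma is_derive_series (F dF : nat -> R -> R) (M : nat -> R) (a b : R) :
  (forall k t, a < t < b -> is_derive t 1 (F k) (dF k t)) ->
  (forall k t, a < t < b -> `|dF k t| <= M k) -> cvgn (series M) ->
  (forall t, a < t < b -> cvgn (series (fun k => F k t))) ->
  forall x, a < x < b ->
  is_derive x 1 (fun t => limn (series (fun k => F k t)))
    (limn (series (fun k => dF k x))).
Proof.
move=> HF HM cM cF x /andP[ax xb].
apply/is_derive_fin => e e0.
have e3 : 0 < e / 3 by rewrite divr_gt0.
have [N HN] := series_tail_small cM e3.
have /is_derive_fin /(_ _ e3)[d d0 Hd] :
    is_derive x 1 (fun t => series (fun k => F k t) N) (series (fun k => dF k x) N).
  by rewrite /series /=; apply: dsum => i; apply: HF; rewrite ax xb.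
pose d1 := Num.min d (Num.min (x - a) (b - x)).
exists d1; first by rewrite !lt_min d0 !subr_gt0 ax xb.
move=> h; rewrite !lt_min => /andP[hd /andP[ha hb]].
have xh : a < x + h < b.
  by move: ha hb; rewrite !ltr_norml => /andP[? ?] /andP[? ?]; apply/andP; split; lra.
have cFh := cF _ xh; have cFx : cvgn (series (fun k => F k x)) by apply: cF; rewrite ax.
have Hk k : `|F k (x + h) - F k x| <= `|h| * M k.
  case: (leP 0 h) => h0.
    have xxh : x <= x + h by rewrite lerDl.
    have := mvt_le (f := F k) (df := dF k) (C := M k) xxh.
    rewrite (ger0_norm h0) addrAC subrr add0r mulrC; apply=> t /andP[xt tx].
      by apply: HF; rewrite (lt_le_trans ax xt) (le_lt_trans tx (andP xh).2).
    by apply: HM; rewrite (lt_le_trans ax xt) (le_lt_trans tx (andP xh).2).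
  have xxh : x + h <= x by rewrite gerDl ltW.
  have := mvt_le (f := F k) (df := dF k) (C := M k) xxh.
  rewrite distrC (ltr0_norm h0) opprD addrA subrr add0r mulrC; apply=> t /andP[xt tx].
    by apply: HF; rewrite (lt_le_trans (andP xh).1 xt) (le_lt_trans tx xb).
  by apply: HM; rewrite (lt_le_trans (andP xh).1 xt) (le_lt_trans tx xb).
have chM : cvgn (series (fun k => `|h| * M k)) by apply: (cvgP (`|h| * limn (series M))); exact: sumsZ.
have T1 := series_tail N Hk chM.
have axb : a < x < b by rewrite ax.
have T2 := series_tail N (fun k => HM k x axb) cM.
have E1 : limn (series (fun k => F k (x + h) - F k x)) =
   limn (series (fun k => F k (x + h))) - limn (series (fun k => F k x)).
  by apply: sums_lim; apply: sumsB.
have E2 : limn (series (fun k => `|h| * M k)) - series (fun k => `|h| * M k) N =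
  `|h| * (limn (series M) - series M N).
  rewrite (sums_lim (@sumsZ M `|h| _ cM)) mulrBr; congr (_ - _).
  by rewrite /series /= mulr_sumr.
have E3 : series (fun k => F k (x + h) - F k x) N =
   series (fun k => F k (x + h)) N - series (fun k => F k x) N.
  by rewrite /series /= sumrB.
rewrite E1 E2 E3 in T1.
have T3 := Hd h hd.
set A := limn _ in T1 *; set B := limn _ in T1 *; set C := limn _ in T2 *.
set A' := series _ _ in T1 T3; set B' := series _ _ in T1 T3; set C' := series _ _ in T2 T3.
have -> : A - B - h * C = (A - B - (A' - B')) + (A' - B' - h * C') - h * (C - C').
  by ring.
have T4 : `|h * (C - C')| <= `|h| * (e / 3).
  by rewrite normrM ler_wpM2l//; exact: (le_trans T2 HN).
have T5 : `|A - B - (A' - B')| <= `|h| * (e / 3).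
  by apply: (le_trans T1); rewrite ler_wpM2l.
rewrite (le_trans (ler_normB _ _))// (le_trans (lerD (ler_normD _ _) (lexx _)))//.
by rewrite (_ : e * `|h| = `|h| * (e / 3) + e / 3 * `|h| + `|h| * (e / 3));
  [rewrite !lerD|field].
Qed.

End real_analysis.

(** The derivative is built as a unification variable by the shape of the function, and [dauto]
    leaves the equation with the stated one. The last case eta-expands a bare function such as
    [cos]; the case before it stops the repetition at any other abstraction. *)
Ltac dstep := lazymatch goal with
  | |- is_derive ?x _ ?f ?a => change (isd f x a)
  | |- isd (fun _ => ?c) _ _ => exact: dcst
  | |- isd (fun t => t) _ _ => exact: did
  | |- isd id _ _ => exact: did
  | |- isd (fun t => _ + _) _ _ => eapply dadd
  | |- isd (fun t => - _) _ _ => eapply dopp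
  | |- isd (fun t => _ * _) _ _ => eapply dmul
  | |- isd (fun t => _ ^+ _) _ _ => eapply dpow
  | |- isd (fun t => _^-1) _ _ => eapply dinv
  | |- isd (fun t => expR _) _ _ => eapply dexpR
  | |- isd (fun t => cos _) _ _ => eapply dcos
  | |- isd (fun t => sin _) _ _ => eapply dsin
  | |- isd (fun t => atan _) _ _ => eapply datan
  | |- isd (fun t => _) _ _ => fail
  | |- isd ?f ?x ?a => change (isd (fun t => f t) x a)
  end.
Ltac dauto := eapply derive_conv; [repeat dstep| rewrite /=].

(** * Hyperbolic functions *)

Section hyperbolic.
Context {R : realType}.
Implicit Types x y : R.

Definition sinh x : R := (expR x - expR (- x)) / 2.
Definition cosh x : R := (expR x + expR (- x)) / 2.

Lemma sinh0 : sinh 0 = 0. Proof. by rewrite /sinh oppr0 subrr mul0r. Qed.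
Lemma cosh0 : cosh 0 = 1. Proof. by rewrite /cosh oppr0 expR0; field. Qed.
Lemma sinhN x : sinh (- x) = - sinh x.
Proof. by rewrite /sinh opprK -mulNr opprB. Qed.
Lemma coshN x : cosh (- x) = cosh x.
Proof. by rewrite /cosh opprK addrC. Qed.
Lemma sinhD x y : sinh (x + y) = sinh x * cosh y + cosh x * sinh y.
Proof. by rewrite /sinh /cosh opprD !expRD; field. Qed.
Lemma coshD x y : cosh (x + y) = cosh x * cosh y + sinh x * sinh y.
Proof. by rewrite /sinh /cosh opprD !expRD; field. Qed.
Lemma sinhB x y : sinh (x - y) = sinh x * cosh y - cosh x * sinh y.
Proof. by rewrite sinhD sinhN coshN mulrN. Qed.
Lemma coshB x y : cosh (x - y) = cosh x * cosh y - sinh x * sinh y.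
Proof. by rewrite coshD sinhN coshN mulrN. Qed.
Lemma cosh_sqr x : cosh x ^+ 2 = 1 + sinh x ^+ 2.
Proof. by have := coshB x x; rewrite subrr cosh0 => e; rewrite !expr2; lra. Qed.
Lemma cosh_sinh x : cosh x + sinh x = expR x.
Proof. by rewrite /sinh /cosh; field. Qed.
Lemma cosh_subsinh x : cosh x - sinh x = expR (- x).
Proof. by rewrite /sinh /cosh; field. Qed.

Lemma cosh_gt0 x : 0 < cosh x.
Proof. by rewrite /cosh divr_gt0// addr_gt0 ?expR_gt0. Qed.
Lemma cosh_neq0 x : cosh x != 0. Proof. by rewrite gt_eqF ?cosh_gt0. Qed.
Lemma cosh_ge1 x : 1 <= cosh x.
Proof. by have := cosh_sqr x; have := cosh_gt0 x; have := sqr_ge0 (sinh x); nra. Qed.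
Lemma sinh_gt0 x : 0 < x -> 0 < sinh x.
Proof. by move=> x0; rewrite /sinh divr_gt0// subr_gt0 ltr_expR; lra. Qed.
Lemma sinh_ge0 x : 0 <= x -> 0 <= sinh x.
Proof. by rewrite le_eqVlt => /predU1P[<-|/sinh_gt0/ltW//]; rewrite sinh0. Qed.
Lemma sinh_neq0 x : x != 0 -> sinh x != 0.
Proof.
rewrite neq_lt => /orP[x0|x0]; last by rewrite gt_eqF ?sinh_gt0.
by rewrite -oppr_eq0 -sinhN gt_eqF// sinh_gt0// oppr_gt0.
Qed.

Lemma isd_sinh (f : R -> R) x a : isd f x a -> isd (fun t => sinh (f t)) x (cosh (f x) * a).
Proof.
move=> fa; rewrite /isd /sinh; eapply derive_conv.
  eapply dmul; [eapply dadd; [eapply dexpR; exact: fa | eapply dopp; eapply dexpR; eapply dopp; exact: fa]|exact: dcst].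
by rewrite /cosh /=; field.
Qed.
Lemma isd_cosh (f : R -> R) x a : isd f x a -> isd (fun t => cosh (f t)) x (sinh (f x) * a).
Proof.
move=> fa; rewrite /isd /cosh; eapply derive_conv.
  eapply dmul; [eapply dadd; [eapply dexpR; exact: fa | eapply dexpR; eapply dopp; exact: fa]|exact: dcst].
by rewrite /sinh /=; field.
Qed.

Lemma cosh_norm x : cosh `|x| = cosh x.
Proof. by have [x0|x0] := leP 0 x; rewrite ?(ger0_norm x0) ?(ltr0_norm x0) ?coshN. Qed.

Lemma sinh_norm x : sinh `|x| = `|sinh x|.
Proof.
have [x0|x0] := leP 0 x; first by rewrite !ger0_norm// sinh_ge0.
rewrite (ltr0_norm x0) sinhN ler0_norm// -oppr_ge0 -sinhN sinh_ge0//.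
by rewrite oppr_ge0 ltW.
Qed.

Lemma cosh_le x y : `|x| <= `|y| -> cosh x <= cosh y.
Proof.
rewrite -(cosh_norm x) -(cosh_norm y); set a := `|x|; set b := `|y| => ab.
have a0 : 0 <= a by rewrite normr_ge0.
apply: (mvt_mono (df := fun t => sinh t * 1) ab) => t /andP[at_ _].
  by apply: isd_cosh; exact: did.
by rewrite mulr1 sinh_ge0// (le_trans a0).
Qed.

Lemma sinh_le x y : x <= y -> sinh x <= sinh y.
Proof.
move=> ab; apply: (mvt_mono (df := fun t => cosh t * 1) ab) => t _.
  by apply: isd_sinh; exact: did.
by rewrite mulr1 ltW// cosh_gt0.
Qed.

Lemma sech_le x : (cosh x)^-1 <= 2 * expR (- `|x|).
Proof.
rewrite -(cosh_norm x) expRN -[2]invrK -invfM lef_pV2 ?posrE ?cosh_gt0//.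
  by rewrite /cosh mulrC ler_pM2r ?invr_gt0// lerDl expR_ge0.
Qed.

Lemma expRN2_le : expR (- (2 : R)) <= 2^-1.
Proof.
rewrite expRN lef_pV2 ?posrE ?expR_gt0//.
by have := @expR_ge1Dx R 2; lra.
Qed.

Lemma sinh_ge x : 1 <= x -> expR x / 4 <= sinh x.
Proof.
move=> x1; rewrite /sinh.
have : expR (- x) <= expR x / 2.
  rewrite -ler_pdivrMl ?expR_gt0// -expRN -expRD.
  by rewrite (le_trans _ expRN2_le)// ler_expR; lra.
by lra.
Qed.

Lemma csch_le x : 1 <= `|x| -> `|(sinh x)^-1| <= 4 * expR (- `|x|).
Proof.
move=> x1; rewrite normfV -sinh_norm expRN -[4]invrK -invfM lef_pV2 ?posrE.
- by rewrite mulrC sinh_ge.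
- by rewrite sinh_gt0// (lt_le_trans _ x1).
- by rewrite mulr_gt0 ?expR_gt0.
Qed.

End hyperbolic.

Ltac hstep := lazymatch goal with
  | |- isd (fun t => sinh _) _ _ => eapply isd_sinh
  | |- isd (fun t => cosh _) _ _ => eapply isd_cosh
  | |- _ => dstep
  end.
Ltac hauto := eapply derive_conv; [repeat hstep| rewrite /=].

(** * Gamma(1/4) as a quartic integral *)

Section half_line.
Context {R : realType}.
Local Notation mu := (@lebesgue_measure R).

Lemma itv0y_bigcup (a b : nat -> R) : (forall n, 0 < a n) ->
  (forall x : R, 0 < x -> exists n, a n <= x <= b n) ->
  \bigcup_n `[a n, b n]%classic = `]0, +oo[%classic.
Proof.
move=> a0 H; apply/seteqP; split=> x /=.
  by case=> n _ /=; rewrite !in_itv /= andbT => /andP[] /(lt_le_trans (a0 n)).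
by rewrite in_itv /= andbT => /H[n Hn]; exists n => //=; rewrite in_itv.
Qed.

Lemma cvg_integral_itv0y (a b : nat -> R) (f : R -> R) : (forall n, 0 < a n) ->
  {homo a : m n / (m <= n)%N >-> n <= m} -> {homo b : m n / (m <= n)%N >-> m <= n} ->
  (forall x : R, 0 < x -> exists n, a n <= x <= b n) ->
  (forall x : R, 0 < x -> {for x, continuous f}) ->
  (forall x : R, 0 < x -> 0 <= f x) ->
  (\int[mu]_(x in `[a n, b n]) (f x)%:E)%E @[n --> \oo] -->
  (\int[mu]_(x in `]0%R, +oo[) (f x)%:E)%E.
Proof.
move=> a0 am bm H cf f0; rewrite -(itv0y_bigcup a0 H).
apply: ge0_nondecreasing_set_cvg_integral => //.
- move=> m n mn; rewrite subsetEset => x /=; rewrite !in_itv /= => /andP[ax xb].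
  by rewrite (le_trans (am _ _ mn) ax) (le_trans xb (bm _ _ mn)).
- move=> n; apply/measurable_EFinP; apply: subspace_continuous_measurable_fun => //.
  apply: continuous_in_subspaceT => x; rewrite inE /= in_itv /= => /andP[ax _].
  by apply: cf; exact: lt_le_trans (a0 n) ax.
- move=> n x /=; rewrite in_itv /= lee_fin => /andP[ax _].
  by apply: f0; exact: lt_le_trans (a0 n) ax.
Qed.

(** Substitution on the compact intervals [[1 / (n + 1), n + 1]]; both sides pass to the limit by
    monotone convergence. *)
Lemma substitution_itv0y (F dF G : R -> R) :
  (forall x : R, 0 < x -> is_derive x 1 F (dF x)) ->
  (forall x : R, 0 < x -> {for x, continuous dF}) ->
  (forall x : R, 0 < x -> 0 < dF x) -> (forall x : R, 0 < x -> 0 < F x) ->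
  (forall e : R, 0 < e -> exists2 x : R, 0 < x & F x <= e) ->
  (forall k : R, exists2 x : R, 0 < x & k <= F x) ->
  (forall y : R, 0 < y -> {for y, continuous G}) -> (forall y : R, 0 < y -> 0 <= G y) ->
  (\int[mu]_(y in `]0%R, +oo[) (G y)%:E =
   \int[mu]_(x in `]0%R, +oo[) (G (F x) * dF x)%:E)%E.
Proof.
move=> HF cdF dF0 F0 Fs Fl cG G0.
have Fmono (x y : R) : 0 < x -> x <= y -> F x <= F y.
  move=> x0 xy; apply: (@mvt_mono R F dF x y xy).
    by move=> t /andP[xt _]; apply: HF; exact: lt_le_trans x0 xt.
  by move=> t /andP[xt _]; apply/ltW/dF0; exact: lt_le_trans x0 xt.
have Fhomo (x y : R) : 0 < x -> x < y -> F x < F y.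
  move=> x0 xy; have [c] := @mvt_ex R F dF x y (ltW xy) (fun t xt => HF t (lt_le_trans x0 (andP xt).1)).
  move=> /andP[xc _] e; rewrite -subr_gt0 e mulr_gt0 ?subr_gt0//.
  by apply: dF0; exact: lt_le_trans x0 xc.
pose a n : R := n.+1%:R^-1; pose b n : R := n.+1%:R.
have a0 n : 0 < a n by rewrite invr_gt0.
have ab n : a n <= b n.
  by rewrite /a /b (@le_trans _ _ 1)// ?invf_le1 ?ler1n// ltr0n.
have am : {homo a : m n / (m <= n)%N >-> n <= m}.
  by move=> m n mn; rewrite /a lef_pV2 ?posrE ?ltr0n// ler_nat.
have bm : {homo b : m n / (m <= n)%N >-> m <= n}.
  by move=> m n mn; rewrite /b ler_nat.
have bT k : exists n, k <= b n.
  have /cvgryPge /(_ k) [n _ H] := @cvgr_idn R; exists n.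
  by rewrite (le_trans (H n (leqnn n)))// /b ler_nat.
have aT (e : R) : 0 < e -> exists n, a n <= e.
  move=> e0; have [n Hn] := bT e^-1; exists n.
  by rewrite /a -[e]invrK lef_pV2 ?posrE ?ltr0n ?invr_gt0.
have Hab (x : R) : 0 < x -> exists n, a n <= x <= b n.
  move=> x0; have [n1 h1] := bT x; have [n2 h2] := aT _ x0; exists (maxn n1 n2).
  by rewrite (le_trans _ h2) ?am ?leq_maxr// (le_trans h1) ?bm ?leq_maxl.
(* The images [[F (a n), F (b n)]] exhaust the half-line because [F] takes arbitrarily small and
   arbitrarily large values. *)
have C1 := @cvg_integral_itv0y (F \o a) (F \o b) G (fun n => F0 _ (a0 n)).
have {}C1 : (\int[mu]_(x in `[F (a n), F (b n)]) (G x)%:E)%E @[n --> \oo] -->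
  (\int[mu]_(x in `]0%R, +oo[) (G x)%:E)%E.
  apply: C1 => //.
  - by move=> m n mn; apply: Fmono => //; exact: am.
  - by move=> m n mn; apply: Fmono; [rewrite /b ltr0n|exact: bm].
  - move=> x x0; have [x1 x10 h1] := Fs _ x0; have [x2 x20 h2] := Fl x.
    have [n1 k1] := aT _ x10; have [n2 k2] := bT x2; exists (maxn n1 n2) => /=.
    rewrite (le_trans _ h1) ?Fmono// ?(le_trans _ k1) ?am ?leq_maxl//=.
    by rewrite (le_trans h2)// Fmono// (le_trans k2)// bm// leq_maxr.
have C2 := @cvg_integral_itv0y a b (fun x => G (F x) * dF x) a0 am bm Hab.
have {}C2 : (\int[mu]_(x in `[a n, b n]) (G (F x) * dF x)%:E)%E @[n --> \oo] -->
  (\int[mu]_(x in `]0%R, +oo[) (G (F x) * dF x)%:E)%E.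
  apply: C2.
  - move=> x x0; apply: cvgM; last exact: cdF.
    by apply: continuous_comp; [exact: is_derive_cont (HF x x0) | apply/cG/F0].
  - by move=> x x0; rewrite mulr_ge0// ?G0 ?F0// ltW ?dF0.
rewrite -(cvg_lim _ C1)// -(cvg_lim _ C2)//.
congr (lim (_ @ \oo)); apply/funext => n.
have dFE (x : R) : 0 < x -> (derive1 F) x = dF x.
  by move=> x0; rewrite derive1E; case: (HF x x0).
have cdFE (x : R) : 0 < x -> {for x, continuous (derive1 F)}.
  move=> x0; rewrite /prop_for /continuous_at dFE//.
  apply: cvg_trans (cdF x x0); apply: near_eq_cvg.
  near=> y; rewrite dFE//; near: y; exact: lt_nbhsr.
have bn0 : 0 < b n by rewrite ltr0n.
rewrite (@integration_by_substitution_increasing R F G (a n) (b n))//.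
- apply: eq_integral => x; rewrite inE /= in_itv /= => /andP[ax _].
  by rewrite !fctE dFE//; exact: lt_le_trans (a0 n) ax.
- move=> x y; rewrite !in_itv /= => /andP[ax _] _ xy.
  by apply: Fhomo => //; exact: lt_le_trans (a0 n) ax.
- by move=> x; rewrite in_itv /= => /andP[ax _]; apply: cdFE; exact: lt_trans ax.
- by apply: (cvgP ((derive1 F) (a n))); apply: cvg_at_right_filter; exact: cdFE.
- by apply: (cvgP ((derive1 F) (b n))); apply: cvg_at_left_filter; exact: cdFE.
- split.
  + by move=> x; rewrite in_itv /= => /andP[ax _]; case: (HF x (lt_trans (a0 n) ax)).
  + by apply: cvg_at_right_filter; exact: is_derive_cont (HF _ (a0 n)).
  + by apply: cvg_at_left_filter; exact: is_derive_cont (HF _ bn0).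
- apply: continuous_in_subspaceT => x; rewrite inE /= in_itv /= => /andP[ax _].
  by apply: cG; exact: lt_le_trans (F0 _ (a0 n)) ax.
Unshelve. all: by end_near. Qed.

End half_line.

(** * The square of Gamma(1/4) by Tonelli *)

Section gamma_quarter.
Context {R : realType}.
Local Notation mu := (@lebesgue_measure R).
Local Notation pos := (`]0%R, +oo[%classic : set R).

Lemma dpowid n (x : R) : is_derive x 1 (fun t : R => t ^+ n) (n%:R * x ^+ n.-1).
Proof. by rewrite -[X in is_derive _ _ _ X]mulr1; exact: (dpow n (did x)). Qed.

Lemma cont_derive (f : R -> R) : (forall x : R, exists a : R, is_derive x 1 f a) ->
  forall x : R, {for x, continuous f}.
Proof. by move=> H x; have [a /is_derive_cont] := H x. Qed.

Definition quart_integral : \bar R := (\int[mu]_(u in pos) (expR (- u ^+ 4))%:E)%E.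

(** Substitute [t = u^4]: the Jacobian [4 u^3] cancels [t^(-3/4)]. *)
Lemma Gamma_quart : (\int[mu]_(t in pos) (t `^ (1 / 4 - 1) * expR (- t))%:E =
  4%:E * quart_integral)%E.
Proof.
have c4 : forall u : R, {for u, continuous (fun u : R => expR (- u ^+ 4))}.
  by apply: cont_derive => x; eexists; repeat dstep.
etransitivity.
  apply: (@substitution_itv0y R (fun u => u ^+ 4) (fun u => 4 * u ^+ 3)).
  - by move=> x _; exact: dpowid.
  - by move=> x _; apply: cont_derive => {}x; eexists; repeat dstep.
  - by move=> x x0; rewrite mulr_gt0// exprn_gt0.
  - by move=> x x0; rewrite exprn_gt0.
  - move=> e e0; exists (Num.min e 1); first by rewrite lt_min e0 ltr01.
    have [e1|e1] := leP e 1; last by rewrite expr1n ltW.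
    by rewrite exprS ler_piMr ?(ltW e0)// exprn_ile1 ?(ltW e0).
  - move=> k; exists (Num.max k 1); first by rewrite lt_max ltr01 orbT.
    have [k1|k1] := leP k 1; first by rewrite expr1n.
    by rewrite exprS ler_peMr ?exprn_ege1// ltW// (lt_trans _ k1).
  - move=> y y0; apply: cvgM; first exact: (is_derive_cont (@is_derive1_powR _ _ _ y0)).
    by have /(_ _ y) := @cont_derive (fun t => expR (- t)); apply=> x; eexists; repeat dstep.
  - by move=> y y0; rewrite mulr_ge0 ?powR_ge0 ?expR_ge0.
rewrite /quart_integral -ge0_integralZl//.
  + apply: eq_integral => u; rewrite inE /= in_itv /= andbT => u0.
    rewrite -EFinM; congr EFin.
    rewrite mulrAC; congr (_ * _).
    rewrite -powR_mulrn ?ltW// -powRrM (_ : 4%:R * _ = - 3%:R); last first.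
      by field.
    rewrite powR_invn ?ltW// mulrC -mulrA divff ?mulr1//.
    by rewrite expf_neq0// gt_eqF.
  + apply/measurable_EFinP; apply: measurable_funTS.
    exact: continuous_measurable_fun.
Qed.

Lemma quart_integral_scale (u : R) : 0 < u ->
  (\int[mu]_(s in pos) (expR (- (u * s) ^+ 4) * u)%:E = quart_integral)%E.
Proof.
move=> u0; rewrite /quart_integral.
symmetry; apply: (@substitution_itv0y R (fun s => u * s) (fun _ => u) (fun y => expR (- y ^+ 4))).
- move=> x _; dauto; by ring.
- by move=> x _; exact: cvg_cst.
- by [].
- by move=> x x0; rewrite mulr_gt0.
- move=> e e0; exists (e / u); first by rewrite divr_gt0.
  by rewrite mulrC divfK// gt_eqF.
- move=> k; exists (`|k| / u + 1); first by rewrite ltr_wpDl// divr_ge0// ltW.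
  rewrite mulrDr mulrCA divff ?gt_eqF// !mulr1.
  by rewrite (le_trans (ler_norm k))// lerDl ltW.
- by move=> y _; apply: cont_derive => x; eexists; repeat dstep.
- by move=> y _; exact: expR_ge0.
Qed.

(** The Gaussian integral after the substitution [w = sqrt c * u^2]. *)
Lemma gauss_quart (c : R) : 0 < c ->
  (\int[mu]_(u in pos) (u * expR (- u ^+ 4 * c))%:E =
   (Num.sqrt pi / 4 * (Num.sqrt c)^-1)%:E)%E.
Proof.
move=> c0; have sc0 : 0 < Num.sqrt c by rewrite sqrtr_gt0.
have H : (\int[mu]_(w in pos) (expR (- w ^+ 2))%:E = (Num.sqrt pi / 2)%:E)%E.
  rewrite -integral0y_gauss -integral_itv_obnd_cbnd //.
  apply/measurable_EFinP; apply: measurable_funTS.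
  exact: measurable_gauss_fun.
have H2 : (\int[mu]_(w in pos) (expR (- w ^+ 2))%:E = \int[mu]_(u in pos)
    (expR (- (Num.sqrt c * u ^+ 2) ^+ 2) * (Num.sqrt c * (2 * u)))%:E)%E.
  apply: (@substitution_itv0y R (fun u => Num.sqrt c * u ^+ 2)
    (fun u => Num.sqrt c * (2 * u)) (fun y => expR (- y ^+ 2))).
  - move=> x _; dauto; by rewrite /=; ring.
  - by move=> x _; apply: cont_derive => {}x; eexists; repeat dstep.
  - by move=> x x0; rewrite !mulr_gt0.
  - by move=> x x0; rewrite mulr_gt0// exprn_gt0.
  - move=> e e0; exists (Num.min (e / Num.sqrt c) 1); first by rewrite lt_min divr_gt0 ?ltr01.
    rewrite mulrC -ler_pdivlMr//; have [e1|e1] := leP (e / Num.sqrt c) 1; last first.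
      by rewrite expr1n ltW.
    by rewrite exprS ler_piMr ?(ltW (divr_gt0 e0 sc0))// expr1.
  - move=> k; exists (Num.max (k / Num.sqrt c) 1); first by rewrite lt_max ltr01 orbT.
    rewrite mulrC -ler_pdivrMr//; have [k1|k1] := leP (k / _) 1; first by rewrite expr1n.
    by rewrite exprS ler_peMr ?exprn_ege1// ltW// (lt_trans _ k1).
  - by move=> y _; apply: cont_derive => x; eexists; repeat dstep.
  - by move=> y _; exact: expR_ge0.
rewrite H2 in H.
transitivity (((2 * Num.sqrt c)^-1)%:E * (Num.sqrt pi / 2)%:E)%E.
  rewrite -H -ge0_integralZl//.
  - apply: eq_integral => u _; rewrite -EFinM; congr EFin.
    rewrite exprMn sqr_sqrtr ?ltW// -exprM [c * _]mulrC mulNr.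
    by rewrite (_ : 2 * 2 = 4)%N// [RHS]mulrC; set E := expR _; field; rewrite gt_eqF.
  - apply/measurable_EFinP; apply: measurable_funTS.
    apply: continuous_measurable_fun; apply: cont_derive => {}x; eexists; repeat dstep.
  - by move=> x /=; rewrite in_itv /= andbT => x0; rewrite lee_fin !mulr_ge0 ?expR_ge0 ?ltW.
by rewrite -EFinM; congr EFin; field; rewrite gt_eqF.
Qed.

Lemma integral_indic_mul (D : set R) (f : R -> R) :
  (\int[mu]_(x in D) (f x)%:E = \int[mu]_x (\1_D x * f x)%:E)%E.
Proof.
rewrite integral_mkcond; apply: eq_integral => x _.
by rewrite /restrict /patch indicE; case: ifP => _; rewrite ?mul1r ?mul0r.
Qed.

(* Substitute [v = u s] in the inner integral and exchange the integrations. *)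
Lemma quart_integral_sqr : (quart_integral * quart_integral =
  (Num.sqrt pi / 4)%:E * \int[mu]_(s in pos) ((Num.sqrt (1 + s ^+ 4))^-1)%:E)%E.
Proof.
(* Indicators extend the integrand to the whole plane, where Tonelli applies; [z.1] is [u] and [z.2]
   is [s]. *)
pose f (z : R * R) : \bar R :=
  (\1_pos z.1 * (\1_pos z.2 * (z.1 * expR (- z.1 ^+ 4 * (1 + z.2 ^+ 4)))))%:E.
have f0 z : (0 <= f z)%E.
  rewrite /f lee_fin; have [z1|z1] := boolP (z.1 \in pos); last first.
    by rewrite indicE (negbTE z1) mul0r.
  rewrite !mulr_ge0 ?expR_ge0//.
  by move: z1; rewrite inE /= in_itv /= andbT => /ltW.
have mf : measurable_fun setT f.
  apply/measurable_EFinP; apply: measurable_funM.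
    by apply: measurableT_comp => //; exact: measurable_indic.
  apply: measurable_funM.
    by apply: measurableT_comp => //; exact: measurable_indic.
  apply: measurable_funM => //; apply: measurableT_comp => //.
  apply: measurable_funM; first by apply: measurableT_comp => //; exact: measurable_funX.
  by apply: measurable_funD => //; exact: measurable_funX.
have T : (\int[mu]_x \int[mu]_y f (x, y) = \int[mu]_y \int[mu]_x f (x, y))%E.
  by apply: fubini_tonelli.
have J0 : (0 <= quart_integral)%E by apply: integral_ge0 => u _; rewrite lee_fin expR_ge0.
have mq : measurable_fun pos (fun u : R => (expR (- u ^+ 4))%:E).
  apply/measurable_EFinP; apply: measurable_funTS; apply: continuous_measurable_fun.
  by apply: cont_derive => x; eexists; repeat dstep.
have E1 : (\int[mu]_x \int[mu]_y f (x, y) = quart_integral * quart_integral)%E.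
  transitivity (\int[mu]_(u in pos) (quart_integral * (expR (- u ^+ 4))%:E))%E.
    rewrite [RHS]integral_mkcond; apply: eq_integral => u _.
    rewrite /restrict /patch; case: ifPn => up; last first.
      by apply: integral0_eq => s _; rewrite /f /= indicE (negbTE up) mul0r.
    have u0 : 0 < u by move: up; rewrite inE /= in_itv /= andbT.
    rewrite -(quart_integral_scale u0) muleC -ge0_integralZl; first last.
    - by rewrite lee_fin expR_ge0.
    - by move=> s _; rewrite lee_fin; apply: mulr_ge0; [exact: expR_ge0|exact: ltW].
    - apply/measurable_EFinP; apply: measurable_funTS.
      by apply: continuous_measurable_fun; apply: cont_derive => x; eexists; repeat dstep.
    - exact: measurable_itv.
    rewrite [RHS]integral_indic_mul; apply: eq_integral => s _.
    rewrite /f /= indicE up mul1r; congr EFin; congr (_ * _).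
    by rewrite [RHS]mulrA -expRD mulrC; congr (expR _ * _); rewrite exprMn; ring.
  by rewrite {3}/quart_integral ge0_integralZl.
have E2 : (\int[mu]_y \int[mu]_x f (x, y) = (Num.sqrt pi / 4)%:E *
   \int[mu]_(s in pos) ((Num.sqrt (1 + s ^+ 4))^-1)%:E)%E.
  have s1 (s : R) : 0 < 1 + s ^+ 4 by have := sqr_ge0 (s ^+ 2); rewrite -exprM => h; apply: ltr_pwDl.
  have ms : measurable_fun pos (fun s : R => ((Num.sqrt (1 + s ^+ 4))^-1)%:E).
    apply/measurable_EFinP; apply: measurable_funTS.
    apply: continuous_measurable_fun => x; apply: cvgV; first by rewrite gt_eqF ?sqrtr_gt0.
    apply: continuous_comp; last exact: sqrt_continuous.
    by apply: cont_derive => {}x; eexists; repeat dstep.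
  rewrite -ge0_integralZl; first last.
  - by rewrite lee_fin divr_ge0 ?sqrtr_ge0.
  - by move=> s _; rewrite lee_fin invr_ge0 sqrtr_ge0.
  - exact: ms.
  - exact: measurable_itv.
  rewrite [RHS]integral_mkcond; apply: eq_integral => s _.
  rewrite /restrict /patch; case: ifPn => sp; last first.
    by apply: integral0_eq => u _; rewrite /f /= [X in _ * (X * _)]indicE (negbTE sp) mul0r mulr0.
  rewrite -EFinM -(gauss_quart (s1 s)) [RHS]integral_indic_mul; apply: eq_integral => u _.
  by rewrite /f /= [X in _ * (X * _)]indicE sp mul1r.
exact: (eq_trans (esym E1) (eq_trans T E2)).
Qed.

Lemma Gamma_quarter_sqr (L : R) :
  (\int[mu]_(s in pos) ((Num.sqrt (1 + s ^+ 4))^-1)%:E = L%:E)%E ->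
  Gamma (1 / 4 : R) ^+ 2 = 4 * Num.sqrt pi * L.
Proof.
move=> HL; have := quart_integral_sqr; rewrite HL -EFinM => H.
have J0 : (0 <= quart_integral)%E by apply: integral_ge0 => u _; rewrite lee_fin expR_ge0.
have Jfin : quart_integral \is a fin_num.
  by rewrite fin_numE; move: H J0; case: quart_integral => [r| |] //.
rewrite /Gamma /Rintegral Gamma_quart.
move: H; rewrite -(fineK Jfin) -!EFinM => -[H] /=.
by rewrite exprMn expr2 expr2 H; field.
Qed.

End gamma_quarter.

(** * Cosine series in closed form *)

Section cosine_series.
Context {R : realType}.
Implicit Types (x : R) (c M : nat -> R).

(** Tannery's theorem. The filter is arbitrary so that it also covers limits within [Q], at boundary
    points. *)
Lemma cvg_series_filter (T : Type) (Fl : set_system T) {FF : ProperFilter Fl}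
    (F : nat -> T -> R) (l M : nat -> R) :
  (forall k, F k @ Fl --> l k) -> cvgn (series M) ->
  (\forall t \near Fl, forall k, `|F k t| <= M k) ->
  (fun t => limn (series (fun k => F k t))) @ Fl --> limn (series l).
Proof.
move=> Fkl cM FM.
have lM k : `|l k| <= M k.
  have C : (fun t => `|F k t|) @ Fl --> `|l k| by apply: cvg_norm; exact: Fkl.
  apply: (closed_cvg (fun y : R => y <= M k) _ _ _ C).
    by exact: closed_le.
  by near=> t; have : forall k, `|F k t| <= M k by near: t.
apply/cvgrPdist_le => e e0.
have e3 : 0 < e / 3 by rewrite divr_gt0.
have [N HN] := series_tail_small cM e3.
have CN : (fun t => series (fun k => F k t) N) @ Fl --> series l N.
  elim: {HN} N => [|N IH].
    rewrite /series /= big_nil; under eq_fun do rewrite big_nil; exact: cvg_cst.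
  by rewrite seriesSr; under eq_fun do rewrite seriesSr; exact: cvgD.
move/cvgrPdist_le : CN => /(_ _ e3) CN.
near=> t.
have T1 : `|limn (series l) - series l N| <= e / 3 by apply: le_trans HN; exact: series_tail.
have Ft : forall k, `|F k t| <= M k by near: t.
have T2 : `|limn (series (F^~ t)) - series (F^~ t) N| <= e / 3.
  by apply: le_trans HN; exact: series_tail.
have T3 : `|series l N - series (F^~ t) N| <= e / 3 by near: t.
move: T1 T2 T3; set A := limn _; set B := series l N; set C := limn _; set D := series _ _.
move=> T1 T2 T3; rewrite (_ : A - C = (A - B) + (B - D) - (C - D)); last by ring.
rewrite (le_trans (ler_normB _ _))// (le_trans (lerD (ler_normD _ _) (lexx _)))//.
by rewrite (_ : e = e / 3 + e / 3 + e / 3); [rewrite !lerD|field].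
Unshelve. all: by end_near. Qed.

Lemma inv_sqr_bound n : series (fun k => (k.+1%:R ^+ 2)^-1 : R) n.+1 <= 2 - (n.+1%:R)^-1.
Proof.
elim: n => [|n IH].
  by rewrite /series /= big_nat1 expr1n invr1; lra.
rewrite seriesSr (le_trans (lerD IH (lexx _)))//.
have n1 : 0 < n.+1%:R :> R by rewrite ltr0n.
rewrite -(natr1 n.+1); set a := n.+1%:R in n1 *.
have -> : 2 - a^-1 + ((a + 1) ^+ 2)^-1 = 2 - (a + 1)^-1 - (a * (a + 1) ^+ 2)^-1.
  by field; rewrite !gt_eqF// addr_gt0.
by rewrite gerBl invr_ge0 mulr_ge0 ?exprn_ge0 ?ltW// addr_gt0.
Qed.

Lemma cvg_inv_sqr : cvgn (series (fun k => (k.+1%:R ^+ 2)^-1 : R)).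
Proof.
apply: nondecreasing_is_cvgn.
  by apply/nondecreasing_seqP => n; rewrite seriesSr lerDl invr_ge0 exprn_ge0.
exists 2 => _ [[|n] _ <-]; first by rewrite /series /= big_nil.
by rewrite (le_trans (inv_sqr_bound n))// gerBl invr_ge0.
Qed.

Definition cosser c x : R := limn (series (fun k => c k * cos (k.+1%:R * x))).
Definition sinser c x : R := limn (series (fun k => c k * sin (k.+1%:R * x))).

Lemma cosser_cvg c M x : (forall k, `|c k| <= M k) -> cvgn (series M) ->
  sums (fun k => c k * cos (k.+1%:R * x)) (cosser c x).
Proof.
move=> cMk cM; apply: abs_cvg_series cM => k.
by rewrite normrM (le_trans _ (cMk k))// ler_piMr// cos_max.
Qed.

Lemma sinser_cvg c M x : (forall k, `|c k| <= M k) -> cvgn (series M) ->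
  sums (fun k => c k * sin (k.+1%:R * x)) (sinser c x).
Proof.
move=> cMk cM; apply: abs_cvg_series cM => k.
by rewrite normrM (le_trans _ (cMk k))// ler_piMr// sin_max.
Qed.

Lemma cosser_derive c M x : (forall k, k.+1%:R * `|c k| <= M k) -> cvgn (series M) ->
  is_derive x 1 (cosser c) (sinser (fun k => - (k.+1%:R * c k)) x).
Proof.
move=> cMk cM.
have cM' k : `|c k| <= M k.
  by apply: le_trans (cMk k); rewrite ler_peMl// ler1n.
rewrite /cosser /sinser.
apply: (@is_derive_series R (fun k t => c k * cos (k.+1%:R * t))
   (fun k t => - (k.+1%:R * c k) * sin (k.+1%:R * t)) M (x - 1) (x + 1)).
- by move=> k t _; dauto; ring.
- move=> k t _; rewrite normrM normrN normrM ger0_norm// (le_trans _ (cMk k))//.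
  by rewrite ler_piMr ?sin_max// mulr_ge0.
- exact: cM.
- by move=> t _; exact: (sums_cvg (cosser_cvg cM' cM)).
- by apply/andP; split; lra.
Qed.

Lemma sinser_derive c M x : (forall k, k.+1%:R * `|c k| <= M k) -> cvgn (series M) ->
  is_derive x 1 (sinser c) (cosser (fun k => k.+1%:R * c k) x).
Proof.
move=> cMk cM.
have cM' k : `|c k| <= M k.
  by apply: le_trans (cMk k); rewrite ler_peMl// ler1n.
rewrite /cosser /sinser.
apply: (@is_derive_series R (fun k t => c k * sin (k.+1%:R * t))
   (fun k t => k.+1%:R * c k * cos (k.+1%:R * t)) M (x - 1) (x + 1)).
- by move=> k t _; dauto; ring.
- move=> k t _; rewrite normrM normrM ger0_norm// (le_trans _ (cMk k))//.
  by rewrite ler_piMr ?cos_max// mulr_ge0.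
- exact: cM.
- by move=> t _; exact: (sums_cvg (sinser_cvg cM' cM)).
- by apply/andP; split; lra.
Qed.

Lemma sin_natpi n : sin (n%:R * pi) = 0 :> R.
Proof.
elim: n => [|n IH]; first by rewrite mul0r sin0.
by rewrite -natr1 mulrDl mul1r sinDpi IH oppr0.
Qed.

Lemma cos_natpi n : cos (n%:R * pi) = (-1) ^+ n :> R.
Proof.
elim: n => [|n IH]; first by rewrite mul0r cos0.
by rewrite -natr1 mulrDl mul1r cosDpi IH exprS mulN1r.
Qed.

Lemma sinser0 c : sinser c 0 = 0.
Proof.
rewrite /sinser (_ : (fun k => _) = fun=> 0).
  by apply: sums_lim; rewrite /sums /series /=; under eq_fun do rewrite big1_eq; exact: cvg_cst.
by apply/funext => k; rewrite mulr0 sin0 mulr0.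
Qed.

Lemma sinserpi c : sinser c pi = 0.
Proof.
rewrite /sinser (_ : (fun k => _) = fun=> 0).
  by apply: sums_lim; rewrite /sums /series /=; under eq_fun do rewrite big1_eq; exact: cvg_cst.
by apply/funext => k; rewrite sin_natpi mulr0.
Qed.

(* Energy argument: [z * z1] is nondecreasing and vanishes at both ends. *)
Lemma neumann_unique (z z1 : R -> R) (nu : R) : 0 < nu ->
  (forall x, 0 <= x <= pi -> is_derive x 1 z (z1 x)) ->
  (forall x, 0 <= x <= pi -> is_derive x 1 z1 (nu ^+ 2 * z x)) ->
  z1 0 = 0 -> z1 pi = 0 -> forall x, 0 <= x <= pi -> z x = 0.
Proof.
move=> nu0 Hz Hz1 z10 z1pi.
have p0 : 0 <= pi :> R := @pi_ge0 R.
have Hp a b : 0 <= a -> a <= b -> b <= pi -> z a * z1 a <= z b * z1 b.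
  move=> a0 ab bpi.
  apply: (mvt_mono (f := fun t => z t * z1 t)
    (df := fun t => z1 t * z1 t + z t * (nu ^+ 2 * z t)) ab) => t /andP[at_ tb].
    have tp : 0 <= t <= pi by rewrite (le_trans a0 at_) (le_trans tb).
    exact: (dmul (Hz t tp) (Hz1 t tp)).
  rewrite -expr2 (mulrCA (z t)) -expr2.
  by apply: addr_ge0; [|apply: mulr_ge0]; exact: sqr_ge0.
have pz t : 0 <= t <= pi -> z t * z1 t = 0.
  move=> /andP[t0 tpi]; apply/eqP; rewrite eq_le.
  have := Hp t pi t0 tpi (lexx _); rewrite z1pi mulr0 => ->.
  by have := Hp 0 t (lexx _) t0 tpi; rewrite z10 mulr0 => ->.
have z2 t : 0 <= t <= pi -> z t ^+ 2 = z 0 ^+ 2.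
  move=> /andP[t0 tpi]; symmetry.
  apply: (mvt_cst (f := fun t => z t ^+ 2) (df := fun t => 2 * z t ^+ 1 * z1 t) t0).
    move=> s /andP[s0 st]; apply: (dpow 2 (Hz s _)).
    by rewrite s0 (le_trans st tpi).
  move=> s /andP[s0 st]; rewrite expr1 -mulrA pz ?mulr0//.
  by rewrite s0 (le_trans st tpi).
(* As [z1] vanishes at both ends, its derivative [nu ^+ 2 * z] has a zero [c]; since [z ^+ 2] is
   constant, [z] vanishes everywhere. *)
have [c c0pi] := mvt_ex p0 Hz1.
rewrite z10 z1pi subrr => /esym/eqP; rewrite subr0 mulf_eq0 (gt_eqF (@pi_gt0 R)) orbF.
rewrite mulf_eq0 sqrf_eq0 (gt_eqF nu0) /= => /eqP zc.
move=> x x0pi; have := z2 x x0pi; rewrite -(z2 c c0pi) zc [in RHS]expr0n mulr0n => /eqP.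
by rewrite sqrf_eq0 => /eqP.
Qed.

End cosine_series.

(** * The series of cos (k x) / k^2 *)

Section closed_forms.
Context {R : realType}.
Implicit Types x nu : R.

Lemma cvg0_harmonic (u : nat -> R) (C : R) :
  (forall n, `|u n| <= C * harmonic n) -> u @ \oo --> 0.
Proof.
move=> H; have Ch : C * harmonic n @[n --> \oo] --> 0.
  by rewrite -[X in _ --> X](mulr0 C); apply: cvgM; [exact: cvg_cst|exact: cvg_harmonic].
apply: (@squeeze_cvgr _ _ _ _ (fun n => - (C * harmonic n)) (fun n => C * harmonic n)) => //.
  by near=> n; rewrite -ler_norml; exact: H.
by rewrite -[X in _ --> X]oppr0; exact: cvgN.
Unshelve. all: by end_near. Qed.

Lemma dirichlet_kernel K x : 2 * sin (x / 2) *
  (1 / 2 + \sum_(0 <= k < K) cos (k.+1%:R * x)) = sin ((K%:R + 1 / 2) * x).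
Proof.
elim: K => [|K IH].
  rewrite big_nil addr0 (_ : (0%:R + 1 / 2) * x = x / 2); last by field.
  by field.
rewrite big_nat_recr//= addrA mulrDr IH.
rewrite (_ : (K%:R + 1 / 2) * x = K.+1%:R * x - x / 2); last by rewrite -natr1; field.
rewrite (_ : (K.+1%:R + 1 / 2) * x = K.+1%:R * x + x / 2); last by rewrite -natr1; field.
by rewrite sinB sinD; ring.
Qed.

Definition isq k : R := (k.+1%:R ^+ 2)^-1.

Lemma isq_le k : `|isq k| <= isq k.
Proof. by rewrite ger0_norm// invr_ge0 exprn_ge0. Qed.

Lemma cos_halfpi K : cos ((K%:R + 1 / 2) * pi) = 0 :> R.
Proof.
rewrite (_ : _ * pi = K%:R * pi + pi / 2); last by field.
by rewrite cosDpihalf sin_natpi oppr0.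
Qed.

(** Two derivatives turn the partial sum minus the parabola into the negative of a Dirichlet kernel.
    Integrated back from [pi], where the first derivative [S] vanishes, its oscillation gains a
    factor [1 / K]; this is uniform on [[x, pi]] because [sin (t / 2)] stays above [sin (x / 2)]. *)
Lemma partial_isq_bound K x : 0 < x <= pi ->
  `|(series (fun k => isq k * cos (k.+1%:R * pi)) K)
   - (series (fun k => isq k * cos (k.+1%:R * x)) K - (x - pi) ^+ 2 / 4)|
  <= ((2 * sin (x / 2) ^+ 2)^-1 * pi + (sin (x / 2))^-1) * pi * harmonic K.
Proof.
move=> /andP[x0 xpi]; set m := sin (x / 2).
have pi0 : 0 < pi :> R := @pi_gt0 R.
have sinm (t : R) : x <= t <= pi -> m <= sin (t / 2).
  move=> /andP[]; rewrite le_eqVlt => /predU1P[<- //|xt tpi].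
  by rewrite /m ltW// ltr_sin ?in_itv /=; lra.
have m0 : 0 < m by rewrite /m sin_gt0_pi//; lra.
pose S (t : R) := - (\sum_(0 <= k < K) (k.+1%:R)^-1 * sin (k.+1%:R * t)) - (t - pi) / 2.
(* The boundary term of an integration by parts of the Dirichlet kernel: [S - Cc] has a derivative
   of order [1 / K]. *)
pose Cc (t : R) := cos ((K%:R + 1 / 2) * t) * ((2 * K%:R + 1) * sin (t / 2))^-1.
have K1 : 0 < 2 * K%:R + 1 :> R by rewrite ltr_wpDl// mulr_ge0.
have dSC (t : R) : x <= t <= pi -> is_derive t 1 (fun t => S t - Cc t)
   (cos ((K%:R + 1 / 2) * t) * cos (t / 2) / (2 * (2 * K%:R + 1) * sin (t / 2) ^+ 2)).
  move=> xt; have st : sin (t / 2) != 0 by rewrite gt_eqF// (lt_le_trans m0)// sinm.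
  have D1 : isd (fun t => \sum_(0 <= k < K) (k.+1%:R)^-1 * sin (k.+1%:R * t)) t
     (\sum_(0 <= k < K) cos (k.+1%:R * t)).
    apply: (@dsum R nat _ (fun k s => (k.+1%:R)^-1 * sin (k.+1%:R * s)) (fun k s => cos (k.+1%:R * s))) => k.
    have := pnatr_eq0 R k.+1; set a : R := k.+1%:R => /negbT k0.
    by eapply derive_conv; [repeat dstep|rewrite /=; field].
  eapply derive_conv.
    rewrite /S /Cc; eapply dadd; [|eapply dopp; eapply dmul; [|eapply dinv]]; first last.
    - by repeat dstep.
    - by rewrite mulf_neq0 ?gt_eqF// (lt_le_trans m0)// sinm.
    - by repeat dstep.
    - by eapply dadd; [eapply dopp; exact: D1 | repeat dstep].
  have := dirichlet_kernel K t; rewrite /=.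
  set A := \sum_(_ <= _ < _) _; set s := sin ((_ + _) * t) => H.
  have -> : A = s / (2 * sin (t / 2)) - 1 / 2 by rewrite -H; field.
  by field; rewrite st gt_eqF.
have SCpi : S pi - Cc pi = 0.
  rewrite /S /Cc cos_halfpi mul0r subrr mul0r !subr0 big1 ?oppr0// => k _.
  by rewrite sin_natpi mulr0.
have bSC (t : R) : x <= t <= pi -> `|S t - Cc t| <= (2 * m ^+ 2)^-1 * harmonic K * pi.
  move=> /andP[xt tpi].
  have := mvt_le tpi (fun s (st : t <= s <= pi) => dSC s (introT andP (conj (le_trans xt (andP st).1) (andP st).2))).
  move=> /(_ ((2 * m ^+ 2)^-1 * harmonic K)).
  rewrite SCpi sub0r normrN => H; apply: (le_trans (H _)).
    move=> s /andP[ts spi]; have xs : x <= s <= pi by rewrite (le_trans xt).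
    have ms := sinm s xs; have s0 := lt_le_trans m0 ms.
    rewrite normrM [X in _ * X]ger0_norm; last first.
      by rewrite invr_ge0 mulr_ge0 ?exprn_ge0 ?(ltW s0)// mulr_ge0 ?(ltW K1).
    rewrite (@le_trans _ _ (1 * (2 * (2 * K%:R + 1) * sin (s / 2) ^+ 2)^-1))//.
      apply: ler_wpM2r; last by rewrite normrM mulr_ile1 ?cos_max.
      by rewrite invr_ge0 mulr_ge0 ?exprn_ge0 ?(ltW s0)// mulr_ge0 ?(ltW K1).
    rewrite mul1r /harmonic /= -invfM lef_pV2 ?posrE ?mulr_gt0 ?exprn_gt0//.
    rewrite [leRHS]mulrAC; apply: ler_pM.
    - by rewrite mulr_ge0// exprn_ge0// ltW.
    - by [].
    - by apply: ler_wpM2l => //; rewrite ler_pXn2r// ?nnegrE ltW.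
    - by rewrite -natr1 lerD2r mulr_natl mulr2n lerDl.
  apply: ler_wpM2l; last by lra.
  by rewrite mulr_ge0 ?harmonic_ge0// invr_ge0 mulr_ge0// exprn_ge0// ltW.
have bC (t : R) : x <= t <= pi -> `|Cc t| <= m^-1 * harmonic K.
  move=> xt; have ms := sinm t xt; have s0 := lt_le_trans m0 ms.
  rewrite /Cc normrM (ger0_norm (_ : 0 <= _^-1)); last by rewrite invr_ge0 mulr_ge0 ?ltW.
  rewrite (@le_trans _ _ (1 * ((2 * K%:R + 1) * sin (t / 2))^-1))//.
    by rewrite ler_wpM2r ?cos_max// invr_ge0 mulr_ge0 ?(ltW K1) ?(ltW s0).
  rewrite mul1r /harmonic /= -invfM lef_pV2 ?posrE ?mulr_gt0//.
  rewrite mulrC; apply: ler_pM => //; first exact: ltW.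
  by rewrite -natr1 lerD2r mulr_natl mulr2n lerDl.
pose T (t : R) := series (fun k => isq k * cos (k.+1%:R * t)) K - (t - pi) ^+ 2 / 4.
have dT (t : R) : is_derive t 1 T (S t).
  have D1 : isd (fun t => \sum_(0 <= k < K) isq k * cos (k.+1%:R * t)) t
     (\sum_(0 <= k < K) - ((k.+1%:R)^-1 * sin (k.+1%:R * t))).
    apply: (@dsum R nat _ (fun k s => isq k * cos (k.+1%:R * s)) (fun k s => - ((k.+1%:R)^-1 * sin (k.+1%:R * s)))) => k.
    rewrite /isq; have := pnatr_eq0 R k.+1; set a : R := k.+1%:R => /negbT k0.
    by eapply derive_conv; [repeat dstep|rewrite /=; field].
  rewrite /T /S /series; eapply derive_conv; first by eapply dadd; [exact: D1|repeat dstep].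
  by rewrite sumrN /=; field.
have := @mvt_le R T S x pi (((2 * m ^+ 2)^-1 * pi + m^-1) * harmonic K) xpi (fun t _ => dT t).
rewrite /T subrr expr0n /= mul0r subr0 => H.
apply: le_trans (H _) _.
  move=> t xt; rewrite -(subrK (Cc t) (S t)) (le_trans (ler_normD _ _))//.
  by rewrite mulrDl lerD ?bC// mulrAC bSC.
rewrite mulrAC; apply: ler_wpM2r; first exact: harmonic_ge0.
apply: ler_wpM2l; last by lra.
by rewrite addr_ge0 ?invr_ge0 ?(ltW m0)// mulr_ge0 ?(ltW pi0)// invr_ge0 mulr_ge0// exprn_ge0// ltW.
Qed.

Definition bern x : R := cosser isq x.

Lemma bern_sums x : sums (fun k => isq k * cos (k.+1%:R * x)) (bern x).
Proof. exact: (cosser_cvg isq_le cvg_inv_sqr). Qed.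

Lemma bern_pos x : 0 < x <= pi -> bern x = bern pi + (x - pi) ^+ 2 / 4.
Proof.
move=> x0pi.
have C0 := cvg0_harmonic (fun K => partial_isq_bound K x0pi).
have C1 : ((series (fun k => isq k * cos (k.+1%:R * pi)) K)
   - (series (fun k => isq k * cos (k.+1%:R * x)) K - (x - pi) ^+ 2 / 4))
   @[K --> \oo] --> bern pi - (bern x - (x - pi) ^+ 2 / 4).
  apply: cvgB; first exact: bern_sums.
  by apply: cvgB; [exact: bern_sums|exact: cvg_cst].
by have e := cvgn_uniq C0 C1; set q := _ / 4 in e *; lra.
Qed.

Lemma bern_cont x : {for x, continuous bern}.
Proof.
apply: (@cvg_series_filter R R (nbhs x) _ (fun k t => isq k * cos (k.+1%:R * t))
  (fun k => isq k * cos (k.+1%:R * x)) isq).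
- move=> k; have := @is_derive_cont R (fun t => isq k * cos (k.+1%:R * t)) x.
  by apply; repeat dstep.
- exact: cvg_inv_sqr.
- by near=> t; move=> k; rewrite normrM ger0_norm ?invr_ge0 ?exprn_ge0// ler_piMr ?cos_max// invr_ge0 exprn_ge0.
Unshelve. all: by end_near. Qed.

(** The bound used on []0, pi]] degenerates at [0] through [1 / sin (x / 2)]; continuity supplies
    the endpoint. *)
Lemma bern0pi x : 0 <= x <= pi -> bern x = bern pi + (x - pi) ^+ 2 / 4.
Proof.
move=> /andP[]; rewrite le_eqVlt => /predU1P[<- _|x0 xpi]; last by rewrite bern_pos ?x0.
have C1 : bern x @[x --> 0^'+] --> bern 0 by apply: cvg_at_right_filter; exact: bern_cont.
have C2 : bern pi + (x - pi) ^+ 2 / 4 @[x --> 0^'+] --> bern pi + (0 - pi) ^+ 2 / 4.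
  apply: cvg_at_right_filter.
  have := @is_derive_cont R (fun x => bern pi + (x - pi) ^+ 2 / 4) 0; apply; repeat dstep.
apply: (cvg_uniq C1); apply: cvg_trans C2; apply: near_eq_cvg.
near=> y; apply/esym/bern_pos/andP; split => //.
by near: y; apply: nbhs_right_le; exact: pi_gt0.
Unshelve. all: by end_near. Qed.

(** Odd frequencies cancel between [0] and [pi], and even ones [2 j] contribute [2 / (2 j)^2].
    Together with the parabola this fixes the constant [bern pi]. *)
Lemma bern_double : bern 0 + bern pi = bern 0 / 2.
Proof.
have S n : series (fun k => isq k * cos (k.+1%:R * 0) + isq k * cos (k.+1%:R * pi)) n.*2 =
   2^-1 * series (fun k => isq k * cos (k.+1%:R * 0)) n :> R.
  elim: n => [|n IH]; first by rewrite /series /= !big_nil mulr0.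
  have e1 : (-1) ^+ n.*2.+1 = -1 :> R by rewrite exprS -mul2n exprM sqrrN expr1n expr1n mulr1.
  have e2 : (-1) ^+ n.*2.+2 = 1 :> R by rewrite exprS e1 mulrNN mulr1.
  rewrite doubleS !seriesSr IH !mulr0 !cos0 !cos_natpi e1 e2 /isq.
  rewrite (_ : n.*2.+2%:R = 2 * n.+1%:R :> R); last by rewrite -natrM; congr _%:R; lia.
  by field; rewrite !nat1r !pnatr_eq0.
have C1 := sumsD (@bern_sums 0) (@bern_sums pi).
have C2 : series (fun k => isq k * cos (k.+1%:R * 0) + isq k * cos (k.+1%:R * pi)) n.*2
   @[n --> \oo] --> bern 0 + bern pi.
  apply: cvg_comp C1 => A [N _ HN]; exists N => // n /= Nn; apply: HN => /=.
  by rewrite -addnn (leq_trans Nn)// leq_addr.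
apply: (cvgn_uniq C2); rewrite (funext S) mulrC.
by apply: cvgM; [exact: cvg_cst|exact: bern_sums].
Qed.

Lemma bern_pi : bern pi = - pi ^+ 2 / 12.
Proof.
have := bern_double; have : 0 <= (0 : R) <= pi by rewrite lexx pi_ge0.
by move/bern0pi => ->; rewrite sub0r sqrrN => h; lra.
Qed.

End closed_forms.

(** * Row sums of the Fourier series as hyperbolic functions *)

Section partial_fractions.
Context {R : realType} (nu : R).
Hypothesis nu0 : 0 < nu.
Implicit Types x : R.

Let den k : R := k.+1%:R ^+ 2 + nu ^+ 2.

Let natS_ge1 k : 1 <= k.+1%:R :> R. Proof. by rewrite ler1n. Qed.

Let den_gt0 k : 0 < den k.
Proof. by rewrite addr_gt0// exprn_gt0. Qed.

Let den_ge_sqr k : k.+1%:R ^+ 2 <= den k.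
Proof. by rewrite lerDl sqr_ge0. Qed.

Let den_ge k : k.+1%:R <= den k.
Proof. by rewrite (le_trans _ (den_ge_sqr k))// expr2 ler_peMl. Qed.

Let denV_le k : (den k)^-1 <= isq k.
Proof. by rewrite /isq lef_pV2 ?posrE ?exprn_gt0. Qed.

Let ch k : R := (den k)^-1.
(** The series with coefficients [ch] decays too slowly for two termwise derivatives. Since
    [isq k - ch k = nu ^+ 2 * cr k], it differs from the known [bern] by a series with coefficients
    of order [k^-4], which admits them. *)
Let cr k : R := isq k / den k.
Let cg k : R := (den k ^+ 2)^-1.

Let isq_gt0 k : 0 < isq k :> R. Proof. by rewrite invr_gt0 exprn_gt0. Qed.

Let ch_le k : `|ch k| <= isq k.
Proof. by rewrite /ch ger0_norm ?invr_ge0 ?(ltW (den_gt0 k))//; exact: denV_le. Qed.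

Let cr1_le k : k.+1%:R * `|cr k| <= isq k.
Proof.
rewrite /cr ger0_norm; last by rewrite divr_ge0 ?(ltW (den_gt0 k)) ?(ltW (isq_gt0 k)).
by rewrite mulrCA ler_piMr ?(ltW (isq_gt0 k))// ler_pdivrMr ?den_gt0// mul1r den_ge.
Qed.

Let cr2E k : k.+1%:R * (k.+1%:R * cr k) = ch k.
Proof. by rewrite /cr /ch /isq; field; rewrite nat1r pnatr_eq0 gt_eqF. Qed.

Let cr2_le k : k.+1%:R * `|- (k.+1%:R * cr k)| <= isq k.
Proof.
have <- : `|k.+1%:R * (k.+1%:R * cr k)| = k.+1%:R * `|- (k.+1%:R * cr k)|.
  by rewrite normrN normrM ger0_norm.
by rewrite cr2E.
Qed.

Let cg1_le k : k.+1%:R * `|cg k| <= isq k.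
Proof.
rewrite /cg ger0_norm ?invr_ge0 ?exprn_ge0 ?(ltW (den_gt0 k))//.
rewrite expr2 invfM mulrA; apply: (@le_trans _ _ (1 * (den k)^-1)); last by rewrite mul1r.
by apply: ler_wpM2r; [rewrite invr_ge0 (ltW (den_gt0 k))|rewrite ler_pdivrMr ?den_gt0// mul1r den_ge].
Qed.

Let cg2_le k : k.+1%:R * `|- (k.+1%:R * cg k)| <= isq k.
Proof.
rewrite normrN normrM (ger0_norm (_ : 0 <= k.+1%:R))// mulrA -expr2.
rewrite /cg ger0_norm ?invr_ge0 ?exprn_ge0 ?(ltW (den_gt0 k))//.
rewrite expr2 invfM mulrA; apply: (@le_trans _ _ (1 * (den k)^-1)); last by rewrite mul1r.
by apply: ler_wpM2r; [rewrite invr_ge0 (ltW (den_gt0 k))|rewrite ler_pdivrMr ?den_gt0// mul1r den_ge_sqr].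
Qed.

Let cr_le k : `|cr k| <= isq k.
Proof. by apply: le_trans (cr1_le k); rewrite ler_peMl. Qed.
Let cg_le k : `|cg k| <= isq k.
Proof. by apply: le_trans (cg1_le k); rewrite ler_peMl. Qed.

Let cr2ser x : cosser (fun k => k.+1%:R * - (k.+1%:R * cr k)) x =
  nu ^+ 2 * cosser cr x - bern x.
Proof.
have S1 := sumsB (@sumsZ _ _ (nu ^+ 2) _ (@cosser_cvg R cr isq x cr_le cvg_inv_sqr)) (@bern_sums R x).
rewrite /cosser; apply: sums_lim; apply: sums_eq S1 => k.
rewrite /= mulrN cr2E mulrA -mulrBl; congr (_ * _); rewrite /ch /cr /isq.
by rewrite /den; field; rewrite nat1r pnatr_eq0/= gt_eqF// den_gt0.
Qed.

Let chser x : cosser ch x = bern x - nu ^+ 2 * cosser cr x.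
Proof.
have S1 := sumsB (@bern_sums R x) (@sumsZ _ _ (nu ^+ 2) _ (@cosser_cvg R cr isq x cr_le cvg_inv_sqr)).
rewrite /cosser; apply: sums_lim; apply: sums_eq S1 => k.
rewrite /= mulrA -mulrBl; congr (_ * _); rewrite /ch /cr /isq.
by rewrite /den; field; rewrite nat1r pnatr_eq0/= gt_eqF// den_gt0.
Qed.

Let S := sinh (nu * pi).
Let C := cosh (nu * pi).

Let S0 : S != 0.
Proof. by rewrite gt_eqF// sinh_gt0// mulr_gt0 ?pi_gt0. Qed.

Let nun0 : nu != 0. Proof. by rewrite gt_eqF. Qed.

Lemma cosser_ch x : 0 <= x <= pi ->
  cosser ch x = pi / (2 * nu * S) * cosh (nu * (pi - x)) - (2 * nu ^+ 2)^-1.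
Proof.
move=> xpi; rewrite chser bern0pi//.
(* The difference between the series and its candidate: it solves [z'' = nu^2 z] with vanishing
   derivative at both ends, so [neumann_unique] applies. *)
pose z t := cosser cr t - ((bern pi + (t - pi) ^+ 2 / 4) / nu ^+ 2 + (2 * nu ^+ 4)^-1)
  + pi / (2 * nu ^+ 3 * S) * cosh (nu * (pi - t)).
pose z1 t := sinser (fun k => - (k.+1%:R * cr k)) t - (t - pi) / (2 * nu ^+ 2)
  - pi / (2 * nu ^+ 2 * S) * sinh (nu * (pi - t)).
have : z x = 0.
  apply: (@neumann_unique R z z1 nu nu0) => //.
  - move=> t _; rewrite /z /z1; eapply derive_conv.
      eapply dadd; [eapply dadd; [exact: (cosser_derive t cr1_le cvg_inv_sqr)|]|]; repeat hstep.
    by rewrite /=; field; rewrite S0 nun0.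
  - move=> t tpi; rewrite /z /z1; eapply derive_conv.
      eapply dadd; [eapply dadd; [exact: (sinser_derive t cr2_le cvg_inv_sqr)|]|]; repeat hstep.
    by rewrite /= cr2ser bern0pi//; field; rewrite S0 nun0.
  - by rewrite /z1 sinser0 sub0r subr0 -/S; field; rewrite S0 nun0.
  - by rewrite /z1 sinserpi !subrr mul0r mulr0 sinh0 mulr0 !subr0.
rewrite /z => /eqP; rewrite addrAC subr_eq0 => /eqP H.
have -> : cosser cr x = ((bern pi + (x - pi) ^+ 2 / 4) / nu ^+ 2 + (2 * nu ^+ 4)^-1) -
   pi / (2 * nu ^+ 3 * S) * cosh (nu * (pi - x)) by rewrite -H; ring.
by field; rewrite S0 nun0.
Qed.

Let cg2ser x : cosser (fun k => k.+1%:R * - (k.+1%:R * cg k)) x =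
  nu ^+ 2 * cosser cg x - cosser ch x.
Proof.
have S1 := sumsB (@sumsZ _ _ (nu ^+ 2) _ (@cosser_cvg R cg isq x cg_le cvg_inv_sqr))
   (@cosser_cvg R ch isq x ch_le cvg_inv_sqr).
rewrite {1}/cosser; apply: sums_lim; apply: sums_eq S1 => k.
rewrite /= [LHS](_ : _ = (nu ^+ 2 * cg k - ch k) * cos (k.+1%:R * x)); last by ring.
congr (_ * _); rewrite /cg /ch.
by have := den_gt0 k; rewrite /den => /gt_eqF/negbT d0; field; rewrite nat1r.
Qed.

Let al := pi / (2 * nu * S).
(** The coefficient of the homogeneous solution [cosh (nu * (pi - x))], fixed by the Neumann
    condition at [0]. *)
Let be := al / (2 * nu ^+ 2) * (1 + nu * pi * C / S).

Lemma cosser_cg x : 0 <= x <= pi ->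
  cosser cg x = - (al / (2 * nu) * ((pi - x) * sinh (nu * (pi - x)))) - (2 * nu ^+ 4)^-1
   + be * cosh (nu * (pi - x)).
Proof.
move=> xpi.
pose z t := cosser cg t + (al / (2 * nu) * ((pi - t) * sinh (nu * (pi - t))) + (2 * nu ^+ 4)^-1
   - be * cosh (nu * (pi - t))).
pose z1 t := sinser (fun k => - (k.+1%:R * cg k)) t + (- (al / (2 * nu) *
   (sinh (nu * (pi - t)) + nu * (pi - t) * cosh (nu * (pi - t))))
   + be * nu * sinh (nu * (pi - t))).
have : z x = 0.
  apply: (@neumann_unique R z z1 nu nu0) => //.
  - move=> t _; rewrite /z /z1; eapply derive_conv.
      eapply dadd; [exact: (cosser_derive t cg1_le cvg_inv_sqr)|]; repeat hstep.
    by rewrite /=; field.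
  - move=> t tpi; rewrite /z /z1; eapply derive_conv.
      eapply dadd; [exact: (sinser_derive t cg2_le cvg_inv_sqr)|]; repeat hstep.
    by rewrite /= cg2ser cosser_ch// -/al; field; rewrite ?S0 ?nun0.
  - by rewrite /z1 sinser0 subr0 -/S -/C /be; field; rewrite S0 nun0.
  - by rewrite /z1 sinserpi subrr !mulr0 sinh0; ring.
rewrite /z => /eqP; rewrite addr_eq0 => /eqP ->.
by ring.
Qed.

(* The sum of [(nu^2 - m^2) / (m^2 + nu^2)^2 * cos (m x)] over all integers [m]. *)
Definition acoef x := pi / S * (pi * C / S * cosh (nu * (pi - x)) - (pi - x) * sinh (nu * (pi - x))).

Lemma acoef_sums x : 0 <= x <= pi ->
  sums (fun k => 2 * ((nu ^+ 2 - k.+1%:R ^+ 2) / (k.+1%:R ^+ 2 + nu ^+ 2) ^+ 2) * cos (k.+1%:R * x))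
    (acoef x - (nu ^+ 2)^-1).
Proof.
move=> xpi.
have S1 := sumsB (@sumsZ _ _ (4 * nu ^+ 2) _ (@cosser_cvg R cg isq x cg_le cvg_inv_sqr))
   (@sumsZ _ _ 2 _ (@cosser_cvg R ch isq x ch_le cvg_inv_sqr)).
rewrite cosser_cg// cosser_ch// in S1.
have -> : acoef x - (nu ^+ 2)^-1 = 4 * nu ^+ 2 *
        (- (al / (2 * nu) * ((pi - x) * sinh (nu * (pi - x)))) -
         (2 * nu ^+ 4)^-1 + be * cosh (nu * (pi - x))) -
        2 * (pi / (2 * nu * S) * cosh (nu * (pi - x)) - (2 * nu ^+ 2)^-1).
  by rewrite /acoef /be /al; field; rewrite S0 nun0.
apply: sums_eq S1 => k; rewrite /cg /ch -/(den k).
have -> : nu ^+ 2 - k.+1%:R ^+ 2 = 2 * nu ^+ 2 - den k by rewrite /den; ring.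
by have := den_gt0 k; move: (den k) => d /gt_eqF/negbT d0; field.
Qed.

End partial_fractions.

(** * The representative that is continuous off the origin *)

Section integral_lower_bound.
Import HBNNSimple.
Local Open Scope ereal_scope.

(* [f] need not be measurable, because the integral of a nonnegative function is a
   supremum over the simple functions below it. *)
Lemma integral_ge_measure d (T : measurableType d) (R : realType)
    (mu : {measure set T -> \bar R}) (D A : set T) (f : T -> \bar R) (c : R) :
  measurable A -> A `<=` D -> (0 <= c)%R -> (forall x, D x -> 0 <= f x) ->
  (forall x, A x -> c%:E <= f x) -> c%:E * mu A <= \int[mu]_(x in D) f x.
Proof.
move=> mA AD c0 f0 fA; rewrite integral_mkcond ge0_integralTE; last first.
  by move=> x; apply: erestrict_ge0.
apply: ereal_sup_ubound; exists (scale_nnsfun (indic_nnsfun R mA) c0).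
  move=> x; rewrite [X in X%:E](_ : _ = c * \1_A x)%R// indicE; have [/[!inE] Ax|Ax] := boolP (x \in A).
    by rewrite mulr1 /patch mem_set; [exact: fA|exact: AD].
  by rewrite mulr0; apply: erestrict_ge0.
by rewrite sintegralrM sintegral_indic.
Qed.

End integral_lower_bound.

Section fourier_representative.
Context {R : realType}.
Local Notation mu := (@lebesgue_measure R).

Lemma normc_ge_Re (z : R[i]) : complex.Re z ^+ 2 <= Normc.normc z ^+ 2.
Proof.
case: z => a b /=; rewrite sqr_sqrtr ?addr_ge0 ?sqr_ge0//.
by rewrite lerDl sqr_ge0.
Qed.

Lemma L2distsq_ge (f : R * R -> R[i]) (F : R * R -> R) (a b c d e : R) :
  a <= b -> c <= d -> 0 <= e -> `[a, b]%classic `*` `[c, d]%classic `<=` @Q R ->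
  (forall t, (`[a, b]%classic `*` `[c, d]%classic) t -> e <= `|complex.Re (f t) - F t|) ->
  ((e ^+ 2 * ((b - a) * (d - c)))%:E <=
     L2distsq (@Q R) f (fun t => (F t)%:C%C))%E.
Proof.
move=> ab cd e0 rQ H; rewrite (EFinM (e ^+ 2)) (EFinM (b - a)) (EFinB b) (EFinB d).
have mab : (mu `[a, b] = b%:E - a%:E)%E by rewrite lebesgue_measure_itv/= lte_fin; case: ltgtP ab => // -> _; rewrite subee.
have mcd : (mu `[c, d] = d%:E - c%:E)%E by rewrite lebesgue_measure_itv/= lte_fin; case: ltgtP cd => // -> _; rewrite subee.
rewrite -mab -mcd -(@product_measure1E _ _ _ _ R mu mu)//.
apply: integral_ge_measure => //.
- exact: measurableX.
- by rewrite exprn_ge0.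
- by move=> t _; rewrite lee_fin sqr_ge0.
- move=> t /H Ht; rewrite lee_fin (le_trans _ (normc_ge_Re _))//.
  rewrite raddfB /= -(ler_sqrt _ _) ?sqr_ge0// !sqrtr_sqr ger0_norm//.
Qed.

Lemma is_F_approx (F : R * R -> R) (e : R) :
  is_F F -> 0 < e -> exists A1 : {fset int * int}, forall A : {fset int * int}, (A1 `<=` A)%fset ->
    (L2distsq (@Q R) (Fpartial A) (fun t => (F t)%:C%C) < e%:E)%E.
Proof.
case=> FC _ _ e0.
have : nbhs (0 : \bar R)%E [set x | (x < e%:E)%E].
  by apply: open_nbhs_nbhs; split; [exact: open_ereal_lt_ereal|rewrite /= lte_fin].
move=> /FC [A1 _ HA1]; exists A1 => A A1A.
exact: HA1.
Qed.

Lemma within_ball (D : set (R * R)) (f : R * R -> R) (t0 : R * R) (e : R) :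
  f t @[t --> within D (nbhs t0)] --> f t0 -> 0 < e ->
  exists2 d : R, 0 < d & forall t, D t -> `|t.1 - t0.1| < d -> `|t.2 - t0.2| < d ->
    `|f t - f t0| <= e.
Proof.
move=> /cvgrPdist_le fc e0; have := fc _ e0; rewrite near_withinE => /nbhs_ballP[d d0 Hd].
exists d => // t Dt t1 t2; rewrite distrC; apply: Hd => //.
by split; rewrite /ball /= distrC.
Qed.

(** Extending from [s] towards [0] treats boundary points of [Q] like interior ones. *)
Lemma half_interval (s d : R) : - pi <= s <= pi -> 0 < d <= pi -> exists a b : R,
  b - a = d /\ forall t : R, a <= t <= b -> - pi <= t <= pi /\ `|t - s| <= d.
Proof.
move=> sp dp; have [s0|s0] := leP s 0.
  exists s, (s + d); split; first by ring.
  move=> t st; split; [lra|]; rewrite ler_norml; lra.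
exists (s - d), s; split; first by ring.
move=> t st; split; [lra|]; rewrite ler_norml; lra.
Qed.

(** If [F t0] and [G t0] differed, then on a fixed small rectangle near [t0] arbitrarily large
    partial sums would stay away from [F], against [L^2] convergence. Closeness to [G] is needed
    only along a cofinal family of finite sets. *)
Lemma is_F_eq (F G : R * R -> R) (t0 : R * R) (dl : R) : is_F F -> @Q R t0 -> t0 != (0, 0) ->
  G t @[t --> within (@Q R) (nbhs t0)] --> G t0 -> 0 < dl ->
  (forall (e : R) (A1 : {fset int * int}), 0 < e -> exists2 A : {fset int * int}, (A1 `<=` A)%fset &
     forall t, @Q R t -> `|t.1 - t0.1| < dl -> `|t.2 - t0.2| < dl ->
       `|complex.Re (Fpartial A t) - G t| <= e) ->
  F t0 = G t0.
Proof.
move=> FF Qt0 t00 Gc dl0 H; apply/eqP; rewrite -subr_eq0; apply/negPn/negP => FG.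
(* Of the gap [3 eta], the approximation of [G] uses [eta] and the two continuities [eta / 2] each,
   which leaves [eta] between the partial sum and [F]. *)
pose eta := `|F t0 - G t0| / 3.
have eta0 : 0 < eta by rewrite divr_gt0// normr_gt0.
have eta2 : 0 < eta / 2 by rewrite divr_gt0.
have [d1 d10 H1] := within_ball Gc eta2.
have Fc : F t @[t --> within (@Q R `\ (0, 0)) (nbhs t0)] --> F t0.
  case: FF => _ /subspace_continuousP /(_ t0) FF _; apply: FF.
  by split => //; apply/eqP.
have [d2 d20 H2] := within_ball Fc eta2.
(* Keeps the rectangle away from the origin, where [F] need not be continuous. *)
pose d3 := Num.max `|t0.1| `|t0.2|.
have d30 : 0 < d3.
  rewrite lt_max !normr_gt0; move: t00; rewrite -negb_and; apply: contra.
  by case: t0 {Qt0 Gc H FG eta eta0 eta2 H1 Fc H2 d3} => [a b] /= /andP[/eqP -> /eqP ->].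
pose d := Num.min (Num.min (d1 / 2) (d2 / 2)) (Num.min (d3 / 2) (Num.min (dl / 2) pi)).
have d0 : 0 < d by rewrite !lt_min !divr_gt0//= pi_gt0.
have dd1 : d < d1 by apply: (@le_lt_trans _ _ (d1 / 2)); [rewrite !ge_min lexx|lra].
have dd2 : d < d2 by apply: (@le_lt_trans _ _ (d2 / 2)); [rewrite !ge_min lexx !orbT|lra].
have dd3 : d < d3 by apply: (@le_lt_trans _ _ (d3 / 2)); [rewrite !ge_min lexx !orbT|lra].
have ddl : d < dl by apply: (@le_lt_trans _ _ (dl / 2)); [rewrite !ge_min lexx !orbT|lra].
have dpi : 0 < d <= pi by rewrite d0 !ge_min lexx !orbT.
move: (Qt0); rewrite /Q /= !in_itv /= => -[t1 t2].
have [a [b [abd Hab]]] := half_interval t1 dpi.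
have [c [e [ced Hce]]] := half_interval t2 dpi.
have e1 : 0 < eta ^+ 2 * (d * d) by apply: mulr_gt0; [exact: exprn_gt0 | exact: mulr_gt0].
have [A1 HA1] := is_F_approx FF e1.
have [A A1A HA] := H eta A1 eta0.
have := HA1 A A1A; apply/negP; rewrite -leNgt.
have -> : eta ^+ 2 * (d * d) = eta ^+ 2 * ((b - a) * (e - c)) by rewrite abd ced.
apply: L2distsq_ge.
- by rewrite -subr_ge0 abd ltW.
- by rewrite -subr_ge0 ced ltW.
- exact: ltW.
- by move=> [x y] []; rewrite /Q /= !in_itv /= => /Hab[? _] /Hce[? _].
move=> t []; rewrite /= !in_itv /= => /Hab[x1 x2] /Hce[y1 y2].
have Qt : @Q R t by rewrite /Q /= !in_itv.
have tn0 : (@Q R `\ (0, 0)) t.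
  split => //= t0E; move: dd3; apply/negP; rewrite -leNgt /d3 ge_max.
  by move: x2 y2; rewrite t0E /= !sub0r !normrN => -> ->.
have B1 := H1 t Qt (le_lt_trans x2 dd1) (le_lt_trans y2 dd1).
have B2 := H2 t tn0 (le_lt_trans x2 dd2) (le_lt_trans y2 dd2).
have B3 := HA t Qt (le_lt_trans x2 ddl) (le_lt_trans y2 ddl).
have B4 : 3 * eta = `|F t0 - G t0| by rewrite /eta mulrC divfK.
move: B1 B2 B3 B4; move: (complex.Re _) (G t) (F t) (F t0) (G t0) => u g f f0 g0.
move=> B1 B2 B3 B4.
have B5 : f0 - g0 = (u - g) - (u - f) - (f - f0) + (g - g0) by ring.
rewrite B5 in B4.
have := ler_normD (u - g - (u - f) - (f - f0)) (g - g0).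
have := ler_normB (u - g - (u - f)) (f - f0).
have := ler_normB (u - g) (u - f).
by move: B1 B2 B3 B4; lra.
Qed.

End fourier_representative.

(** * Symmetric windows and partial sums over boxes *)

Section windows.
Context {R : realType}.

(** Each step adds a pair of opposite integers, so that sums over windows become series over the
    positive ones. *)
Fixpoint win (N : nat) : seq int :=
  if N is M.+1 then M.+1%:Z :: - M.+1%:Z :: win M else [:: 0].

Lemma mem_win N n : (n \in win N) = (`|n| <= N)%N.
Proof.
elim: N => [|N IH]; first by rewrite inE leqn0 absz_eq0.
by rewrite /= !inE IH; lia.
Qed.

Lemma uniq_win N : uniq (win N).
Proof.
elim: N => [//|N IH] /=; rewrite IH andbT inE !mem_win negb_or.
by lia.
Qed.

Lemma sum_win_even N (f : int -> R) : (forall n, f (- n) = f n) ->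
  \sum_(n <- win N) f n = f 0 + 2 * \sum_(0 <= k < N) f k.+1%:Z.
Proof.
move=> fe; elim: N => [|N IH]; first by rewrite big_seq1 big_nil mulr0 addr0.
by rewrite big_nat_recr//= !big_cons IH fe; ring.
Qed.

Lemma sum_win_odd N (f : int -> R) : (forall n, f (- n) = - f n) ->
  \sum_(n <- win N) f n = 0.
Proof.
move=> fo; have f0 : f 0 = 0 by have := fo 0; rewrite oppr0 => ?; lra.
elim: N => [|N IH]; first by rewrite big_seq1.
by rewrite /= !big_cons IH fo; ring.
Qed.

End windows.

Section box_sums.
Context {R : realType}.
Implicit Types (x y : R) (t : R * R).

Definition wt (i j : int) : R := (j ^+ 2 - i ^+ 2)%:~R / (i ^+ 2 + j ^+ 2)%:~R ^+ 2.

Lemma wt_antisym i j : wt i j = - wt j i.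
Proof. by rewrite /wt [j ^+ 2 + i ^+ 2]addrC -[i ^+ 2 - _]opprB mulrNz mulNr opprK. Qed.

Lemma wtNl i j : wt (- i) j = wt i j. Proof. by rewrite /wt sqrrN. Qed.
Lemma wtNr i j : wt i (- j) = wt i j. Proof. by rewrite /wt sqrrN. Qed.

Lemma FcoefE (m : int * int) : Fcoef R m = (2 * pi)^-1 * wt m.1 m.2.
Proof. by rewrite /Fcoef /wt /normsq [(2 * pi * _)^-1]invfM mulrCA. Qed.

(** The condition [m != 0] disappears because [wt 0 0 = 0]. *)
Lemma Re_Fpartial (A : {fset int * int}) t :
  complex.Re (Fpartial A t) = \sum_(m <- A) Fcoef R m * cos (dotp m t).
Proof.
rewrite /Fpartial raddf_sum /= big_mkcond; apply: eq_bigr => m _ /=.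
case: ifPn => [_|]; first by rewrite mul0r subr0.
by rewrite negbK => /eqP ->; rewrite FcoefE /wt /= expr0n subrr mul0r mulr0 mul0r.
Qed.

Definition box (K N : nat) : {fset int * int} := [fset p in [seq (i, j) | i <- win K, j <- win N]]%fset.

Lemma mem_box K N (m : int * int) : (m \in box K N) = ((`|m.1| <= K) && (`|m.2| <= N))%N.
Proof.
rewrite /box inE; case: m => i j /=; apply/allpairsP/andP => [[[a b]] /= []|[iK jN]].
  by rewrite !mem_win => ? ? [-> ->].
by exists (i, j); rewrite /= !mem_win.
Qed.

Lemma box_sup (A : {fset int * int}) : exists N0 : nat, forall K N, (N0 <= K)%N -> (N0 <= N)%N ->
  (A `<=` box K N)%fset.
Proof.
exists (\max_(m <- A) maxn `|m.1|%N `|m.2|%N)%N => K N hK hN.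
apply/fsubsetP => m mA; rewrite mem_box.
have := @leq_bigmax_seq _ (enum_fset A) xpredT (fun m : int * int => maxn `|m.1|%N `|m.2|%N) m mA isT.
rewrite geq_max => /andP[h1 h2].
by rewrite (leq_trans h1 hK) (leq_trans h2 hN).
Qed.

Lemma sum_box K N (f : int * int -> R) :
  \sum_(m <- box K N) f m = \sum_(j <- win N) \sum_(i <- win K) f (i, j).
Proof.
rewrite exchange_big /=.
transitivity (\sum_(m <- [seq (i, j) | i <- win K, j <- win N]) f m); last first.
  by rewrite big_allpairs_dep.
apply: perm_big; apply: uniq_perm; first exact: fset_uniq.
  by apply: allpairs_uniq; rewrite ?uniq_win// => -[a b] [c d].
by move=> m; rewrite /box inE.
Qed.

Definition row K (n : int) x : R := \sum_(i <- win K) wt i n * cos (i%:~R * x).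

Lemma Re_Fpartial_box K N t : complex.Re (Fpartial (box K N) t) =
  (2 * pi)^-1 * \sum_(j <- win N) cos (j%:~R * t.2) * row K j t.1.
Proof.
rewrite Re_Fpartial sum_box mulr_sumr; apply: eq_bigr => j _.
rewrite /row !mulr_sumr.
have -> : \sum_(i <- win K) Fcoef R (i, j) * cos (dotp (i, j) t) =
  \sum_(i <- win K) ((2 * pi)^-1 * (cos (j%:~R * t.2) * (wt i j * cos (i%:~R * t.1))))
  - \sum_(i <- win K) ((2 * pi)^-1 * (sin (j%:~R * t.2) * (wt i j * sin (i%:~R * t.1)))).
  rewrite -sumrB; apply: eq_bigr => i _.
  by rewrite FcoefE /dotp /= cosD; ring.
rewrite [X in _ - X]sum_win_odd ?subr0// => i.
by rewrite wtNl mulrNz mulNr sinN; ring.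
Qed.

Lemma Re_Fpartial_box_swap K N t : complex.Re (Fpartial (box N K) t) =
  - complex.Re (Fpartial (box K N) (t.2, t.1)).
Proof.
rewrite !Re_Fpartial !sum_box exchange_big -sumrN; apply: eq_bigr => i _.
rewrite -sumrN; apply: eq_bigr => j _.
rewrite !FcoefE /= (wt_antisym i j) /dotp /= [X in cos X]addrC.
by ring.
Qed.

Definition rowlim (n : nat) x : R := if n is 0%N then - (2 * bern x) else acoef n%:R x.

Lemma row_even K n x : row K (- n) x = row K n x.
Proof. by rewrite /row; apply: eq_bigr => i _; rewrite wtNr. Qed.

(** [|wt i n| <= 1 / i^2] whatever [n] is. The bound depends on neither [n] nor [x], which allows
    [K] to be chosen after the number of rows. *)
Lemma row_close K n x : 0 <= x <= pi ->
  `|row K n%:Z x - rowlim n x| <= limn (series (fun k => 2 * isq k : R)) - series (fun k => 2 * isq k) K.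
Proof.
move=> xpi.
pose u k : R := 2 * (wt k.+1%:Z n%:Z * cos (k.+1%:R * x)).
have rowE : row K n%:Z x = wt 0 n%:Z + series u K.
  rewrite /row sum_win_even; last by move=> i; rewrite wtNl mulrNz mulNr cosN.
  by rewrite mul0r cos0 mulr1 /series /= mulr_sumr.
have wtE k : wt k.+1%:Z n%:Z = (n%:R ^+ 2 - k.+1%:R ^+ 2) / (k.+1%:R ^+ 2 + n%:R ^+ 2) ^+ 2.
  by rewrite /wt intrB intrD !rmorphXn.
have ub k : `|u k| <= 2 * isq k.
  rewrite /u normrM (ger0_norm (_ : 0 <= 2))// ler_wpM2l//.
  rewrite normrM (@le_trans _ _ (`|wt k.+1 n| * 1))//; first by rewrite ler_wpM2l// cos_max.
  rewrite mulr1 wtE /isq; set a := k.+1%:R ^+ 2; set b := n%:R ^+ 2.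
  have a0 : 0 < a by rewrite exprn_gt0.
  have b0 : 0 <= b by rewrite sqr_ge0.
  rewrite normrM (ger0_norm (_ : 0 <= _^-1)); last by rewrite invr_ge0 exprn_ge0// addr_ge0// ltW.
  rewrite ler_pdivrMr; last by rewrite exprn_gt0// ltr_pwDl.
  rewrite -ler_pdivrMl ?invr_gt0// invrK.
  rewrite (@le_trans _ _ (a * (a + b)))//.
    by apply: ler_wpM2l; [exact: ltW|rewrite ler_norml; lra].
  by rewrite expr2; apply: ler_wpM2r; lra.
have cM : cvgn (series (fun k => 2 * isq k : R)).
  by apply: sums_cvg; exact: (@sumsZ _ _ 2 _ (@cvg_inv_sqr R)).
suff -> : rowlim n x = wt 0 n%:Z + limn (series u).
  by rewrite rowE opprD addrACA subrr add0r distrC; exact: series_tail.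
case: n @u rowE wtE ub => [|n] u rowE wtE ub /=.
  rewrite /wt expr0n subrr mul0r add0r.
  have S1 := @sumsN _ _ _ (@sumsZ _ _ 2 _ (@bern_sums R x)).
  symmetry; apply: sums_lim; apply: sums_eq S1 => k.
  by rewrite /u wtE expr0n /= sub0r addr0 /isq; field; rewrite nat1r pnatr_eq0.
have n0 : 0 < n.+1%:R :> R by rewrite ltr0n.
have S1 := acoef_sums n0 xpi.
have -> : wt 0 n.+1%:Z = (n.+1%:R ^+ 2)^-1.
  by rewrite /wt expr0n subr0 add0r rmorphXn /=; field; rewrite nat1r pnatr_eq0.
rewrite [limn _](_ : _ = acoef n.+1%:R x - (n.+1%:R ^+ 2)^-1); first by ring.
by apply: sums_lim; apply: sums_eq S1 => k; rewrite /u wtE [RHS]mulrA.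
Qed.

End box_sums.

(** * The explicit function *)

Section representative.
Context {R : realType}.
Implicit Types (x y nu : R) (t : R * R).

Lemma cvg_exp_series (a : R) : 0 < a -> cvgn (series (fun k => expR (- (k.+1%:R * a)))).
Proof.
move=> a0; have q1 : `|expR (- a)| < 1 by rewrite ger0_norm ?expR_ge0// expR_lt1 oppr_lt0.
rewrite (_ : (fun k => _) = geometric (expR (- a)) (expR (- a))).
  exact: is_cvg_geometric_series.
by apply/funext => k; rewrite /geometric /= -mulrN expRM_natl exprS.
Qed.

(** What is left of [acoef nu x / pi] without the term [x * expR (- (nu * x))], the only one that
    fails to be exponentially small in [nu] as [x] tends to [0]. It is even in [x], which extends
    the formula to negative [x]. *)
Definition Rn nu x := pi * cosh (nu * x) / sinh (nu * pi) ^+ 2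
  - x * expR (- (nu * pi)) * sinh (nu * x) / sinh (nu * pi).

Lemma acoef_split nu x : 0 < nu -> acoef nu x = pi * (Rn nu x + x * expR (- (nu * x))).
Proof.
move=> nu0; have S0 : sinh (nu * pi) != 0 by rewrite gt_eqF// sinh_gt0// mulr_gt0 ?pi_gt0.
rewrite /acoef /Rn -!cosh_subsinh (_ : nu * (pi - x) = nu * pi - nu * x); last by ring.
rewrite coshB sinhB.
have := cosh_sqr (nu * pi).
move: S0; set S := sinh (nu * pi); set C := cosh (nu * pi); set s := sinh _; set c := cosh _.
move=> S0 CS; apply/eqP; rewrite -subr_eq0; apply/eqP.
transitivity (pi ^+ 2 * c / S ^+ 2 * (C ^+ 2 - 1 - S ^+ 2)); last by rewrite CS; ring.
by field.
Qed.

Lemma RnN nu x : Rn nu (- x) = Rn nu x.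
Proof. by rewrite /Rn mulrN sinhN coshN; ring. Qed.

Lemma Rn_bound nu x : 1 <= nu -> `|x| <= pi -> `|Rn nu x| <= 17 * pi * expR (- (nu * pi)).
Proof.
move=> nu1 xpi; have nu0 : 0 < nu := lt_le_trans ltr01 nu1.
have pi1 : 1 <= pi :> R by have := @pi_ge2 R; lra.
have a1 : 1 <= nu * pi by rewrite mulr_ege1.
have S4 := sinh_ge a1.
have S0 : 0 < sinh (nu * pi) by rewrite sinh_gt0// (lt_le_trans ltr01 a1).
have E0 := expR_gt0 (nu * pi).
have xa : `|nu * x| <= `|nu * pi|.
  by rewrite !normrM ler_wpM2l// [X in _ <= X]ger0_norm ?pi_ge0.
have C1 : cosh (nu * pi) <= expR (nu * pi) by rewrite -cosh_sinh lerDl ltW.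
rewrite /Rn (le_trans (ler_normB _ _))//.
(* The [16] is the square of the [4] in [sinh_ge]; the second summand uses
   [|sinh (nu x)| <= sinh (nu pi)]. *)
have -> : 17 * pi * expR (- (nu * pi)) = 16 * pi * expR (- (nu * pi)) + pi * expR (- (nu * pi)) by ring.
apply: lerD.
  rewrite ger0_norm; last first.
    by apply: divr_ge0; [apply: mulr_ge0; [exact: pi_ge0|exact/ltW/cosh_gt0]|exact: sqr_ge0].
  rewrite ler_pdivrMr ?exprn_gt0//.
  apply: (@le_trans _ _ (pi * expR (nu * pi))).
    apply: ler_wpM2l; [exact: pi_ge0|exact: le_trans (cosh_le xa) C1].
  have -> : pi * expR (nu * pi) = 16 * pi * expR (- (nu * pi)) * (expR (nu * pi) / 4) ^+ 2.
    by rewrite expRN; field; rewrite gt_eqF.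
  apply: ler_wpM2l; first by rewrite !mulr_ge0 ?expR_ge0 ?pi_ge0.
  by rewrite ler_pXn2r// nnegrE ?ltW// divr_gt0.
rewrite -mulrA normrM; apply: (@le_trans _ _ (pi * expR (- (nu * pi)) * 1)); last by rewrite mulr1.
apply: ler_pM => //.
  by rewrite normrM (ger0_norm (expR_ge0 _)) ler_wpM2r ?expR_ge0.
have a0 : 0 <= nu * pi := le_trans ler01 a1.
rewrite normrM normfV -!sinh_norm (ger0_norm a0) ler_pdivrMr// mul1r.
by apply: sinh_le; rewrite -[leRHS](ger0_norm a0).
Qed.

Definition Hser t : R := limn (series (fun k => Rn k.+1%:R t.1 * cos (k.+1%:R * t.2))).

(* Summed over [m_1] first, the Fourier series of [2 pi F] is [- 2 bern t.1], the row
   [m_2 = 0], plus the sum over [k >= 1] of [2 acoef k t.1 cos (k t.2)]. By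
   [acoef_split] these terms are [2 pi t.1 expR (- k t.1) cos (k t.2)], which sum to the
   first summand of [Gf], up to the exponentially small [2 pi Rn k t.1 cos (k t.2)]. *)
Definition Gf t : R := t.1 * sinh t.1 / (2 * (cosh t.1 - cos t.2)) - pi / 6
  - t.1 ^+ 2 / (4 * pi) + Hser t.

Let Mn k : R := 17 * pi * expR (- (k.+1%:R * pi)).

Let cvg_Mn : cvgn (series Mn).
Proof. by apply: sums_cvg; exact: (@sumsZ _ _ (17 * pi) _ (cvg_exp_series (@pi_gt0 R))). Qed.

Let Hterm_le t k : @Q R t -> `|Rn k.+1%:R t.1 * cos (k.+1%:R * t.2)| <= Mn k.
Proof.
rewrite /Q /= !in_itv /= => -[t1 _].
rewrite normrM (@le_trans _ _ (`|Rn k.+1%:R t.1| * 1))//.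
  by rewrite ler_wpM2l// cos_max.
by rewrite mulr1 Rn_bound ?ler1n// ler_norml.
Qed.

Lemma Hser_sums t : @Q R t -> sums (fun k => Rn k.+1%:R t.1 * cos (k.+1%:R * t.2)) (Hser t).
Proof. by move=> Qt; apply: (abs_cvg_series _ cvg_Mn) => k; exact: Hterm_le. Qed.

Lemma cont_fst (f : R -> R) t : {for t.1, continuous f} -> {for t, continuous (fun t : R * R => f t.1)}.
Proof. by move=> fc; apply: (@continuous_comp _ _ _ fst f); [exact: cvg_fst|exact: fc]. Qed.
Lemma cont_snd (f : R -> R) t : {for t.2, continuous f} -> {for t, continuous (fun t : R * R => f t.2)}.
Proof. by move=> fc; apply: (@continuous_comp _ _ _ snd f); [exact: cvg_snd|exact: fc]. Qed.

Lemma Hser_cont t0 : @Q R t0 -> Hser t @[t --> within (@Q R) (nbhs t0)] --> Hser t0.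
Proof.
move=> Qt0; have PF : ProperFilter (within (@Q R) (nbhs t0)).
  by apply: within_nbhs_proper; exact: subset_closure.
apply: (@cvg_series_filter R (R * R)%type (within (@Q R) (nbhs t0)) PF
  (fun k t => Rn k.+1%:R t.1 * cos (k.+1%:R * t.2))
  (fun k => Rn k.+1%:R t0.1 * cos (k.+1%:R * t0.2)) Mn).
- move=> k; apply: cvg_within_filter; apply: cvgM.
    apply: (@cont_fst (Rn k.+1%:R)); rewrite /Rn.
    by eapply is_derive_cont; repeat hstep.
  apply: (@cont_snd (fun y => cos (k.+1%:R * y))).
  by eapply is_derive_cont; repeat hstep.
- exact: cvg_Mn.
- by rewrite near_withinE; near=> t; move=> Qt k; exact: Hterm_le.
Unshelve. all: by end_near. Qed.

Lemma cosh_sub_cos_gt0 x y : x != 0 -> 0 < cosh x - cos y.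
Proof.
move=> x0; have s0 : 0 < sinh x ^+ 2 by rewrite exprn_even_gt0//= sinh_neq0.
by have := cosh_sqr x; have := cosh_gt0 x; have := cos_le1 y; nra.
Qed.

Lemma Gf_cont t0 : @Q R t0 -> t0.1 != 0 -> Gf t @[t --> within (@Q R) (nbhs t0)] --> Gf t0.
Proof.
move=> Qt0 t00; rewrite /Gf; apply: cvgD; last exact: Hser_cont.
apply: cvg_within_filter; apply: cvgB; [apply: cvgB|].
- apply: cvgM.
    apply: (@cont_fst (fun x => x * sinh x)).
    by eapply is_derive_cont; repeat hstep.
  apply: cvgV; first by rewrite mulf_neq0// gt_eqF// cosh_sub_cos_gt0.
  apply: cvgM; [exact: cvg_cst|apply: cvgB].
    by apply: (@cont_fst cosh); exact: (@is_derive_cont R cosh _ _ (isd_cosh (did t0.1))).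
  by apply: (@cont_snd cos); exact: continuous_cos.
- exact: cvg_cst.
- apply: (@cont_fst (fun x => x ^+ 2 / (4 * pi))).
  by eapply is_derive_cont; repeat hstep.
Qed.

Lemma GfN t : Gf (- t.1, t.2) = Gf t.
Proof.
rewrite /Gf /= sinhN coshN mulrNN sqrrN; congr (_ + _).
by rewrite /Hser /=; congr (limn (series _)); apply/funext => k; rewrite RnN.
Qed.

(** The real part of the geometric series of ratio [exp (- x + i y)]; the three-term recurrence
    [rec] of its terms makes the partial sums telescope. *)
Lemma exp_cos_sums x y : 0 < x ->
  sums (fun k => expR (- (k.+1%:R * x)) * cos (k.+1%:R * y))
    ((cos y - expR (- x)) / (2 * (cosh x - cos y))).
Proof.
move=> x0; pose u n := expR (- (n%:R * x)) * cos (n%:R * y).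
have d0 : cosh x - cos y != 0 by rewrite gt_eqF// cosh_sub_cos_gt0// gt_eqF.
have S N : series (fun k => u k.+1) N = (expR x * (u 1%N - u N.+1) + expR (- x) * (u N - u 0%N)) / (2 * (cosh x - cos y)).
  elim: N => [|N IH].
    by rewrite /series /= big_nil !subrr !mulr0 addr0 mul0r.
  rewrite seriesSr IH.
  have rec : 2 * (cosh x - cos y) * u N.+1 = expR x * (u N.+1 - u N.+2) + expR (- x) * (u N.+1 - u N).
    rewrite /u.
    have -> : cos (N.+2%:R * y) = cos (N.+1%:R * y) * cos y - sin (N.+1%:R * y) * sin y.
      by rewrite -cosD; congr cos; rewrite -(natr1 N.+1); ring.
    have -> : cos (N%:R * y) = cos (N.+1%:R * y) * cos y + sin (N.+1%:R * y) * sin y.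
      by rewrite -cosB; congr cos; rewrite -(natr1 N); ring.
    have -> : expR (- (N.+2%:R * x)) = expR (- (N.+1%:R * x)) * expR (- x).
      by rewrite -expRD; congr expR; rewrite -(natr1 N.+1); ring.
    have -> : expR (- (N%:R * x)) = expR (- (N.+1%:R * x)) * expR x.
      by rewrite -expRD; congr expR; rewrite -(natr1 N); ring.
    have e1 : expR x * expR (- x) = 1 := expRxMexpNx_1 x.
    rewrite /cosh; set A := expR (- (N.+1%:R * x)); set c := cos (N.+1%:R * y); set s := sin (N.+1%:R * y).
    apply/eqP; rewrite -subr_eq0; apply/eqP.
    transitivity (A * 2 * c * cos y * (expR x * expR (- x) - 1)); last by rewrite e1 subrr mulr0.
    by field.
  apply: (mulIf (mulf_neq0 (_ : 2 != 0) d0)); first by rewrite pnatr_eq0.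
  rewrite mulrDl !divfK ?mulf_neq0 ?pnatr_eq0// [u N.+1 * _]mulrC rec.
  by ring.
have u0 : u n @[n --> \oo] --> 0.
  rewrite -(cvg_shiftS u); apply: cvg_series_cvg_0.
  apply: (abs_cvg_series _ (cvg_exp_series x0)) => k.
  by rewrite /u normrM (ger0_norm (expR_ge0 _)) ler_piMr ?expR_ge0// cos_max.
have H : series (fun k => u k.+1) N @[N --> \oo] -->
  (expR x * (u 1%N - 0) + expR (- x) * (0 - u 0%N)) / (2 * (cosh x - cos y)).
  rewrite (funext S); apply: cvgM; last exact: cvg_cst.
  apply: cvgD; apply: cvgM; try exact: cvg_cst.
    by apply: cvgB; [exact: cvg_cst|rewrite (cvg_shiftS u)].
  by apply: cvgB; [|exact: cvg_cst].
have e : expR x * (u 1%N - 0) + expR (- x) * (0 - u 0%N) = cos y - expR (- x).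
  by rewrite /u !mul0r !mul1r oppr0 expR0 cos0 addr0 mulrA expRxMexpNx_1; ring.
by rewrite e in H.
Qed.

End representative.

(** * Uniform approximation by boxes and antisymmetry *)

Section approximation.
Context {R : realType}.
Implicit Types (x y : R) (t : R * R).

Lemma Gf_sums t : @Q R t -> 0 < t.1 ->
  sums (fun k => 2 * acoef k.+1%:R t.1 * cos (k.+1%:R * t.2)) (2 * pi * Gf t + 2 * bern t.1).
Proof.
move=> Qt t10; have t1pi : 0 <= t.1 <= pi.
  by move: Qt; rewrite /Q /= !in_itv /= => -[/andP[_ ->] _]; rewrite ltW.
have d0 : cosh t.1 - cos t.2 != 0 by rewrite gt_eqF// cosh_sub_cos_gt0// gt_eqF.
have S1 := @sumsZ _ _ (2 * pi) _ (sumsD (Hser_sums Qt) (@sumsZ _ _ t.1 _ (@exp_cos_sums R t.1 t.2 t10))).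
(* By [sinh = cosh - exp(-)], the geometric part contains [- t.1 / 2], which cancels against the
   linear term of the parabola [bern]; so [Gf] is even in [t.1]. *)
have -> : 2 * pi * Gf t + 2 * bern t.1 = 2 * pi *
   (Hser t + t.1 * ((cos t.2 - expR (- t.1)) / (2 * (cosh t.1 - cos t.2)))).
  rewrite bern0pi// bern_pi /Gf -cosh_subsinh.
  have := gt_eqF (@pi_gt0 R); move: (@pi R) => p /negbT p0.
  by field; rewrite d0 p0.
by apply: sums_eq S1 => k; rewrite acoef_split ?ltr0n//; ring.
Qed.

Lemma row_Nx K n x : row K n (- x) = row K n x.
Proof. by rewrite /row; apply: eq_bigr => i _; rewrite mulrN cosN. Qed.

Lemma Re_Fpartial_boxN K N t :
  complex.Re (Fpartial (box K N) (- t.1, t.2)) = complex.Re (Fpartial (box K N) t).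
Proof. by rewrite !Re_Fpartial_box /=; under eq_bigr do rewrite row_Nx. Qed.

Lemma Re_Fpartial_box_pos K N t : complex.Re (Fpartial (box K N) t) =
  (2 * pi)^-1 * (row K 0 t.1 + \sum_(0 <= k < N) 2 * row K k.+1%:Z t.1 * cos (k.+1%:R * t.2)).
Proof.
rewrite Re_Fpartial_box sum_win_even.
  rewrite mul0r cos0 mul1r mulr_sumr; congr (_ * (_ + _)).
  by apply: eq_bigr => k _; rewrite mulrA mulrAC.
by move=> n; rewrite mulrNz mulNr cosN row_even.
Qed.

(** [N] comes first, from the exponential decay of the row sums for [t.1 >= dl]; then [K] makes each
    of the finitely many rows accurate. *)
Lemma approx_pos (e dl : R) (n0 : nat) : 0 < e -> 0 < dl -> exists K N : nat,
  [/\ (n0 <= K)%N, (n0 <= N)%N & forall t, @Q R t -> dl <= t.1 ->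
    `|complex.Re (Fpartial (box K N) t) - Gf t| <= e].
Proof.
move=> e0 dl0; have pi0 := @pi_gt0 R.
pose M k := 2 * pi * (17 * pi * expR (- (k.+1%:R * pi)) + pi * expR (- (k.+1%:R * dl))).
have cM : cvgn (series M).
  apply: sums_cvg; apply: (@sumsZ _ _ (2 * pi)); apply: sumsD.
    exact: (@sumsZ _ _ (17 * pi) _ (cvg_exp_series pi0)).
  exact: (@sumsZ _ _ pi _ (cvg_exp_series dl0)).
have e1 : 0 < pi * e by rewrite mulr_gt0.
have [N1 HN1] := (cvgnP _ _).1 cM _ e1.
pose N := maxn n0 N1.
have cI : cvgn (series (fun k => 2 * isq k : R)).
  by apply: sums_cvg; exact: (@sumsZ _ _ 2 _ (@cvg_inv_sqr R)).
(* The share of one row: row [0] counts once and each row [1..N] twice. *)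
have e2 : 0 < pi * e / (2 * N%:R + 1) by rewrite divr_gt0// ltr_wpDl// mulr_ge0.
have [K1 HK1] := (cvgnP _ _).1 cI _ e2.
exists (maxn n0 K1), N; split; rewrite ?leq_maxl// => t Qt dt.
set K := maxn _ _.
have t10 : 0 < t.1 := lt_le_trans dl0 dt.
have t1pi : 0 <= t.1 <= pi.
  by move: Qt; rewrite /Q /= !in_itv /= => -[/andP[_ ->] _]; rewrite ltW.
have S1 := Gf_sums Qt t10.
pose u k := 2 * acoef k.+1%:R t.1 * cos (k.+1%:R * t.2).
have uM k : `|u k| <= M k.
  rewrite /u normrM (@le_trans _ _ (`|2 * acoef k.+1%:R t.1| * 1))//.
    by rewrite ler_wpM2l// cos_max.
  rewrite mulr1 acoef_split// mulrA normrM (ger0_norm (_ : 0 <= 2 * pi)); last by rewrite mulr_ge0// ltW.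
  rewrite /M; apply: ler_wpM2l; first by rewrite mulr_ge0 ?ltW.
  rewrite (le_trans (ler_normD _ _))// lerD//.
    by rewrite Rn_bound ?ler1n// ger0_norm ?(ltW t10)//; case/andP: t1pi.
  rewrite normrM (ger0_norm (ltW t10)) (ger0_norm (expR_ge0 _)).
  apply: ler_pM; rewrite ?expR_ge0 ?(ltW t10)//; first by case/andP: t1pi.
  by rewrite ler_expR lerN2 ler_wpM2l.
have T1 : `|limn (series u) - series u N| <= pi * e.
  apply: (le_trans (series_tail N uM cM)).
  by have := HN1 N (leq_maxr _ _); rewrite distrC; apply: le_trans; exact: ler_norm.
have T2 n : `|row K n%:Z t.1 - rowlim n t.1| <= pi * e / (2 * N%:R + 1).
  apply: (le_trans (row_close K n t1pi)).
  by have := HK1 K (leq_maxr _ _); rewrite distrC; apply: le_trans; exact: ler_norm.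
have T3 : `|\sum_(0 <= k < N) 2 * row K k.+1%:Z t.1 * cos (k.+1%:R * t.2) - series u N|
   <= 2 * N%:R * (pi * e / (2 * N%:R + 1)).
  rewrite /series /= -sumrB (le_trans (ler_norm_sum _ _ _))//.
  rewrite (@le_trans _ _ (\sum_(0 <= k < N) 2 * (pi * e / (2 * N%:R + 1))))//.
    apply: ler_sum => k _; rewrite /u -mulrBl -mulrBr normrM.
    rewrite (@le_trans _ _ (`|2 * (row K k.+1%:Z t.1 - acoef k.+1%:R t.1)| * 1))//.
      by rewrite ler_wpM2l// cos_max.
    by rewrite mulr1 normrM ger0_norm// ler_wpM2l//; exact: (T2 k.+1).
  by rewrite sumr_const_nat subn0 -mulr_natr; lra.
have T0 := T2 0%N; rewrite /= in T0.
have SE := sums_lim S1; rewrite -/u in SE.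
rewrite Re_Fpartial_box_pos.
set r := row _ _ _ in T0 *; set s := \sum_(_ <= _ < _) _ in T3 *.
have -> : (2 * pi)^-1 * (r + s) - Gf t = (2 * pi)^-1 *
  ((r - - (2 * bern t.1)) + (s - series u N) - (limn (series u) - series u N)).
  rewrite SE; have := gt_eqF pi0; move: (@pi R) => p /negbT p0.
  by field.
rewrite normrM (ger0_norm (_ : 0 <= _^-1)); last by rewrite invr_ge0 mulr_ge0// ltW.
rewrite ler_pdivrMl ?mulr_gt0//.
rewrite (le_trans (ler_normB _ _))// (le_trans (lerD (ler_normD _ _) (lexx _)))//.
have -> : 2 * pi * e = pi * e / (2 * N%:R + 1) + 2 * N%:R * (pi * e / (2 * N%:R + 1)) + pi * e.
  by field; rewrite gt_eqF// ltr_wpDl// mulr_ge0.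
by rewrite !lerD.
Qed.

Lemma approx_box (e dl : R) (n0 : nat) : 0 < e -> 0 < dl -> exists K N : nat,
  [/\ (n0 <= K)%N, (n0 <= N)%N & forall t, @Q R t -> dl <= `|t.1| ->
    `|complex.Re (Fpartial (box K N) t) - Gf t| <= e].
Proof.
move=> e0 dl0; have [K [N [Kn Nn H]]] := approx_pos n0 e0 dl0.
exists K, N; split => // t Qt dt; have [t10|t10] := leP 0 t.1.
  by apply: H => //; move: dt; rewrite ger0_norm.
rewrite -GfN -Re_Fpartial_boxN; apply: H; last by move: dt; rewrite /= ltr0_norm.
by move: Qt; rewrite /Q /= !in_itv /= => -[? ?]; split => //; lra.
Qed.

Lemma Qswap t : @Q R t -> @Q R (t.2, t.1).
Proof. by case. Qed.

Lemma is_F_Gf (F : R * R -> R) t0 : is_F F -> @Q R t0 -> t0.1 != 0 -> F t0 = Gf t0.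
Proof.
move=> FF Qt0 t00.
have dl0 : 0 < `|t0.1| / 2 by rewrite divr_gt0// normr_gt0.
apply: (is_F_eq FF Qt0 _ _ dl0).
- by apply: contra t00 => /eqP ->.
- exact: Gf_cont.
move=> e A1 e0; have [n0 Hn0] := box_sup A1.
have [K [N [Kn Nn H]]] := approx_box n0 e0 dl0.
exists (box K N); first exact: Hn0.
move=> t Qt t1 _; apply: H => //.
have := ler_normD (t.1) (t0.1 - t.1); rewrite addrC subrK (distrC t0.1).
by move: t1; move: `|t.1 - t0.1| `|t0.1| `|t.1| => a b c; lra.
Qed.

(** The same argument with transposed boxes, that is with summation over [m_2] first; it covers the
    axis [t.1 = 0]. *)
Lemma is_F_GfN (F : R * R -> R) t0 : is_F F -> @Q R t0 -> t0.2 != 0 -> F t0 = - Gf (t0.2, t0.1).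
Proof.
move=> FF Qt0 t00.
have dl0 : 0 < `|t0.2| / 2 by rewrite divr_gt0// normr_gt0.
apply: (@is_F_eq R F (fun t => - Gf (t.2, t.1)) t0 _ FF Qt0 _ _ dl0).
- by apply: contra t00 => /eqP ->.
- apply: cvgN.
  have C := @Gf_cont R (t0.2, t0.1) (Qswap Qt0) t00.
  apply: cvg_comp C => P; rewrite /within /= !nbhs_simpl.
  move=> [[A B] [/= HA HB] HAB]; exists (B, A) => //= -[a b] /= [Ha Hb] Qab.
  by apply: HAB => //; exact: (@Qswap (a, b)).
move=> e A1 e0; have [n0 Hn0] := box_sup A1.
have [K [N [Kn Nn H]]] := approx_box n0 e0 dl0.
exists (box N K); first exact: Hn0.
move=> t Qt _ t2; rewrite Re_Fpartial_box_swap opprK -normrN opprD opprK.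
apply: H; first exact: Qswap.
have := ler_normD (t.2) (t0.2 - t.2); rewrite addrC subrK (distrC t0.2) /=.
by move: t2; move: `|t.2 - t0.2| `|t0.2| `|t.2| => a b c; lra.
Qed.

End approximation.

(** * Lattice sums *)

Section window_convolution.
Context {R : realType}.

Definition eR (k : nat) : R := expR (- (k%:R * pi)).

Lemma eR_gt0 k : 0 < eR k. Proof. exact: expR_gt0. Qed.

Lemma eR_le j k : (j <= k)%N -> eR k <= eR j.
Proof. by move=> jk; rewrite ler_expR lerN2; apply: ler_wpM2r; rewrite ?pi_ge0// ler_nat. Qed.

Lemma eRD j k : eR (j + k) = eR j * eR k.
Proof. by rewrite /eR -expRD natrD; congr expR; ring. Qed.

Lemma sum_winE N (f : int -> R) :
  \sum_(n <- win N) f n = f 0 + series (fun k => f k.+1%:Z + f (- k.+1%:Z)) N.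
Proof.
elim: N => [|N IH]; first by rewrite big_seq1 /series /= big_nil addr0.
by rewrite seriesSr /= !big_cons IH; ring.
Qed.

Lemma sum_win_opp N (f : int -> R) : \sum_(n <- win N) f (- n) = \sum_(n <- win N) f n.
Proof.
rewrite !sum_winE oppr0; congr (_ + series _ _); apply/funext => k.
by rewrite opprK addrC.
Qed.

Lemma sum_win_tel N (g : int -> R) :
  \sum_(n <- win N) (g (n + 1) - g n) = g (N%:Z + 1) - g (- N%:Z).
Proof.
elim: N => [|N IH]; first by rewrite big_seq1 oppr0.
rewrite /= !big_cons IH.
have -> : - N.+1%:Z + 1 = - N%:Z by lia.
have -> : N%:Z + 1 = N.+1%:Z by lia.
by ring.
Qed.

(** The reflection has centre [-1/2], the window has centre [0]: all terms but the one at [N]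
    cancel. *)
Lemma sum_win_anti N (f : int -> R) : (forall n, f (- n - 1) = - f n) ->
  \sum_(n <- win N) f n = f N%:Z.
Proof.
move=> fo; elim: N => [|N IH]; first by rewrite big_seq1.
rewrite /= !big_cons IH.
have -> : - N.+1%:Z = - N%:Z - 1 by lia.
by rewrite fo; ring.
Qed.

Lemma size_win N : size (win N) = N.*2.+1.
Proof. by elim: N => [//|N IH]; rewrite /= IH doubleS. Qed.

Section decay.
Variables (f : int -> R) (C : R).
Hypothesis fC : forall n, `|f n| <= C * eR `|n|.

Lemma win_cvg : cvgn (fun N => \sum_(n <- win N) f n).
Proof.
have cs : cvgn (series (fun k => f k.+1%:Z + f (- k.+1%:Z))).
  apply: (abs_cvg_series (v := fun k => (2 * C) * expR (- (k.+1%:R * pi)))).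
    move=> k; have h1 := fC k.+1%:Z; have h2 := fC (- k.+1%:Z).
    rewrite abszN in h2; have h3 := ler_normD (f k.+1%:Z) (f (- k.+1%:Z)).
    by apply: (le_trans h3); rewrite -[expR _]/(eR k.+1); move: h1 h2; rewrite /=; lra.
  by apply: sums_cvg; exact: (@sumsZ _ _ (2 * C) _ (cvg_exp_series (@pi_gt0 R))).
apply/cvg_ex; exists (f 0 + limn (series (fun k => f k.+1%:Z + f (- k.+1%:Z)))).
rewrite (_ : (fun N => _) = (fun N => f 0 + series (fun k => f k.+1%:Z + f (- k.+1%:Z)) N)).
  by apply: cvgD => //; exact: cvg_cst.
by apply/funext => N; rewrite sum_winE.
Qed.

Lemma sum_win_shift N (s : int) : \sum_(l <- win N) f (l - s) - \sum_(l <- win N) f (l - (s + 1)) =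
  f (N%:Z - s) - f (- N%:Z - (s + 1)).
Proof.
rewrite -sumrB (eq_bigr (fun l => f (l + 1 - (s + 1)) - f (l - (s + 1)))).
  by rewrite (sum_win_tel N (fun l => f (l - (s + 1)))); congr (f _ - _); lia.
by move=> l _; congr (f _ - _); lia.
Qed.

(** A shift by [n] exchanges [n] terms at each end of the window, all at distance at least [N - n]
    from [0]. *)
Lemma sum_win_shift_nat N (n : nat) : (n <= N)%N ->
  `|\sum_(l <- win N) f (l - n%:Z) - \sum_(l <- win N) f l| <= n%:R * (2 * C * eR (N - n)).
Proof.
have C0 : 0 <= C.
  have := fC 0; rewrite absz0 /eR mul0r oppr0 expR0 mulr1; apply: le_trans.
  exact: normr_ge0.
elim: n => [_|n IH nN].
  by rewrite mul0r (eq_bigr f) ?subrr ?normr0// => l _; rewrite subr0.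
set T0 := \sum_(l <- win N) f l.
have -> : \sum_(l <- win N) f (l - n.+1%:Z) - T0 =
   (\sum_(l <- win N) f (l - n%:Z) - T0) - (f (N%:Z - n%:Z) - f (- N%:Z - n.+1%:Z)).
  have := sum_win_shift N n%:Z; have -> : n%:Z + 1 = n.+1%:Z by lia.
  by move=> <-; ring.
rewrite (le_trans (ler_normB _ _))//.
have H1 := IH (ltnW nN).
have E1 : eR (N - n) <= eR (N - n.+1) by apply: eR_le; lia.
have H2 : `|f (N%:Z - n%:Z)| <= C * eR (N - n.+1).
  apply: le_trans (fC _) _; apply: ler_wpM2l => //.
  by apply: eR_le; lia.
have H3 : `|f (- N%:Z - n.+1%:Z)| <= C * eR (N - n.+1).
  apply: le_trans (fC _) _; apply: ler_wpM2l => //.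
  by apply: eR_le; lia.
have H4 := ler_normB (f (N%:Z - n%:Z)) (f (- N%:Z - n.+1%:Z)).
have H5 : n%:R * (2 * C * eR (N - n)) <= n%:R * (2 * C * eR (N - n.+1)).
  by apply: ler_wpM2l => //; apply: ler_wpM2l => //; rewrite mulr_ge0.
rewrite -(natr1 n) mulrDl mul1r; lra.
Qed.

End decay.

Lemma sum_win_shift_bound N (n : int) (f : int -> R) (C : R) :
  (forall n, `|f n| <= C * eR `|n|) -> (`|n| <= N)%N ->
  `|\sum_(l <- win N) f (l - n) - \sum_(l <- win N) f l| <= `|n|%N%:R * (2 * C * eR (N - `|n|)).
Proof.
move=> fC nN; have [n0|n0] := leP 0 n.
  by rewrite -{1}(gez0_abs n0); exact: sum_win_shift_nat.
have fC' m : `|f (- m)| <= C * eR `|m| by have := fC (- m); rewrite abszN.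
have := @sum_win_shift_nat (fun m => f (- m)) C fC' N `|n|%N nN.
rewrite sum_win_opp -(sum_win_opp N (fun l => f (- (l - _)))).
rewrite (eq_bigr (fun l => f (l - n)))//.
by move=> l _; congr f; lia.
Qed.

Lemma cvg_sqr_eR (C : R) : C * N%:R * (2 * N%:R + 1) * eR N @[N --> \oo] --> 0.
Proof.
apply: (@cvg0_harmonic R _ (`|C| * 36)) => N.
rewrite !normrM -!mulrA; apply: ler_wpM2l; first exact: normr_ge0.
rewrite (ger0_norm (_ : 0 <= eR N)); last exact/ltW/eR_gt0.
rewrite ger0_norm// ger0_norm ?addr_ge0 ?mulr_ge0//.
case: N => [|n]; first by rewrite mul0r mulr_ge0// harmonic_ge0.
set N := n.+1; have N1 : 1 <= N%:R :> R by rewrite ler1n.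
have e0 := eR_gt0 N.
(* The cubic term of the exponential series outweighs the two factors of order [N]. *)
have H : N%:R ^+ 3 / 6 <= (eR N)^-1.
  rewrite /eR expRN invrK (@le_trans _ _ (1 + (N%:R * pi) ^+ 3 / 3`!%:R))//; last first.
    by apply: (@expR_ge1Dxn R _ 2); rewrite mulr_ge0 ?pi_ge0.
  rewrite (_ : 3`! = 6)%N// ler_wpDl// ler_pM2r// ler_pXn2r ?nnegrE ?mulr_ge0 ?pi_ge0//.
  by rewrite ler_peMr// ; have := @pi_ge2 R; lra.
rewrite /harmonic /= -/N.
have H1 : eR N <= 6 / N%:R ^+ 3.
  have h := ler_wpM2l (ltW e0) H; rewrite mulfV ?gt_eqF// in h.
  by rewrite ler_pdivlMr ?exprn_gt0 ?(lt_le_trans ltr01)//; lra.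
apply: (@le_trans _ _ (N%:R * ((3 * N%:R) * (6 / N%:R ^+ 3)))).
  apply: ler_wpM2l => //; apply: ler_pM; [|exact: ltW|by lra|exact: H1].
  by rewrite addr_ge0// mulr_ge0.
have n0 : N%:R != 0 :> R by rewrite pnatr_eq0.
have -> : N%:R * ((3 * N%:R) * (6 / N%:R ^+ 3)) = 18 / N%:R :> R by field.
apply: (@le_trans _ _ (36 * (2 * N%:R)^-1)).
  by rewrite le_eqVlt; apply/orP; left; apply/eqP; field.
apply: ler_wpM2l => //; rewrite lef_pV2 ?posrE; lra.
Qed.

(** For fixed [n] the inner sum is a shifted window, off by at most a multiple of
    [|n| eR (N - |n|)]. The weight [w n] supplies [eR |n|], so each of the [2 N + 1] errors is of
    order [N eR N]. *)
Lemma window_conv (w psi : int -> R) (C D : R) :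
  (forall n, `|w n| <= C * eR `|n|) -> (forall n, `|psi n| <= D * eR `|n|) ->
  (\sum_(n <- win N) \sum_(l <- win N) w n * psi (l - n)) -
    (\sum_(n <- win N) w n) * (\sum_(l <- win N) psi l) @[N --> \oo] --> 0.
Proof.
move=> wC pD.
have C0 : 0 <= C.
  have := wC 0; rewrite absz0 /eR mul0r oppr0 expR0 mulr1; apply: le_trans.
  exact: normr_ge0.
have D0 : 0 <= D.
  have := pD 0; rewrite absz0 /eR mul0r oppr0 expR0 mulr1; apply: le_trans.
  exact: normr_ge0.
have := cvg_sqr_eR (2 * C * D); move/cvgnP => H; apply/cvgnP => e e0.
have [N0 HN0] := H e e0; exists N0 => N /HN0; rewrite !subr0; apply: le_trans.
rewrite mulr_suml -sumrB (le_trans (ler_norm_sum _ _ _))//.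
apply: (le_trans _ (ler_norm _)).
rewrite (@le_trans _ _ (\sum_(n <- win N) (2 * C * D * N%:R * eR N)))//; last first.
  rewrite big_const_seq count_predT size_win iter_addr_0 -[_ *+ N.*2.+1]mulr_natr.
  have -> : N.*2.+1%:R = 2 * N%:R + 1 :> R by rewrite -addnn -addn1 !natrD; ring.
  by rewrite le_eqVlt; apply/orP; left; apply/eqP; ring.
rewrite big_seq [leRHS]big_seq; apply: ler_sum => n; rewrite mem_win => nN.
rewrite -mulr_sumr -mulrBr normrM.
have B := sum_win_shift_bound pD nN.
apply: (@le_trans _ _ ((C * eR `|n|) * (N%:R * (2 * D * eR (N - `|n|))))).
  apply: ler_pM; [exact: normr_ge0|exact: normr_ge0|exact: wC|].
  apply: le_trans B _; apply: ler_wpM2r.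
    by rewrite !mulr_ge0// ltW ?eR_gt0.
  by rewrite ler_nat.
have -> : eR N = eR `|n| * eR (N - `|n|) by rewrite -eRD subnKC.
by rewrite le_eqVlt; apply/orP; left; apply/eqP; ring.
Qed.

End window_convolution.

(** * Hyperbolic functions on translates of the lattice pi Z *)

Section lattice_sums.
Context {R : realType}.
Implicit Types (x u : R) (n l : int).

Definition sc u : R := (cosh u)^-1.
Definition th u : R := sinh u / cosh u.
(** The value [cs 0 = 0] silently omits the diagonal in sums over [cs (pt 0 (l - n))]. *)
Definition cs u : R := (sinh u)^-1.
Definition pt x n : R := x + n%:~R * pi.

Definition zs (f : int -> R) : R := limn (fun N => \sum_(n <- win N) f n).

Lemma zs_cvg (f : int -> R) (C : R) : (forall n, `|f n| <= C * eR `|n|) ->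
  (\sum_(n <- win N) f n) @[N --> \oo] --> zs f.
Proof. exact: win_cvg. Qed.

Lemma zsE (f : int -> R) : cvgn (fun N => \sum_(n <- win N) f n) ->
  sums (fun k => f k.+1%:Z + f (- k.+1%:Z)) (zs f - f 0).
Proof.
move=> cf; rewrite /sums (_ : series _ = (fun N => \sum_(n <- win N) f n - f 0)).
  by apply: cvgB; [exact: cf|exact: cvg_cst].
by apply/funext => N; rewrite sum_winE addrC addKr.
Qed.

Lemma zs_derive (F dF : int -> R -> R) (C x : R) :
  (forall n (t : R), is_derive t 1 (F n) (dF n t)) ->
  (forall n (t : R), `|dF n t| <= C * expR `|t| * eR `|n|) ->
  (forall t : R, cvgn (fun N => \sum_(n <- win N) F n t)) ->
  is_derive x 1 (fun t => zs (F^~ t)) (zs (dF^~ x)).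
Proof.
move=> HF HdF cF.
have C0 : 0 <= C.
  have := HdF 0 0; rewrite normr0 expR0 absz0 /eR mul0r oppr0 expR0 !mulr1.
  exact: le_trans (normr_ge0 _).
have E1 : (fun t => zs (F^~ t)) =
    (fun t => F 0 t + limn (series (fun k => F k.+1%:Z t + F (- k.+1%:Z) t))).
  by apply/funext => t; rewrite (sums_lim (zsE (cF t))) addrC subrK.
have E2 : zs (dF^~ x) = dF 0 x + limn (series (fun k => dF k.+1%:Z x + dF (- k.+1%:Z) x)).
  have cd := win_cvg (fun n => HdF n x).
  by rewrite (sums_lim (zsE cd)) addrC subrK.
have H : is_derive x 1 (fun t => limn (series (fun k => F k.+1%:Z t + F (- k.+1%:Z) t)))
    (limn (series (fun k => dF k.+1%:Z x + dF (- k.+1%:Z) x))); last first.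
  rewrite E1 E2; exact: (dadd (HF 0 x) H).
apply: (@is_derive_series R (fun k t => F k.+1%:Z t + F (- k.+1%:Z) t)
  (fun k t => dF k.+1%:Z t + dF (- k.+1%:Z) t)
  (fun k => (2 * (C * expR (`|x| + 1))) * expR (- (k.+1%:R * pi))) (x - 1) (x + 1)).
- move=> k t xt; have h1 := HdF k.+1%:Z t; have h2 := HdF (- k.+1%:Z) t.
  rewrite abszN in h2; have h3 := ler_normD (dF k.+1%:Z t) (dF (- k.+1%:Z) t).
  have h4 : C * expR `|t| * eR k.+1 <= C * expR (`|x| + 1) * eR k.+1.
    apply: ler_wpM2r; first exact/ltW/eR_gt0.
    apply: ler_wpM2l => //; rewrite ler_expR.
    have -> : t = x + (t - x) by ring.
    rewrite (le_trans (ler_normD _ _))// lerD2l ler_norml; lra.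
  by apply: (le_trans h3); rewrite -[expR (- _)]/(eR k.+1); move: h1 h2; rewrite /=; lra.
- by apply: sums_cvg; exact: (@sumsZ _ _ _ _ (cvg_exp_series (@pi_gt0 R))).
- by move=> t _; exact: (sums_cvg (zsE (cF t))).
- by apply/andP; split; lra.
Qed.

Lemma pt_norm x n : (`|n|%N%:R * pi) - `|x| <= `|pt x n|.
Proof.
have -> : `|n|%N%:R * pi = `|n%:~R * pi| :> R.
  by rewrite normrM (ger0_norm (@pi_ge0 R)) -intr_norm -abszE.
have := ler_normB (pt x n) x; rewrite /pt addrC addKr; lra.
Qed.

Lemma exp_pt x n : expR (- `|pt x n|) <= expR `|x| * eR `|n|.
Proof. by rewrite /eR -expRD ler_expR; have := pt_norm x n; lra. Qed.

Lemma sc_decay x n : `|sc (pt x n)| <= 2 * expR `|x| * eR `|n|.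
Proof.
rewrite ger0_norm; last by rewrite invr_ge0 ltW// cosh_gt0.
rewrite (le_trans (sech_le _))// -mulrA; apply: ler_wpM2l => //.
exact: exp_pt.
Qed.

Lemma sc_ge0 u : 0 <= sc u. Proof. by rewrite invr_ge0 ltW// cosh_gt0. Qed.
Lemma sc_le1 u : sc u <= 1. Proof. by rewrite invf_le1 ?cosh_ge1// cosh_gt0. Qed.
Lemma th_le1 u : `|th u| <= 1.
Proof.
rewrite normrM normfV (ger0_norm (ltW (cosh_gt0 u))) ler_pdivrMr ?cosh_gt0// mul1r.
rewrite -sinh_norm -(cosh_norm u); have := cosh_subsinh `|u|; have := expR_gt0 (- `|u|); lra.
Qed.

Lemma cs_decay x n : 1 <= `|pt x n| -> `|cs (pt x n)| <= 4 * expR `|x| * eR `|n|.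
Proof.
move=> h; rewrite (le_trans (csch_le h))// -mulrA; apply: ler_wpM2l => //.
exact: exp_pt.
Qed.

Lemma csd_ge1 n : n != 0 -> 1 <= `|pt 0 n|.
Proof.
move=> n0; rewrite /pt add0r normrM (ger0_norm (@pi_ge0 R)).
have : 1 <= `|n%:~R| :> R by rewrite -intr_norm -[1]/(1%:~R) ler_int; lia.
have := @pi_ge2 R; set a := `|_| => p2 a1.
by rewrite (le_trans _ (ler_wpM2r _ a1)) ?mul1r ?pi_ge0//; lra.
Qed.

Lemma half_ge1 n : 1 <= `|pt (pi / 2) n|.
Proof.
have -> : pt (pi / 2) n = (2 * n + 1)%:~R * (pi / 2) by rewrite /pt intrD intrM; field.
have p1 := @pihalf_ge1 R.
rewrite normrM [X in _ * X]ger0_norm; last by lra.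
have a1 : 1 <= `|(2 * n + 1)%:~R| :> R by rewrite -intr_norm -[1]/(1%:~R) ler_int; lia.
by rewrite (le_trans p1)// ler_peMl//; lra.
Qed.

Lemma cs0 : cs 0 = 0. Proof. by rewrite /cs sinh0 invr0. Qed.
Lemma csN u : cs (- u) = - cs u. Proof. by rewrite /cs sinhN invrN. Qed.

Lemma csd_decay n : `|cs (pt 0 n)| <= 4 * eR `|n|.
Proof.
have [->|/csd_ge1/cs_decay] := eqVneq n 0.
  by rewrite /pt add0r mul0r cs0 normr0 mulr_ge0// ltW// eR_gt0.
by rewrite normr0 expR0 mulr1.
Qed.

Lemma csd2_decay n : `|cs (pt 0 n) ^+ 2| <= 16 * eR `|n|.
Proof.
rewrite normrX; have h := csd_decay n.
have e1 : eR `|n| <= 1 :> R.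
  by have := @eR_le R 0 `|n| (leq0n _); rewrite {2}/eR mul0r oppr0 expR0.
have e0 := @eR_gt0 R `|n|.
have : 0 <= `|cs (pt 0 n)| by exact: normr_ge0.
move: h e1 e0; move: (eR _) (`|cs _|) => a b; nra.
Qed.

Lemma chcs_decay n : `|cosh (pt 0 n) * cs (pt 0 n) ^+ 2| <= 16 * eR `|n|.
Proof.
have [->|n0] := eqVneq n 0.
  by rewrite /pt add0r mul0r cs0 expr0n mulr0 normr0 mulr_ge0// ltW// eR_gt0.
have h := csch_le (csd_ge1 n0).
rewrite normrM normrX (ger0_norm (ltW (cosh_gt0 _))) -(cosh_norm (pt 0 n)).
have h2 : cosh `|pt 0 n| <= expR `|pt 0 n|.
  by rewrite -cosh_sinh lerDl sinh_ge0.
have h3 := exp_pt 0 n; rewrite normr0 expR0 mul1r in h3.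
apply: (@le_trans _ _ (expR `|pt 0 n| * (4 * expR (- `|pt 0 n|)) ^+ 2)).
  apply: ler_pM; [by rewrite cosh_norm ltW ?cosh_gt0|exact: exprn_ge0 (normr_ge0 _)|exact: h2|].
  by rewrite ler_pXn2r ?nnegrE// mulr_ge0// expR_ge0.
have -> : expR `|pt 0 n| * (4 * expR (- `|pt 0 n|)) ^+ 2 = 16 * expR (- `|pt 0 n|).
  by rewrite expRN; field; rewrite gt_eqF ?expR_gt0.
by apply: ler_wpM2l.
Qed.

Lemma pt_diff x n l : pt x l = pt x n + pt 0 (l - n).
Proof. by rewrite /pt intrB; ring. Qed.

Lemma pt00 : pt 0 0 = 0. Proof. by rewrite /pt mul0r addr0. Qed.

Lemma pt0_neq0 n : n != 0 -> pt 0 n != 0.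
Proof. by move=> /csd_ge1; apply: contraTneq => ->; rewrite normr0 -ltNge ltr01. Qed.

Lemma sum_diag N (f : int -> R) :
  \sum_(n <- win N) \sum_(l <- win N) (if l == n then f n else 0) = \sum_(n <- win N) f n.
Proof.
rewrite big_seq [RHS]big_seq; apply: eq_bigr => n nN.
rewrite (bigD1_seq n)//= ?uniq_win// eqxx big1 ?addr0// => l /negbTE ->.
by [].
Qed.

Lemma sum_swap N (f g : int -> R) :
  \sum_(n <- win N) \sum_(l <- win N) f l * g (l - n) =
  \sum_(n <- win N) \sum_(l <- win N) f n * g (- (l - n)).
Proof.
rewrite exchange_big; apply: eq_bigr => n _; apply: eq_bigr => l _.
by rewrite opprB.
Qed.

(** Partial fractions: [tanh a - tanh b = sinh (a - b) / (cosh a cosh b)]. *)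
Lemma sc_mul x n l : sc (pt x n) * sc (pt x l) =
  (if l == n then sc (pt x n) ^+ 2 else 0) + (th (pt x l) * cs (pt 0 (l - n)) - th (pt x n) * cs (pt 0 (l - n))).
Proof.
case: eqVneq => [->|ln]; first by rewrite subrr addr0 expr2.
rewrite (pt_diff x n l); set u := pt x n; set c := pt 0 _.
have s0 : sinh c != 0 by rewrite sinh_neq0// pt0_neq0// subr_eq0.
have h1 := cosh_neq0 u; have h2 := cosh_neq0 (u + c).
rewrite add0r -mulrBl /th /cs /sc.
have -> : sinh (u + c) / cosh (u + c) - sinh u / cosh u = sinh c / (cosh (u + c) * cosh u).
  have -> : sinh c = sinh (u + c) * cosh u - cosh (u + c) * sinh u by rewrite -sinhB; congr sinh; ring.
  by field; rewrite h1 h2.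
by field; rewrite ?h1 ?h2 ?s0.
Qed.

Definition coth u : R := cosh u / sinh u.

Lemma cs_mul x n l : (forall m, pt x m != 0) -> cs (pt x n) * cs (pt x l) =
  (if l == n then cs (pt x n) ^+ 2 else 0) + (coth (pt x n) * cs (pt 0 (l - n)) - coth (pt x l) * cs (pt 0 (l - n))).
Proof.
move=> xm; case: eqVneq => [->|ln]; first by rewrite subrr addr0 expr2.
have h1 := sinh_neq0 (xm n); have h2 := sinh_neq0 (xm l).
move: h2; rewrite (pt_diff x n l); set u := pt x n in h1 *; set c := pt 0 _ => h2.
have s0 : sinh c != 0 by rewrite sinh_neq0// pt0_neq0// subr_eq0.
rewrite add0r -mulrBl /coth /cs.
have -> : cosh u / sinh u - cosh (u + c) / sinh (u + c) = sinh c / (sinh (u + c) * sinh u).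
  have -> : sinh c = sinh (u + c) * cosh u - cosh (u + c) * sinh u by rewrite -sinhB; congr sinh; ring.
  by field; rewrite h1 h2.
by field; rewrite ?h1 ?h2 ?s0.
Qed.

(** Partial fractions with a double pole. Over a common denominator the difference has the numerator
    [q^2 (1 + b^2 - a^2)], once [p^2 = 1 + q^2] is used, and this is [0]. *)
Lemma sc_mul2 x n l : sc (pt x n) * sc (pt x l) ^+ 2 =
  (if l == n then sc (pt x n) ^+ 3 else 0) +
  (sc (pt x l) * th (pt x l) * cs (pt 0 (l - n)) - sc (pt x n) * cs (pt 0 (l - n)) ^+ 2
   + sc (pt x l) * (cosh (pt 0 (l - n)) * cs (pt 0 (l - n)) ^+ 2)).
Proof.
case: eqVneq => [->|ln].
  by rewrite (subrr n) pt00 cs0 expr0n !mulr0 subrr !addr0 -exprS.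
rewrite (pt_diff x n l); set u := pt x n; set c := pt 0 _.
have s0 : sinh c != 0 by rewrite sinh_neq0// pt0_neq0// subr_eq0.
have h1 := cosh_neq0 u; have h2 := cosh_neq0 (u + c).
have E : cosh u = cosh (u + c) * cosh c - sinh (u + c) * sinh c.
  by rewrite -coshB; congr cosh; ring.
have E2 := cosh_sqr c; have E3 := cosh_sqr (u + c).
rewrite add0r /th /cs /sc; move: h1; rewrite E.
move: (cosh (u + c)) (sinh (u + c)) h2 E3 => a b h2 E3.
move: (cosh c) (sinh c) E2 s0 => p q E2 s0 h1.
apply/eqP; rewrite -subr_eq0; apply/eqP.
transitivity ((q ^+ 2 + a ^+ 2 - a ^+ 2 * p ^+ 2 + b ^+ 2 * q ^+ 2) / ((a * p - b * q) * a ^+ 2 * q ^+ 2)).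
  by field; rewrite ?h1 ?h2 ?s0.
have -> : q ^+ 2 + a ^+ 2 - a ^+ 2 * p ^+ 2 + b ^+ 2 * q ^+ 2 = 0 by rewrite E2 E3; ring.
by rewrite mul0r.
Qed.

End lattice_sums.

(** * The differential equation and the amplitude *)

Section dn_identities.
Context {R : realType}.
Implicit Types (x u : R) (n l : int).

(* Up to scaling, [Dn] is the Jacobi elliptic function dn. *)
Definition Dn x : R := zs (fun n => sc (pt x n)).
Definition dDn x : R := zs (fun n => - (sc (pt x n) * th (pt x n))).
Definition W2 x : R := zs (fun n => sc (pt x n) ^+ 2).
Definition W3 x : R := zs (fun n => sc (pt x n) ^+ 3).
Definition zA : R := zs (fun n => cs (pt (pi / 2) n) ^+ 2).
Definition zS : R := zs (fun n => cs (pt 0 n) ^+ 2).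
Definition zP : R := zs (fun n => cosh (pt 0 n) * cs (pt 0 n) ^+ 2).

Lemma zs_conv (w psi : int -> R) (C D : R) :
  (forall n, `|w n| <= C * eR `|n|) -> (forall n, `|psi n| <= D * eR `|n|) ->
  (\sum_(n <- win N) \sum_(l <- win N) w n * psi (l - n)) @[N --> \oo] --> zs w * zs psi.
Proof.
move=> wC pD; have H := window_conv wC pD.
have H2 := cvgD H (cvgM (zs_cvg wC) (zs_cvg pD)).
rewrite add0r in H2.
pose T N := \sum_(n <- win N) \sum_(l <- win N) w n * psi (l - n).
pose U N := (\sum_(n <- win N) w n) * (\sum_(l <- win N) psi l).
have E : (fun N => T N - U N + U N) = T by apply/funext => N; rewrite subrK.
by rewrite -[X in X @ _ --> _]/T -E; exact: H2.
Qed.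

Lemma zs_odd (f : int -> R) : (forall n, f (- n) = - f n) -> zs f = 0.
Proof.
move=> fN; rewrite /zs; have -> : (fun N => \sum_(n <- win N) f n) = (fun=> 0).
  by apply/funext => N; exact: sum_win_odd.
exact: lim_cst.
Qed.

Lemma pt0N n : pt 0 (- n) = - pt 0 n :> R.
Proof. by rewrite /pt mulrNz !add0r mulNr. Qed.

Lemma psiN n : cs (pt 0 (- n)) = - cs (pt 0 n) :> R.
Proof. by rewrite pt0N csN. Qed.

Lemma sc_dom x n (y : R) : `|y| <= 1 -> `|sc (pt x n) * y| <= 2 * expR `|x| * eR `|n|.
Proof.
move=> y1; rewrite normrM (le_trans _ (sc_decay x n))//.
by rewrite ler_piMr.
Qed.

Lemma sc_norm1 u : `|sc u| <= 1. Proof. by rewrite ger0_norm ?sc_ge0// sc_le1. Qed.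

Lemma sc2_decay x n : `|sc (pt x n) ^+ 2| <= 2 * expR `|x| * eR `|n|.
Proof. by rewrite expr2; apply: sc_dom; exact: sc_norm1. Qed.

Lemma sc3_decay x n : `|sc (pt x n) ^+ 3| <= 2 * expR `|x| * eR `|n|.
Proof.
by rewrite exprS; apply: sc_dom; rewrite normrX exprn_ile1 ?normr_ge0// sc_norm1.
Qed.

Lemma scth_decay x n : `|sc (pt x n) * th (pt x n)| <= 2 * expR `|x| * eR `|n|.
Proof. by apply: sc_dom; exact: th_le1. Qed.

Lemma csh_decay n : `|cs (pt (pi / 2) n)| <= (4 * expR (pi / 2) * eR `|n| : R).
Proof.
have := cs_decay (@half_ge1 R n); have -> : `|pi / 2| = pi / 2 :> R; last by [].
by rewrite ger0_norm// divr_ge0// pi_ge0.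
Qed.

Lemma csh2_decay n : `|cs (pt (pi / 2) n) ^+ 2| <= ((4 * expR (pi / 2)) ^+ 2 * eR `|n| : R).
Proof.
rewrite normrX; have h := csh_decay n.
have e1 : eR `|n| <= 1 :> R.
  by have := @eR_le R 0 `|n| (leq0n _); rewrite {2}/eR mul0r oppr0 expR0.
have e0 := @eR_gt0 R `|n|.
have c0 : 0 <= 4 * expR (pi / 2) :> R by rewrite mulr_ge0// expR_ge0.
apply: (@le_trans _ _ ((4 * expR (pi / 2) * eR `|n|) ^+ 2)).
  by rewrite ler_pXn2r ?nnegrE ?normr_ge0// mulr_ge0// ltW.
rewrite exprMn; apply: ler_wpM2l; first exact: sqr_ge0.
by rewrite expr2; apply: ler_piMl => //; exact: ltW.
Qed.

(** The map [n -> - n - 1] negates the points [pt (pi / 2) n]. *)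
Lemma half_win N : \sum_(n <- win N) cs (pt (pi / 2) n) = cs (pt (pi / 2) N%:Z) :> R.
Proof.
apply: sum_win_anti => n; rewrite -csN; congr cs.
by rewrite /pt intrB intrN; field.
Qed.

Lemma half_neq0 n : pt (pi / 2) n != 0 :> R.
Proof. by have := @half_ge1 R n; apply: contraTneq => ->; rewrite normr0 -ltNge ltr01. Qed.

Lemma eR_cvg0 (C : R) : C * eR N @[N --> \oo] --> 0.
Proof.
have h := cvg_series_cvg_0 (sums_cvg (@sumsZ _ _ C _ (cvg_exp_series (@pi_gt0 R)))).
by move: h; rewrite -(cvg_shiftS (fun N => C * eR N)).
Qed.

Lemma half_win_cvg : \sum_(n <- win N) cs (pt (pi / 2) n) @[N --> \oo] --> (0 : R).
Proof.
apply/cvgnP => e e0; have /cvgnP/(_ e e0)[N0 H] := @eR_cvg0 (4 * expR (pi / 2)).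
exists N0 => N /H; rewrite !subr0 half_win; apply: le_trans.
exact: le_trans (csh_decay N%:Z) (ler_norm _).
Qed.

(** Both functions tend to [1] or both to [-1], and [coth a - tanh b = cosh (a - b) / (sinh a cosh
    b)] with [a - b] independent of [n]. *)
Lemma w_decay x n : `|coth (pt (pi / 2) n) - th (pt x n)| <=
  cosh (pi / 2 - x) * (4 * expR (pi / 2)) * eR `|n|.
Proof.
have -> : coth (pt (pi / 2) n) - th (pt x n) = cosh (pi / 2 - x) * cs (pt (pi / 2) n) * sc (pt x n).
  have -> : pi / 2 - x = pt (pi / 2) n - pt x n by rewrite /pt; ring.
  have h1 := sinh_neq0 (half_neq0 n); have h2 := cosh_neq0 (pt x n).
  by rewrite coshB /coth /th /cs /sc; field; rewrite ?h1 ?h2.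
rewrite 2!normrM (ger0_norm (ltW (cosh_gt0 _))) -2!mulrA; apply: ler_wpM2l.
  exact: ltW (cosh_gt0 _).
apply: le_trans (csh_decay n).
by rewrite ler_piMr ?normr_ge0 ?sc_norm1.
Qed.

(* Partial fractions turn the double series of [Dn x ^+ 2] into
   [- 2 th (pt x n) cs (pt 0 (l - n))] plus the diagonal. The square of the series of
   [cs (pt (pi / 2) n)], which is [0], contributes [2 coth (pt (pi / 2) n)] instead,
   and only the sum of both is summable in [n]. *)
Lemma Dn_sqr x : Dn x ^+ 2 = W2 x + zA.
Proof.
pose d N := \sum_(n <- win N) sc (pt x n).
pose a N := \sum_(n <- win N) cs (pt (pi / 2) n) : R.
pose psi n := cs (pt 0 n) : R.
pose w n := coth (pt (pi / 2) n) - th (pt x n).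
have E N : d N * d N + a N * a N = \sum_(n <- win N) sc (pt x n) ^+ 2 +
    \sum_(n <- win N) cs (pt (pi / 2) n) ^+ 2 +
    2 * (\sum_(n <- win N) \sum_(l <- win N) w n * psi (l - n)).
  have E1 : d N * d N = \sum_(n <- win N) sc (pt x n) ^+ 2 -
      2 * \sum_(n <- win N) \sum_(l <- win N) th (pt x n) * psi (l - n).
    rewrite mulr_suml; under eq_bigr do rewrite mulr_sumr.
    under eq_bigr do under eq_bigr do rewrite sc_mul.
    under eq_bigr do rewrite big_split sumrB /=.
    rewrite big_split sumrB /= sum_diag (sum_swap N (fun l => th (pt x l)) psi).
    under [X in _ + (X - _)]eq_bigr do under eq_bigr do rewrite /psi psiN mulrN.
    under [X in _ + (X - _)]eq_bigr do rewrite sumrN.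
    by rewrite sumrN /psi; ring.
  have E2 : a N * a N = \sum_(n <- win N) cs (pt (pi / 2) n) ^+ 2 +
      2 * \sum_(n <- win N) \sum_(l <- win N) coth (pt (pi / 2) n) * psi (l - n).
    rewrite mulr_suml; under eq_bigr do rewrite mulr_sumr.
    under eq_bigr do under eq_bigr do rewrite (cs_mul _ _ half_neq0).
    under eq_bigr do rewrite big_split sumrB /=.
    rewrite big_split sumrB /= sum_diag (sum_swap N (fun l => coth (pt (pi / 2) l)) psi).
    under [X in _ + (_ - X)]eq_bigr do under eq_bigr do rewrite /psi psiN mulrN.
    under [X in _ + (_ - X)]eq_bigr do rewrite sumrN.
    by rewrite sumrN /psi; ring.
  rewrite E1 E2; under [X in _ = _ + 2 * X]eq_bigr do under eq_bigr do rewrite /w mulrBl.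
  under [X in _ = _ + 2 * X]eq_bigr do rewrite sumrB.
  by rewrite sumrB; ring.
have dc : d N @[N --> \oo] --> Dn x := zs_cvg (sc_decay x).
have ac : a N @[N --> \oo] --> 0 := half_win_cvg.
have L1 := cvgD (cvgM dc dc) (cvgM ac ac).
have wc := zs_conv (w_decay x) (@csd_decay R).
rewrite (zs_odd psiN) mulr0 in wc.
have L2 := cvgD (cvgD (zs_cvg (sc2_decay x)) (zs_cvg csh2_decay)) (cvgM (cvg_cst (2 : R)) wc).
rewrite mulr0 addr0 in L1; rewrite mulr0 addr0 in L2; rewrite expr2.
apply: (@cvgn_uniq R (fun N => d N * d N + a N * a N)); first exact: L1.
by rewrite (funext E); exact: L2.
Qed.

(** Here every weight decays, so each double series off the diagonal factors by [zs_conv]; the one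
    with the odd [psi] vanishes. *)
Lemma Dn_W2 x : Dn x * W2 x = W3 x + Dn x * (zP - zS).
Proof.
pose psi n := cs (pt 0 n) : R.
pose phi n := cosh (pt 0 n) * cs (pt 0 n) ^+ 2 : R.
pose q n := sc (pt x n) * th (pt x n).
have E N : (\sum_(n <- win N) sc (pt x n)) * (\sum_(n <- win N) sc (pt x n) ^+ 2) =
   \sum_(n <- win N) sc (pt x n) ^+ 3 -
    (\sum_(n <- win N) \sum_(l <- win N) q n * psi (l - n)) -
    (\sum_(n <- win N) \sum_(l <- win N) sc (pt x n) * psi (l - n) ^+ 2) +
    (\sum_(n <- win N) \sum_(l <- win N) sc (pt x n) * phi (l - n)).
  rewrite mulr_suml; under eq_bigr do rewrite mulr_sumr.
  under eq_bigr do under eq_bigr do rewrite sc_mul2.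
  under eq_bigr do rewrite big_split big_split sumrB /=.
  rewrite big_split big_split sumrB /= sum_diag (sum_swap N q psi).
  rewrite (sum_swap N (fun l => sc (pt x l)) phi).
  under [X in _ + (X - _ + _)]eq_bigr do under eq_bigr do rewrite /psi psiN mulrN.
  under [X in _ + (X - _ + _)]eq_bigr do rewrite sumrN.
  under [X in _ + (_ - _ + X)]eq_bigr do under eq_bigr do rewrite /phi psiN pt0N coshN sqrrN.
  by rewrite sumrN /psi /phi; ring.
have L1 := cvgM (zs_cvg (sc_decay x)) (zs_cvg (sc2_decay x)).
have qc := zs_conv (scth_decay x) (@csd_decay R).
rewrite (zs_odd psiN) mulr0 in qc.
have L2 := cvgD (cvgB (cvgB (zs_cvg (sc3_decay x)) qc) (zs_conv (sc_decay x) (@csd2_decay R)))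
  (zs_conv (sc_decay x) (@chcs_decay R)).
have -> : W3 x + Dn x * (zP - zS) = W3 x - 0 - Dn x * zS + Dn x * zP by ring.
apply: (@cvgn_uniq R (fun N => (\sum_(n <- win N) sc (pt x n)) * (\sum_(n <- win N) sc (pt x n) ^+ 2))).
  exact: L1.
by rewrite (funext E); exact: L2.
Qed.

Definition gam : R := 1 + 2 * zA + 2 * (zP - zS).

Lemma isd_pt n x : isd (fun t => pt t n) x 1.
Proof. by rewrite /isd /pt; dauto; ring. Qed.

Lemma isd_sc (f : R -> R) x a : isd f x a -> isd (fun t => sc (f t)) x (- (sc (f x) * th (f x)) * a).
Proof.
move=> fa; eapply derive_conv; first by eapply dinv; [exact: cosh_neq0|apply: isd_cosh; exact: fa].
by rewrite /sc /th /=; field; rewrite cosh_neq0.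
Qed.

Lemma isd_th (f : R -> R) x a : isd f x a -> isd (fun t => th (f t)) x (sc (f x) ^+ 2 * a).
Proof.
move=> fa; eapply derive_conv.
  eapply dmul; first by apply: isd_sinh; exact: fa.
  by eapply dinv; [exact: cosh_neq0|apply: isd_cosh; exact: fa].
have h := cosh_sqr (f x); have h2 := cosh_neq0 (f x).
rewrite /sc /th /=; transitivity ((cosh (f x) ^+ 2 - sinh (f x) ^+ 2) / cosh (f x) ^+ 2 * a).
  by field.
by rewrite {1}h; field.
Qed.

Lemma th_sqr u : th u ^+ 2 = 1 - sc u ^+ 2.
Proof.
rewrite /th /sc exprMn exprVn; have h := cosh_sqr u; have h2 := cosh_neq0 u.
have -> : sinh u ^+ 2 = cosh u ^+ 2 - 1 by lra.
by field.
Qed.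

Lemma Dn_cvg x : cvgn (fun N => \sum_(n <- win N) sc (pt x n)).
Proof. exact: (win_cvg (sc_decay x)). Qed.

Lemma isd_Dn x : is_derive x 1 Dn (dDn x).
Proof.
apply: (@zs_derive R (fun n t => sc (pt t n)) (fun n t => - (sc (pt t n) * th (pt t n))) 2).
- by move=> n t; eapply derive_conv; [apply: isd_sc; exact: isd_pt|rewrite mulr1].
- by move=> n t; rewrite normrN; exact: scth_decay.
- exact: Dn_cvg.
Qed.

Lemma zsZ (f : int -> R) (c C : R) : (forall n, `|f n| <= C * eR `|n|) ->
  zs (fun n => c * f n) = c * zs f.
Proof.
move=> fC; rewrite [LHS]/zs (_ : (fun N => _) = fun N => c * \sum_(n <- win N) f n).
  by apply: cvg_lim => //; apply: cvgM; [exact: cvg_cst|exact: zs_cvg fC].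
by apply/funext => N; rewrite mulr_sumr.
Qed.

Lemma zsD (f g : int -> R) (C D : R) : (forall n, `|f n| <= C * eR `|n|) ->
  (forall n, `|g n| <= D * eR `|n|) -> zs (fun n => f n + g n) = zs f + zs g.
Proof.
move=> fC gD; rewrite [LHS]/zs (_ : (fun N => _) = fun N => \sum_(n <- win N) f n + \sum_(n <- win N) g n).
  by apply: cvg_lim => //; apply: cvgD; [exact: zs_cvg fC|exact: zs_cvg gD].
by apply/funext => N; rewrite big_split.
Qed.

(** Termwise [sech'' = sech - 2 sech^3]; [Dn_W2] and [Dn_sqr] then express the sum of cubes through
    [Dn]. *)
Lemma isd_dDn x : is_derive x 1 dDn (gam * Dn x - 2 * Dn x ^+ 3).
Proof.
have -> : gam * Dn x - 2 * Dn x ^+ 3 = zs (fun n => sc (pt x n) + (-2) * sc (pt x n) ^+ 3).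
  have c3 n : `|(-2) * sc (pt x n) ^+ 3| <= (2 * (2 * expR `|x|)) * eR `|n|.
    rewrite normrM normrN (ger0_norm (ler0n _ 2)) -mulrA; apply: ler_wpM2l => //.
    exact: sc3_decay.
  rewrite (zsD (sc_decay x) c3) (zsZ (-2) (sc3_decay x)) -/(Dn x) -/(W3 x).
  have h1 := Dn_W2 x; have h2 := Dn_sqr x.
  have -> : W3 x = Dn x * W2 x - Dn x * (zP - zS) by rewrite h1; ring.
  have -> : W2 x = Dn x ^+ 2 - zA by rewrite h2; ring.
  by rewrite /gam; ring.
apply: (@zs_derive R (fun n t => - (sc (pt t n) * th (pt t n))) (fun n t => sc (pt t n) + (-2) * sc (pt t n) ^+ 3) 6).
- move=> n t; eapply derive_conv; first by eapply dopp; eapply dmul; [apply: isd_sc; exact: isd_pt|apply: isd_th; exact: isd_pt].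
  have h := th_sqr (pt t n).
  rewrite /= !mulr1; transitivity (sc (pt t n) * th (pt t n) ^+ 2 - sc (pt t n) ^+ 3); first by ring.
  by rewrite h; ring.
- move=> n t; have h1 := sc_decay t n; have h3 := sc3_decay t n.
  rewrite (le_trans (ler_normD _ _))// normrM normrN (ger0_norm (ler0n _ 2)); lra.
- move=> t; apply: (@win_cvg _ _ (2 * expR `|t|)) => n; rewrite normrN; exact: scth_decay.
Qed.

End dn_identities.

(** * The amplitude and the change of variable *)

Section amplitude.
Context {R : realType}.
Implicit Types (x u y : R) (n l : int).

Local Notation M := (@Dn R 0).

Lemma Dn_ge x : sc x <= Dn x.
Proof.
have := zs_cvg (sc_decay x) => c; apply: (ler_cvg_to (cvg_cst (sc x)) c).
near=> N; rewrite sum_winE.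
have -> : pt x 0 = x by rewrite /pt mul0r addr0.
by rewrite lerDl; apply: sumr_ge0 => k _; rewrite addr_ge0 ?sc_ge0.
Unshelve. all: by end_near. Qed.

Lemma Dn_gt0 x : 0 < Dn x.
Proof. by apply: lt_le_trans (Dn_ge x); rewrite invr_gt0 cosh_gt0. Qed.

Lemma thN u : th (- u) = - th u.
Proof. by rewrite /th sinhN coshN mulNr. Qed.

Lemma dDn0 : dDn (0 : R) = 0.
Proof.
by apply: zs_odd => n; rewrite pt0N /sc coshN thN mulrN.
Qed.

(** The Gudermannian function plus [pi / 2], an antiderivative of sech. *)
Definition gd u : R := 2 * atan (expR u).

Lemma isd_gd (f : R -> R) x a : isd f x a -> isd (fun t => gd (f t)) x (sc (f x) * a).
Proof.
move=> fa; eapply derive_conv.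
  by eapply dmul; [exact: dcst|eapply datan; eapply dexpR; exact: fa].
rewrite /= mul0r add0r /sc /cosh expRN; have e0 := expR_gt0 (f x).
have h1 : 1 + expR (f x) ^+ 2 != 0 by rewrite gt_eqF// addr_gt0// exprn_gt0.
by field; rewrite ?h1 ?(gt_eqF e0) // addrC ?h1.
Qed.

(** The values of [gd] tend to [pi] as [n] grows; subtracting those at [x = 0] makes the series
    converge. *)
Definition ph x : R := zs (fun n => gd (pt x n) - gd (pt 0 n)).

Lemma gd_decay x n : `|gd (pt x n) - gd (pt 0 n)| <= `|x| * (2 * expR `|x|) * eR `|n|.
Proof.
have H (a b : R) : a <= b -> `|a| <= `|x| -> `|b| <= `|x| ->
    `|gd (pt b n) - gd (pt a n)| <= 2 * expR `|x| * eR `|n| * (b - a).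
  move=> ab ax bx.
  apply: (@mvt_le R (fun t => gd (pt t n)) (fun t => sc (pt t n) * 1) a b _ ab) => t /andP[at_ tb].
    by apply: isd_gd; exact: isd_pt.
  rewrite mulr1; apply: le_trans (sc_decay _ _) _; apply: ler_wpM2r; first exact/ltW/eR_gt0.
  apply: ler_wpM2l => //; rewrite ler_expR.
  by move: ax bx; rewrite !ler_norml => /andP[? ?] /andP[? ?]; apply/andP; split; lra.
have [x0|x0] := leP 0 x.
  have h0 : `|0 : R| <= `|x| by rewrite normr0 normr_ge0.
  apply: le_trans (H 0 x x0 h0 (lexx _)) _.
  by rewrite subr0 !(ger0_norm x0) le_eqVlt; apply/orP; left; apply/eqP; ring.
have h0 : `|0 : R| <= `|x| by rewrite normr0 normr_ge0.
rewrite distrC; apply: le_trans (H x 0 (ltW x0) (lexx _) h0) _.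
by rewrite sub0r !(ltr0_norm x0) le_eqVlt; apply/orP; left; apply/eqP; ring.
Qed.

Lemma isd_ph x : is_derive x 1 ph (Dn x).
Proof.
apply: (@zs_derive R (fun n t => gd (pt t n) - gd (pt 0 n)) (fun n t => sc (pt t n)) 2).
- move=> n t; eapply derive_conv.
    by eapply dadd; [apply: isd_gd; exact: isd_pt|exact: dcst].
  by rewrite mulr1 addr0.
- by move=> n t; exact: sc_decay.
- by move=> t; exact: (win_cvg (gd_decay t)).
Qed.

Lemma ph0 : ph 0 = 0.
Proof.
rewrite /ph /zs; have -> : (fun N => \sum_(n <- win N) (gd (pt 0 n) - gd (pt 0 n))) = (fun=> 0).
  by apply/funext => N; rewrite big1// => n _; rewrite subrr.
exact: lim_cst.
Qed.

Lemma ph_pi : ph pi = pi.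
Proof.
apply: cvg_lim => //.
have -> : (fun N => \sum_(n <- win N) (gd (pt pi n) - gd (pt 0 n))) =
   (fun N => 2 * atan (expR (N.+1%:R * pi)) - 2 * atan (eR N)).
  apply/funext => N; have -> : \sum_(n <- win N) (gd (pt pi n) - gd (pt 0 n)) =
      \sum_(n <- win N) (gd (pt 0 (n + 1)) - gd (pt 0 n)).
    by apply: eq_bigr => n _; congr (gd _ - _); rewrite /pt intrD; ring.
  rewrite (sum_win_tel N (fun n => gd (pt 0 n))) /gd /eR; congr (2 * atan (expR _) - 2 * atan (expR _)).
    have -> : N%:Z + 1 = N.+1%:Z by lia.
    by rewrite /pt add0r.
  by rewrite pt0N /pt add0r.
have c0 : eR N @[N --> \oo] --> (0 : R).
  by have := @eR_cvg0 R 1; under eq_fun do rewrite mul1r.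
have ey : expR (N.+1%:R * pi) @[N --> \oo] --> (+oo%R : set_system R).
  apply/cvgryPge => A; near=> N.
  have h1 := @expR_ge1Dx R (N.+1%:R * pi).
  have h2 : A <= N%:R by near: N; exact: nbhs_infty_ger.
  have h3 : N%:R <= N.+1%:R * pi :> R.
    rewrite -natr1; have := @pi_ge2 R; have : 0 <= N%:R :> R by rewrite ler0n.
    by move: (N%:R) (pi) => a b; nra.
  lra.
have e1 : atan (expR (N.+1%:R * pi)) @[N --> \oo] --> (pi / 2 : R).
  exact: (cvg_comp _ _ ey (@cvgy_atan R)).
have e2 : atan (eR N) @[N --> \oo] --> (atan 0 : R).
  exact: (cvg_comp _ _ c0 (@continuous_atan R 0)).
have h := cvgB (cvgM (cvg_cst (2 : R)) e1) (cvgM (cvg_cst (2 : R)) e2).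
have e3 : 2 * (pi / 2) - 2 * atan 0 = pi :> R by rewrite atan0; field.
by rewrite e3 in h; exact: h.
Unshelve. all: by end_near. Qed.

(** The lemniscatic case, to be derived from the antisymmetry of [F]. *)
Hypothesis gamE : gam = 3 / 2 * M ^+ 2 :> R.

(* The first integral of [isd_dDn]. *)
Lemma Dn_energy x : 0 <= x -> dDn x ^+ 2 = 3 / 2 * M ^+ 2 * Dn x ^+ 2 - Dn x ^+ 4 - M ^+ 4 / 2.
Proof.
move=> x0; have H (t : R) : is_derive t 1 (fun s => dDn s ^+ 2 - gam * Dn s ^+ 2 + Dn s ^+ 4) 0.
  eapply derive_conv.
    eapply dadd; [eapply dadd; [eapply dpow; exact: isd_dDn|]|eapply dpow; exact: isd_Dn].
    by eapply dopp; eapply dmul; [exact: dcst|eapply dpow; exact: isd_Dn].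
  by rewrite /= !expr1; ring.
have := mvt_cst x0 (fun t _ => H t) (fun=> fun=> erefl).
by rewrite dDn0 gamE => h; lra.
Qed.

(* [(P, S)] below and [M^2 (cos (2 ph), sin (2 ph))] lie on the same circle and solve
   the same linear system with the same initial value. *)
Lemma Dn_cos x : 0 <= x -> 4 * Dn x ^+ 2 = M ^+ 2 * (2 + 2 * cos (ph x) ^+ 2).
Proof.
move=> x0; have M0 := Dn_gt0 0; have Mn0 := gt_eqF M0.
pose P (t : R) := 4 * Dn t ^+ 2 - 3 * M ^+ 2.
pose S (t : R) := - 4 * dDn t.
have H (t : R) : is_derive t 1 (fun s => P s * cos (2 * ph s) + S s * sin (2 * ph s)) 0.
  have d2 : isd (fun s => 2 * ph s) t (0 * ph t + 2 * Dn t).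
    exact: (dmul (dcst 2 t) (isd_ph t)).
  have dP : isd P t (8 * Dn t * dDn t).
    rewrite /P; eapply derive_conv.
      by eapply dadd; [eapply dmul; [exact: dcst|eapply dpow; exact: isd_Dn]|exact: dcst].
    by rewrite /= expr1; ring.
  have dS : isd S t (- 4 * (gam * Dn t - 2 * Dn t ^+ 3)).
    rewrite /S; eapply derive_conv; first by eapply dmul; [exact: dcst|exact: isd_dDn].
    by rewrite /=; ring.
  eapply derive_conv; first exact: (dadd (dmul dP (dcos d2)) (dmul dS (dsin d2))).
  by rewrite /= /P /S gamE; field.
have := mvt_cst x0 (fun t _ => H t) (fun=> fun=> erefl).
rewrite ph0 mulr0 cos0 sin0 mulr0 addr0 mulr1 => K.
have P0 : P 0 = M ^+ 2 by rewrite /P; ring.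
have PS : P x ^+ 2 + S x ^+ 2 = (M ^+ 2) ^+ 2.
  by rewrite /P /S exprMn Dn_energy//; field.
have cs1 := cos2Dsin2 (2 * ph x).
have Z : (P x - M ^+ 2 * cos (2 * ph x)) ^+ 2 + (S x - M ^+ 2 * sin (2 * ph x)) ^+ 2 = 0.
  transitivity ((P x ^+ 2 + S x ^+ 2) + (M ^+ 2) ^+ 2 * (cos (2 * ph x) ^+ 2 + sin (2 * ph x) ^+ 2)
     - 2 * M ^+ 2 * (P x * cos (2 * ph x) + S x * sin (2 * ph x))); first by ring.
  by rewrite PS cs1 -K P0; ring.
have PE : P x = M ^+ 2 * cos (2 * ph x).
  have h2 := sqr_ge0 (S x - M ^+ 2 * sin (2 * ph x)).
  have h1 : (P x - M ^+ 2 * cos (2 * ph x)) ^+ 2 <= 0 by lra.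
  have /eqP : (P x - M ^+ 2 * cos (2 * ph x)) ^+ 2 = 0 by apply/eqP; rewrite eq_le h1 sqr_ge0.
  by rewrite expf_eq0 /= subr_eq0 => /eqP.
have : cos (2 * ph x) = 2 * cos (ph x) ^+ 2 - 1.
  have -> : 2 * ph x = ph x + ph x by ring.
  by rewrite cosD; have := cos2Dsin2 (ph x); lra.
move: PE; rewrite /P => PE ce; rewrite ce in PE.
lra.
Qed.

Lemma ph_incr x y : x < y -> ph x < ph y.
Proof.
move=> xy; have [c _ e] := mvt_ex (ltW xy) (fun t _ => isd_ph t).
by rewrite -subr_gt0 e mulr_gt0 ?Dn_gt0 ?subr_gt0.
Qed.

Lemma ph_bounds x : 0 < x < pi -> 0 < ph x < pi.
Proof.
by move=> /andP[/ph_incr + /ph_incr]; rewrite ph0 ph_pi => -> ->.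
Qed.

Lemma ph_onto v : 0 < v < pi -> exists2 x, 0 < x < pi & ph x = v.
Proof.
move=> /andP[v0 vp]; have p0 := @pi_gt0 R.
have [||x] := @IVT R ph 0 pi v (ltW p0).
- by apply: is_derive_within => t _; exact: isd_ph.
- by rewrite ph0 ph_pi (min_idPl (ltW p0)) (max_idPr (ltW p0)) !ltW.
rewrite in_itv /= => /andP[x0 xp] E; exists x => //; rewrite !lt_neqAle x0 xp !andbT.
apply/andP; split; apply/eqP => e; move: E.
  by rewrite -e ph0 => e'; rewrite e' ltxx in v0.
by rewrite e ph_pi => e'; rewrite e' ltxx in vp.
Qed.

Definition tph y : R := tan (ph (2 * atan y) / 2).

Lemma atan_bounds y : 0 < y -> 0 < 2 * atan y < pi.
Proof.
move=> y0; have h := @lt_atan R 0 y y0; rewrite atan0 in h.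
by have h2 := @atan_ltpi2 R y; apply/andP; split; lra.
Qed.

Lemma cos_half_gt0 y : 0 < y -> 0 < cos (ph (2 * atan y) / 2).
Proof.
move=> /atan_bounds/ph_bounds/andP[h1 h2]; apply: cos_gt0_pihalf; apply/andP; split; lra.
Qed.

Lemma tph_gt0 y : 0 < y -> 0 < tph y.
Proof.
move=> y0; have c0 := cos_half_gt0 y0; have /ph_bounds/andP[h1 h2] := atan_bounds y0.
by rewrite /tph /tan divr_gt0// sin_gt0_pi//; apply/andP; split; lra.
Qed.

Lemma tph_onto k : 0 < k -> exists2 y, 0 < y & tph y = k.
Proof.
move=> k0; have [x /andP[x0 xp] E] := ph_onto (atan_bounds k0).
exists (tan (x / 2)).
  by rewrite /tan divr_gt0//; [apply: sin_gt0_pi|apply: cos_gt0_pihalf]; apply/andP; split; lra.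
rewrite /tph tanK; last by rewrite in_itv /=; apply/andP; split; lra.
have -> : 2 * (x / 2) = x by field.
by rewrite E (_ : 2 * atan k / 2 = atan k) ?atanK//; field.
Qed.

Definition dtph y : R := M * Num.sqrt (1 + tph y ^+ 4) / (1 + y ^+ 2).

Lemma isd_tph y : 0 < y -> is_derive y 1 tph (dtph y).
Proof.
move=> y0; have c0 := cos_half_gt0 y0; have cn0 := gt_eqF c0.
have y1 : 1 + y ^+ 2 != 0 by rewrite gt_eqF// addr_gt0// exprn_gt0.
have D0 := Dn_gt0 (2 * atan y).
eapply derive_conv.
  eapply (@dcomp R (@tan R) (fun y => ph (2 * atan y) / 2)); first by apply: is_derive_tan; rewrite cn0.
  eapply dmul; [|exact: dcst].
  eapply (@dcomp R ph (fun y => 2 * atan y)); first exact: isd_ph.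
  by eapply dmul; [exact: dcst|eapply datan; exact: did].
rewrite /= /dtph.
(* Both sides are nonnegative, and their squares agree by [Dn_cos] and [1 + cos^2 v = 2 (cos^4 (v/2)
   + sin^4 (v/2))]. *)
suff -> : M * Num.sqrt (1 + tph y ^+ 4) = Dn (2 * atan y) / cos (ph (2 * atan y) / 2) ^+ 2.
  by move: (cos _) cn0 (Dn _) => c cn0 d; field; rewrite ?cn0 ?y1.
rewrite -[LHS]ger0_norm; last by rewrite mulr_ge0 ?sqrtr_ge0// ltW// Dn_gt0.
rewrite -[RHS]ger0_norm; last by rewrite divr_ge0 ?sqr_ge0// ltW.
apply/eqP; rewrite -(eqrXn2 (n := 2))//; apply/eqP; rewrite !real_normK ?num_real//.
rewrite exprMn sqr_sqrtr; last by rewrite addr_ge0// exprn_even_ge0.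
have /andP[x0 _] := atan_bounds y0.
have := Dn_cos (ltW x0); rewrite /tph /tan.
have -> : cos (ph (2 * atan y)) = 2 * cos (ph (2 * atan y) / 2) ^+ 2 - 1.
  have {1}-> : ph (2 * atan y) = ph (2 * atan y) / 2 + ph (2 * atan y) / 2 by field.
  by rewrite cosD; have := cos2Dsin2 (ph (2 * atan y) / 2); lra.
have := cos2Dsin2 (ph (2 * atan y) / 2).
move: (sin _) (cos _) cn0 (Dn (2 * atan y)) => s c cn0 d sc1 E.
have d2 : d ^+ 2 = M ^+ 2 * (2 + 2 * (2 * c ^+ 2 - 1) ^+ 2) / 4 by lra.
have s4 : s ^+ 4 = (1 - c ^+ 2) ^+ 2 by rewrite -sc1; ring.
rewrite !expr_div_n d2 s4; field; rewrite cn0 //.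
Qed.

Lemma dtph_cont y : 0 < y -> {for y, continuous dtph}.
Proof.
move=> y0; have tc := is_derive_cont (isd_tph y0).
have y1 : 1 + y ^+ 2 != 0 by rewrite gt_eqF// addr_gt0// exprn_gt0.
apply: (@continuousM _ _ (fun y => M * Num.sqrt (1 + tph y ^+ 4)) (fun y => (1 + y ^+ 2)^-1)).
  apply: (@continuousM _ _ (fun=> M) (fun y => Num.sqrt (1 + tph y ^+ 4))); first exact: cst_continuous.
  apply: (@continuous_comp _ _ _ (fun y => 1 + tph y ^+ 4) (@Num.sqrt R)); last exact: sqrt_continuous.
  exact: (is_derive_cont (dadd (dcst 1 y) (dpow 4 (isd_tph y0)))).
exact: (is_derive_cont (dinv (f := fun y => 1 + y ^+ 2) y1 (dadd (dcst 1 y) (dpow 2 (did y))))).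
Qed.

Lemma quartic_integral :
  (\int[lebesgue_measure]_(s in `]0%R, +oo[) ((Num.sqrt (1 + s ^+ 4))^-1)%:E = (M * (pi / 2))%:E)%E.
Proof.
have s0 (s : R) : 0 < 1 + s ^+ 4 by rewrite ltr_pwDl// exprn_even_ge0.
have M0 := Dn_gt0 0.
etransitivity; first apply: (@substitution_itv0y R tph dtph (fun s => (Num.sqrt (1 + s ^+ 4))^-1)).
- exact: isd_tph.
- exact: dtph_cont.
- move=> x x0; rewrite divr_gt0 ?mulr_gt0 ?sqrtr_gt0//.
  by rewrite addr_gt0// exprn_gt0.
- exact: tph_gt0.
- by move=> e /tph_onto[y y0 E]; exists y => //; rewrite E.
- move=> k; have k0 : 0 < Num.max k 1 by rewrite lt_max ltr01 orbT.
  have [y y0 E] := tph_onto k0.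
  by exists y => //; rewrite E le_max lexx.
- move=> y y0; apply: continuousV; first by rewrite sqrtr_eq0 -ltNge.
  apply: (@continuous_comp _ _ _ (fun y => 1 + y ^+ 4) (@Num.sqrt R)); last exact: sqrt_continuous.
  exact: (is_derive_cont (dadd (dcst 1 y) (dpow 4 (did y)))).
- by move=> y _; rewrite invr_ge0 sqrtr_ge0.
have -> : (fun x => ((Num.sqrt (1 + tph x ^+ 4))^-1 * dtph x)%:E) =
    (fun x => (M%:E * (oneDsqr x)^-1%:E)%E).
  apply/funext => x; rewrite -EFinM /dtph; congr _%:E.
  rewrite mulrA mulrCA mulVf ?mulr1// sqrtr_eq0 -ltNge //.
have mD (D : set R) : measurable D -> measurable_fun D (fun x : R => ((oneDsqr x)^-1)%:E).
  move=> mD; apply/measurable_EFinP; apply: (@measurable_funS _ _ _ _ setT) => //.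
  by apply: continuous_measurable_fun; exact: continuous_oneDsqrV.
rewrite EFinM -integral0y_oneDsqr -integral_itv_obnd_cbnd; last exact: mD.
rewrite ge0_integralZl ?lee_fin ?(ltW M0)//; first exact: mD.
Qed.

Lemma Lambda0E : Lambda0 R = pi * M ^+ 2 / 8.
Proof.
have := Gamma_quarter_sqr quartic_integral; rewrite /Lambda0 => E.
have -> : Gamma (1 / 4 : R) ^+ 4 = (Gamma (1 / 4 : R) ^+ 2) ^+ 2 by rewrite -exprM.
rewrite E !exprMn sqr_sqrtr ?pi_ge0//.
by have := gt_eqF (@pi_gt0 R); move: (@pi R) => p /negbT p0; field.
Qed.

End amplitude.

(** * The constants of the differential equation *)

Section lattice_constants.
Context {R : realType}.
Implicit Types (n k : int).

(** Duplication formulas lead from [k pi] to the half-lattice [k pi / 2], whose even points form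
    [pi Z] and whose odd points form [pi / 2 + pi Z]. *)
Definition hp k : R := k%:~R * (pi / 2).

Lemma hp_even n : hp (2 * n) = pt 0 n.
Proof. by rewrite /hp /pt intrM add0r; field. Qed.

Lemma hp_odd n : hp (2 * n + 1) = pt (pi / 2) n.
Proof. by rewrite /hp /pt intrD intrM; field. Qed.

Lemma hp_norm k : `|hp k| = `|k|%N%:R * (pi / 2).
Proof.
have p0 := @pi_ge0 R; rewrite normrM [X in _ * X]ger0_norm ?divr_ge0//.
by rewrite -intr_norm -abszE.
Qed.

Lemma exp_hp k : expR (- `|hp k|) ^+ 2 = eR `|k|.
Proof. by rewrite hp_norm expr2 -expRD /eR; congr expR; field. Qed.

Lemma sch2_decay k : `|sc (hp k) ^+ 2| <= 4 * eR `|k|.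
Proof.
rewrite ger0_norm ?sqr_ge0// -exp_hp (_ : 4 * _ = (2 * expR (- `|hp k|)) ^+ 2); last by ring.
rewrite ler_pXn2r// ?nnegrE ?mulr_ge0 ?expR_ge0 ?sc_ge0//; exact: sech_le.
Qed.

Lemma hp_ge1 k : k != 0 -> 1 <= `|hp k|.
Proof.
move=> k0; rewrite hp_norm; have p1 := @pihalf_ge1 R.
have : 1 <= `|k|%N%:R :> R by rewrite ler1n; lia.
by move: (pi / 2) p1 => p p1 k1; rewrite (le_trans p1)// ler_peMl// (le_trans ler01).
Qed.

Lemma cshp2_decay k : `|cs (hp k) ^+ 2| <= 16 * eR `|k|.
Proof.
have [->|/hp_ge1 k1] := eqVneq k 0.
  by rewrite /hp mul0r cs0 expr0n normr0 mulr_ge0// ltW// eR_gt0.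
rewrite normrX -exp_hp (_ : 16 * _ = (4 * expR (- `|hp k|)) ^+ 2); last by ring.
by rewrite ler_pXn2r// ?nnegrE ?mulr_ge0 ?expR_ge0 ?normr_ge0//; exact: csch_le.
Qed.

(** The odd numbers [2 n + 1] overshoot the window of radius [2 N] by one term on the right. *)
Lemma sum_win_split N (f : int -> R) :
  \sum_(n <- win N) (f (2 * n) + f (2 * n + 1)) = \sum_(n <- win N.*2) f n + f (N.*2.+1%:Z).
Proof.
elim: N => [|N IH]; first by rewrite /= !big_seq1.
rewrite doubleS /= !big_cons IH.
have -> : 2 * N.+1%:Z = N.*2.+2%:Z by lia.
have -> : 2 * (- N.+1%:Z) = - N.*2.+2%:Z by lia.
have -> : N.*2.+2%:Z + 1 = N.*2.+3%:Z by lia.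
have -> : - N.*2.+2%:Z + 1 = - N.*2.+1%:Z by lia.
by ring.
Qed.

Lemma zs_split (f : int -> R) (C : R) : (forall n, `|f n| <= C * eR `|n|) ->
  zs f = zs (fun n => f (2 * n) + f (2 * n + 1)).
Proof.
move=> fC; apply/esym; rewrite [LHS]/zs (funext (fun N => sum_win_split N f)).
have dbl : (fun N => N.*2) @ \oo --> \oo.
  by apply/cvgnyPge => A; near=> N; rewrite -addnn; apply: leq_trans (leq_addr _ _); near: N; exact: nbhs_infty_ge.
have c1 : (\sum_(n <- win N.*2) f n) @[N --> \oo] --> zs f.
  exact: (cvg_comp _ _ dbl (zs_cvg fC)).
have c2 : f (N.*2.+1%:Z) @[N --> \oo] --> (0 : R).
  apply/cvgnP => e e0; have /cvgnP/(_ e e0)[N0 H] := @eR_cvg0 R C.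
  exists N0 => N NN; have := H N.*2.+1; rewrite !subr0 => h.
  apply: le_trans (fC _) _; apply: le_trans (ler_norm _) (h _).
  by rewrite -addnn; lia.
have := cvgD c1 c2; rewrite addr0 => c.
by apply: cvg_lim => //; exact: c.
Unshelve. all: by end_near. Qed.

(** Corrects the duplication formulas at [k = 0], where [cs] is [0] by convention but [sc] is
    [1]. *)
Definition dl k : R := (k == 0)%:R.

Lemma dl0 : dl 0 = 1. Proof. by rewrite /dl eqxx. Qed.

Lemma dl_neq0 k : k != 0 -> dl k = 0. Proof. by rewrite /dl => /negbTE ->. Qed.

Lemma dl_decay k : `|dl k| <= 1 * eR `|k|.
Proof.
rewrite /dl mul1r; case: eqVneq => [->|_]; last by rewrite normr0 ltW// eR_gt0.
by rewrite absz0 /eR mul0r oppr0 expR0 normr1.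
Qed.

Lemma zs_dl : zs dl = 1.
Proof.
rewrite /zs; have -> : (fun N => \sum_(n <- win N) dl n) = (fun=> 1).
  apply/funext => N; rewrite sum_winE.
  have -> : (fun k : nat => dl k.+1%:Z + dl (- k.+1%:Z)) = (fun=> 0).
    apply/funext => k; rewrite /dl (_ : (- k.+1%:Z == 0) = false); last by [].
    by rewrite (_ : (k.+1%:Z == 0) = false) ?addr0.
  by rewrite /dl eqxx /series /= big1 ?addr0.
exact: lim_cst.
Qed.

(** For [k > 0] this is [acoef k pi / pi^2]: its plain sum belongs to [Gf (pi, 0)], its alternating
    sum to [Gf (pi, pi)]. *)
Definition ck k : R := cosh (pt 0 k) * cs (pt 0 k) ^+ 2.

Lemma pt0_hp k : pt 0 k = hp k + hp k.
Proof. by rewrite /pt /hp add0r; field. Qed.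

Lemma ckE k : ck k = (sc (hp k) ^+ 2 + cs (hp k) ^+ 2) / 4 - dl k / 4.
Proof.
rewrite /ck; case: (eqVneq k 0) => [->|k0].
  by rewrite dl0 pt00 /hp mul0r cs0 /sc cosh0 invr1; field.
have u0 : hp k != 0 by have := hp_ge1 k0; apply: contraTneq => ->; rewrite normr0 -ltNge.
rewrite (dl_neq0 k0) pt0_hp coshD /cs /sc sinhD; have s0 := sinh_neq0 u0; have c0 := cosh_neq0 (hp k).
move: (sinh (hp k)) (cosh (hp k)) s0 c0 => s c s0 c0.
have -> : s * c + c * s = 2 * s * c by ring.
by field; rewrite ?s0 ?c0.
Qed.

Lemma cs2E k : cs (pt 0 k) ^+ 2 = (cs (hp k) ^+ 2 - sc (hp k) ^+ 2) / 4 + dl k / 4.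
Proof.
case: (eqVneq k 0) => [->|k0].
  by rewrite dl0 pt00 /hp mul0r cs0 /sc cosh0 invr1; field.
have u0 : hp k != 0 by have := hp_ge1 k0; apply: contraTneq => ->; rewrite normr0 -ltNge.
rewrite (dl_neq0 k0) pt0_hp /cs /sc sinhD; have s0 := sinh_neq0 u0; have c0 := cosh_neq0 (hp k).
have := cosh_sqr (hp k).
move: (sinh (hp k)) (cosh (hp k)) s0 c0 => s c s0 c0 E.
rewrite mul0r addr0; transitivity ((c ^+ 2 - s ^+ 2) / (4 * s ^+ 2 * c ^+ 2)); last by field; rewrite ?s0 ?c0.
have -> : s * c + c * s = 2 * s * c by ring.
have -> : c ^+ 2 - s ^+ 2 = 1 by rewrite E; ring.
by field; rewrite ?s0 ?c0.
Qed.

Local Notation He := (@W2 R 0).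
Local Notation Ho := (@W2 R (pi / 2)).

Lemma zs_lin (f g h : int -> R) (a b c C D E : R) :
  (forall n, `|f n| <= C * eR `|n|) -> (forall n, `|g n| <= D * eR `|n|) ->
  (forall n, `|h n| <= E * eR `|n|) ->
  zs (fun n => a * f n + b * g n + c * h n) = a * zs f + b * zs g + c * zs h.
Proof.
move=> fC gD hE; have H (u : int -> R) x X : (forall n, `|u n| <= X * eR `|n|) ->
    forall n, `|x * u n| <= (`|x| * X) * eR `|n|.
  by move=> uX n; rewrite normrM -mulrA ler_wpM2l.
have HD n : `|a * f n + b * g n| <= (`|a| * C + `|b| * D) * eR `|n|.
  by rewrite (le_trans (ler_normD _ _))// mulrDl lerD ?H.
rewrite (zsD HD (H _ c _ hE)) (zsD (H _ a _ fC) (H _ b _ gD)).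
by rewrite (zsZ a fC) (zsZ b gD) (zsZ c hE).
Qed.

Lemma zs_sch : zs (fun k => sc (hp k) ^+ 2) = He + Ho.
Proof.
rewrite (zs_split sch2_decay) -(zsD (@sc2_decay R 0) (@sc2_decay R (pi / 2))).
by congr zs; apply/funext => n; rewrite hp_even hp_odd.
Qed.

Lemma zs_csh : zs (fun k => cs (hp k) ^+ 2) = zS + zA.
Proof.
rewrite (zs_split cshp2_decay) -(zsD (@csd2_decay R) (@csh2_decay R)).
by congr zs; apply/funext => n; rewrite hp_even hp_odd.
Qed.

Lemma zPE : zP = (He + Ho + zS + zA) / 4 - 4^-1 :> R.
Proof.
have -> : zP = zs (fun k => 4^-1 * sc (hp k) ^+ 2 + 4^-1 * cs (hp k) ^+ 2 + (- 4^-1) * dl k) :> R.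
  by rewrite /zP; congr zs; apply/funext => k; rewrite -/(ck k) ckE; field.
by rewrite (zs_lin _ _ _ sch2_decay cshp2_decay dl_decay) zs_sch zs_csh zs_dl; field.
Qed.

Lemma zSE : zS = (zS + zA - He - Ho) / 4 + 4^-1 :> R.
Proof.
transitivity (zs (fun k => 4^-1 * cs (hp k) ^+ 2 + (- 4^-1) * sc (hp k) ^+ 2 + 4^-1 * dl k)).
  by rewrite /zS; congr zs; apply/funext => k; rewrite cs2E; field.
by rewrite (zs_lin _ _ _ cshp2_decay sch2_decay dl_decay) zs_sch zs_csh zs_dl; field.
Qed.

Definition sgz k : R := (-1) ^+ `|k|.

Lemma sgz_even n : sgz (2 * n) = 1.
Proof. by rewrite /sgz abszM exprM sqrrN !expr1n. Qed.

Lemma sgz_odd n : sgz (2 * n + 1) = -1.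
Proof.
rewrite /sgz; have [m ->] : exists m, `|(2 * n + 1)%R|%N = (2 * m + 1)%N.
  have [n0|n0] := leP 0 n; [exists `|n|%N | exists `|n|.-1]; lia.
by rewrite exprD exprM sqrrN !expr1n mul1r.
Qed.

Lemma ck_decay k : `|ck k| <= 16 * eR `|k|. Proof. exact: chcs_decay. Qed.

Lemma sgck_decay k : `|sgz k * ck k| <= 16 * eR `|k|.
Proof. by rewrite normrM normrX normrN1 expr1n mul1r ck_decay. Qed.

Lemma zs_sgck : zs (fun k => sgz k * ck k) = (He + zS - Ho - zA) / 4 - 4^-1 :> R.
Proof.
pose a n := (sc (pt 0 n) ^+ 2 + cs (pt 0 n) ^+ 2 : R).
pose b n := (sc (pt (pi / 2) n) ^+ 2 + cs (pt (pi / 2) n) ^+ 2 : R).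
have aC n : `|a n| <= (2 * expR `|0 : R| + 16) * eR `|n|.
  rewrite mulrDl; apply: le_trans (ler_normD _ _) _.
  by apply: lerD; [exact: sc2_decay|exact: csd2_decay].
have bC n : `|b n| <= (2 * expR `|pi / 2 : R| + (4 * expR (pi / 2)) ^+ 2) * eR `|n|.
  rewrite mulrDl; apply: le_trans (ler_normD _ _) _.
  by apply: lerD; [exact: sc2_decay|exact: csh2_decay].
rewrite (zs_split sgck_decay).
have -> : (fun n => sgz (2 * n) * ck (2 * n) + sgz (2 * n + 1) * ck (2 * n + 1)) =
   (fun n => 4^-1 * a n + (- 4^-1) * b n + (- 4^-1) * dl n).
  apply/funext => n; rewrite sgz_even sgz_odd !ckE hp_even hp_odd /a /b.
  have -> : dl (2 * n + 1) = 0 by rewrite /dl (_ : (2 * n + 1 == 0) = false)//; lia.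
  have -> : dl (2 * n) = dl n by rewrite /dl mulf_eq0.
  by field.
rewrite (zs_lin _ _ _ aC bC dl_decay) zs_dl.
rewrite (zsD (@sc2_decay R 0) (@csd2_decay R)) (zsD (@sc2_decay R (pi / 2)) (@csh2_decay R)).
by rewrite -/zS -/zA -/He -/Ho; field.
Qed.

Lemma pt0_nat (k : nat) : pt 0 k%:Z = k%:R * pi :> R.
Proof. by rewrite /pt add0r. Qed.

Lemma ckN k : ck (- k) = ck k.
Proof. by rewrite /ck pt0N coshN csN sqrrN. Qed.

Lemma ck0 : ck 0 = 0.
Proof. by rewrite /ck pt00 cs0 expr0n mulr0. Qed.

Lemma acoef_pi (k : nat) : 2 * acoef k.+1%:R pi = pi ^+ 2 * (ck k.+1%:Z + ck (- k.+1%:Z)) :> R.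
Proof.
rewrite ckN /ck pt0_nat /acoef subrr mulr0 cosh0 mul0r subr0 /cs.
have s0 : sinh (k.+1%:R * pi) != 0 :> R by rewrite gt_eqF// sinh_gt0// mulr_gt0// pi_gt0.
by move: (sinh _) (cosh _) s0 => s c s0; move: (@pi R) => p; field; rewrite ?s0.
Qed.

Lemma Qpi (y : R) : 0 <= y <= pi -> @Q R (pi, y).
Proof.
have p0 := @pi_ge0 R; move=> /andP[y0 yp]; split; rewrite /= in_itv /=; apply/andP; split; lra.
Qed.

Lemma Gf_pi0 : 2 * pi * Gf (pi, 0) - pi ^+ 2 / 6 = pi ^+ 2 * zP :> R.
Proof.
have p0 := @pi_gt0 R; have Q0 : @Q R (pi, 0) by apply: Qpi; rewrite lexx ltW.
have S1 := Gf_sums Q0 p0; rewrite /= bern_pi in S1.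
have S2 := @sumsZ R _ (pi ^+ 2) _ (zsE (win_cvg ck_decay)); rewrite ck0 subr0 in S2.
have -> : 2 * pi * Gf (pi, 0) - pi ^+ 2 / 6 = 2 * pi * Gf (pi, 0) + 2 * (- (pi ^+ 2) / 12) :> R by field.
apply: (sums_unique _ S2); apply: sums_eq S1 => k.
by rewrite mulr0 cos0 mulr1 acoef_pi.
Qed.

Lemma Gf_pipi : 2 * pi * Gf (pi, pi) - pi ^+ 2 / 6 = pi ^+ 2 * zs (fun k => sgz k * ck k) :> R.
Proof.
have p0 := @pi_gt0 R; have Q0 : @Q R (pi, pi) by apply: Qpi; rewrite lexx ltW.
have S1 := Gf_sums Q0 p0; rewrite /= bern_pi in S1.
have S2 := @sumsZ R _ (pi ^+ 2) _ (zsE (win_cvg sgck_decay)); rewrite ck0 mulr0 subr0 in S2.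
have -> : 2 * pi * Gf (pi, pi) - pi ^+ 2 / 6 = 2 * pi * Gf (pi, pi) + 2 * (- (pi ^+ 2) / 12) :> R by field.
apply: (sums_unique _ S2); apply: sums_eq S1 => k.
rewrite cos_natpi acoef_pi /sgz abszN /= -mulrA; congr (_ * _).
by rewrite ckN; ring.
Qed.

Hypothesis Gf0 : Gf (pi, pi) = 0 :> R.

Lemma zsgck_val : (He + zS - Ho - zA) / 4 - 4^-1 = - 6^-1 :> R.
Proof.
rewrite -zs_sgck; have := Gf_pipi; rewrite Gf0 mulr0 sub0r => h.
have p0 : pi ^+ 2 != 0 :> R by rewrite expf_neq0// gt_eqF// pi_gt0.
apply: (mulfI p0); rewrite -h.
by move: (pi : R) => p; field.
Qed.

(** Linear algebra: [zPE] and [zSE] reduce [gam] to [2 zA + He + Ho], and [zSE] with [zsgck_val]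
    gives [He = 2 Ho + zA], while [Dn 0 ^+ 2 = He + zA]. *)
Lemma gamE : gam = 3 / 2 * @Dn R 0 ^+ 2.
Proof. by rewrite Dn_sqr /gam; have := zsgck_val; have := zPE; have := zSE; lra. Qed.

Lemma Gf_pi0_val : Gf (pi, 0) = pi * @Dn R 0 ^+ 2 / 8.
Proof.
have h : @Dn R 0 ^+ 2 / 8 = zP / 2 + 12^-1 :> R.
  by rewrite Dn_sqr; have := zsgck_val; have := zPE; have := zSE; lra.
rewrite -mulrA h; have := Gf_pi0; have p0 : pi != 0 :> R by rewrite gt_eqF// pi_gt0.
move: (Gf _) zP p0 => g z; move: (@pi R) => p p0 E.
apply: (mulfI (mulf_neq0 (_ : 2 != 0 :> R) p0)) => //.
have -> : 2 * p * g = (2 * p * g - p ^+ 2 / 6) + p ^+ 2 / 6 by ring.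
by rewrite E; field.
Qed.

Lemma Lambda0_Gf : Lambda0 R = Gf (pi, 0).
Proof. by rewrite (Lambda0E gamE) Gf_pi0_val. Qed.

End lattice_constants.

(** * Numerical bounds *)

Section numerics.
Context {R : realType}.
Implicit Types x y : R.

(** Iterated below to obtain Taylor bounds: each remainder vanishes at [0] and has the preceding one
    as derivative. *)
Lemma nonneg_of_derive (f df : R -> R) : f 0 = 0 -> (forall t : R, isd f t (df t)) ->
  (forall t : R, 0 <= t -> 0 <= df t) -> forall x, 0 <= x -> 0 <= f x.
Proof.
move=> f0 fd d0 x x0; rewrite -f0; apply: (mvt_mono x0 (fun t _ => fd t)) => t /andP[t0 _].
exact: d0.
Qed.

Ltac taylor_step H := refine (nonneg_of_derive _ _ H);
  [by rewrite ?oppr0 ?expR0 ?sin0 ?cos0; ring | by move=> t; rewrite /isd; dauto; field].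

Lemma exp_le7 x : 0 <= x -> 0 <= expR (- x) -
  (1 - x + x ^+ 2 / 2 - x ^+ 3 / 6 + x ^+ 4 / 24 - x ^+ 5 / 120 + x ^+ 6 / 720 - x ^+ 7 / 5040).
Proof.
have H0 (t : R) : 0 <= t -> 0 <= 1 - expR (- t) by move=> t0; rewrite subr_ge0 expR_le1 oppr_le0.
have H1 : forall t : R, 0 <= t -> 0 <= expR (- t) - (1 - t) by taylor_step H0.
have H2 : forall t : R, 0 <= t -> 0 <= (1 - t + t ^+ 2 / 2) - expR (- t) by taylor_step H1.
have H3 : forall t : R, 0 <= t -> 0 <= expR (- t) - (1 - t + t ^+ 2 / 2 - t ^+ 3 / 6).
  by taylor_step H2.
have H4 : forall t : R, 0 <= t ->
    0 <= (1 - t + t ^+ 2 / 2 - t ^+ 3 / 6 + t ^+ 4 / 24) - expR (- t) by taylor_step H3.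
have H5 : forall t : R, 0 <= t ->
    0 <= expR (- t) - (1 - t + t ^+ 2 / 2 - t ^+ 3 / 6 + t ^+ 4 / 24 - t ^+ 5 / 120).
  by taylor_step H4.
have H6 : forall t : R, 0 <= t -> 0 <= (1 - t + t ^+ 2 / 2 - t ^+ 3 / 6 + t ^+ 4 / 24 -
    t ^+ 5 / 120 + t ^+ 6 / 720) - expR (- t) by taylor_step H5.
by move: x; taylor_step H6.
Qed.

Lemma exp_ge6 x : 0 <= x -> 0 <= expR x -
  (1 + x + x ^+ 2 / 2 + x ^+ 3 / 6 + x ^+ 4 / 24 + x ^+ 5 / 120 + x ^+ 6 / 720).
Proof.
have H0 (t : R) : 0 <= t -> 0 <= expR t - 1 by move=> t0; have := expR_ge1Dx t; lra.
have H1 : forall t : R, 0 <= t -> 0 <= expR t - (1 + t) by taylor_step H0.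
have H2 : forall t : R, 0 <= t -> 0 <= expR t - (1 + t + t ^+ 2 / 2) by taylor_step H1.
have H3 : forall t : R, 0 <= t -> 0 <= expR t - (1 + t + t ^+ 2 / 2 + t ^+ 3 / 6).
  by taylor_step H2.
have H4 : forall t : R, 0 <= t ->
    0 <= expR t - (1 + t + t ^+ 2 / 2 + t ^+ 3 / 6 + t ^+ 4 / 24) by taylor_step H3.
have H5 : forall t : R, 0 <= t ->
    0 <= expR t - (1 + t + t ^+ 2 / 2 + t ^+ 3 / 6 + t ^+ 4 / 24 + t ^+ 5 / 120).
  by taylor_step H4.
by move: x; taylor_step H5.
Qed.

Lemma sin_taylor x : 0 <= x ->
  0 <= sin x - (x - x ^+ 3 / 6 + x ^+ 5 / 120 - x ^+ 7 / 5040) /\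
  0 <= (x - x ^+ 3 / 6 + x ^+ 5 / 120 - x ^+ 7 / 5040 + x ^+ 9 / (72 * 5040)) - sin x.
Proof.
have H0 (t : R) : 0 <= t -> 0 <= 1 - cos t by move=> _; rewrite subr_ge0 cos_le1.
have H1 : forall t : R, 0 <= t -> 0 <= t - sin t by taylor_step H0.
have H2 : forall t : R, 0 <= t -> 0 <= cos t - (1 - t ^+ 2 / 2) by taylor_step H1.
have H3 : forall t : R, 0 <= t -> 0 <= sin t - (t - t ^+ 3 / 6) by taylor_step H2.
have H4 : forall t : R, 0 <= t -> 0 <= (1 - t ^+ 2 / 2 + t ^+ 4 / 24) - cos t by taylor_step H3.
have H5 : forall t : R, 0 <= t -> 0 <= (t - t ^+ 3 / 6 + t ^+ 5 / 120) - sin t by taylor_step H4.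
have H6 : forall t : R, 0 <= t -> 0 <= cos t - (1 - t ^+ 2 / 2 + t ^+ 4 / 24 - t ^+ 6 / 720).
  by taylor_step H5.
have H7 : forall t : R, 0 <= t -> 0 <= sin t - (t - t ^+ 3 / 6 + t ^+ 5 / 120 - t ^+ 7 / 5040).
  by taylor_step H6.
have H8 : forall t : R, 0 <= t -> 0 <= (1 - t ^+ 2 / 2 + t ^+ 4 / 24 - t ^+ 6 / 720 + t ^+ 8 / (8 * 5040)) - cos t.
  by taylor_step H7.
have H9 : forall t : R, 0 <= t -> 0 <= (t - t ^+ 3 / 6 + t ^+ 5 / 120 - t ^+ 7 / 5040 + t ^+ 9 / (72 * 5040)) - sin t.
  by taylor_step H8.
by move=> x0; split; [exact: H7|exact: H9].
Qed.

(** The triple-angle formula makes [s] a root of [4 s^3 - 3 s + 1 = (s + 1) (2 s - 1)^2]. *)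
Lemma sin_pi6 : sin (pi / 6) = 1 / 2 :> R.
Proof.
have p0 := @pi_gt0 R; set s := sin _.
have s0 : 0 < s by apply: sin_gt0_pi; apply/andP; split; lra.
have h3 : sin (3 * (pi / 6)) = 3 * s - 4 * s ^+ 3 :> R.
  have -> : 3 * (pi / 6) = pi / 6 + pi / 6 + pi / 6 :> R by ring.
  rewrite !(sinD, cosD) -/s.
  have : cos (pi / 6) ^+ 2 = 1 - s ^+ 2 :> R
    by have := cos2Dsin2 (pi / 6 : R); rewrite -/s; lra.
  by move: (cos (pi / 6)) => c E; transitivity (3 * s * c ^+ 2 - s ^+ 3); [ring|rewrite E; ring].
have h1 : sin (3 * (pi / 6)) = 1 :> R.
  have -> : 3 * (pi / 6) = pi / 2 :> R by field.
  exact: sin_pihalf.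

have /eqP : (s + 1) * (2 * s - 1) ^+ 2 = 0.
  by transitivity (1 - (3 * s - 4 * s ^+ 3)); [ring|rewrite -h3 h1 subrr].
rewrite mulf_eq0 expf_eq0 /= => /orP[/eqP|/eqP]; lra.
Qed.

(** Otherwise [3.1416 / 6 = 1 / 2 + 236 / 10^4] would lie below [pi / 6], but its sine exceeds
    [1 / 2] by the Taylor bound. *)
Lemma pi_upper : pi <= 3 + 1416 / 10 ^+ 4 :> R.
Proof.
rewrite leNgt; apply/negP => h.
have p4 : pi <= 4 :> R by have /andP[_ /ltW] := @pihalf_02 R; lra.
have y0 : 0 <= 1 / 2 + 236 / 10 ^+ 4 :> R by lra.
have [h1 _] := sin_taylor y0.
have : sin (1 / 2 + 236 / 10 ^+ 4) <= sin (pi / 6) :> R.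
  rewrite ltW// ltr_sin ?in_itv /=; first by lra.
    by apply/andP; split; lra.
  by apply/andP; split; lra.
rewrite sin_pi6; lra.
Qed.

Lemma pi_lower : 3 + 14 / 100 + 159 / 10 ^+ 5 <= pi :> R.
Proof.
rewrite leNgt; apply/negP => h; have p0 := @pi_ge2 R.
have y0 : 0 <= (3 + 14 / 100 + 159 / 10 ^+ 5) / 6 :> R by lra.
have [_ h1] := sin_taylor y0.
have : sin (pi / 6) <= sin ((3 + 14 / 100 + 159 / 10 ^+ 5) / 6) :> R.
  rewrite ltW// ltr_sin ?in_itv /=; first by lra.
    by apply/andP; split; lra.
  by apply/andP; split; lra.
rewrite sin_pi6; lra.
Qed.

End numerics.

(** * Decimal bounds on Lambda0 *)

Section value_of_Lambda0.
Context {R : realType}.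

Local Notation q := (@eR R 1).
Local Notation M := (@Dn R 0).

Lemma eRX n : eR n = q ^+ n.
Proof.
elim: n => [|n IH]; first by rewrite /eR mul0r oppr0 expR0.
by rewrite -addn1 eRD IH -exprSr addn1.
Qed.

(** As the eighth power of [expR (- (pi / 8))]: on the smaller argument a Taylor polynomial of
    degree 7 is accurate enough. Here [3927 / 10^4 = 3.1416 / 8]. *)
Lemma q_ge : 43 / 1000 + 2129 / 10 ^+ 7 <= q.
Proof.
have c0 : 0 <= 675 / 1000 + 231 / 10 ^+ 6 :> R by lra.
have c8 : 43 / 1000 + 2129 / 10 ^+ 7 <= (675 / 1000 + 231 / 10 ^+ 6) ^+ 8 :> R by lra.
have h2 : expR (- (3927 / 10 ^+ 4)) <= expR (- (pi / 8)) :> R.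
  by rewrite ler_expR; have := @pi_upper R; lra.
have h1 : 675 / 1000 + 231 / 10 ^+ 6 <= expR (- (3927 / 10 ^+ 4)) :> R.
  have y0 : 0 <= 3927 / 10 ^+ 4 :> R by lra.
  by have := exp_le7 y0; lra.
have -> : q = expR (- (pi / 8)) ^+ 8 by rewrite -expRM_natl /eR; congr expR; field.
by apply: (le_trans c8); rewrite ler_pXn2r ?nnegrE ?expR_ge0 ?c0 ?(le_trans h1 h2).
Qed.

Lemma q_le : q <= 4323 / 10 ^+ 5.
Proof.
have pl := @pi_lower R; have y0 : 0 <= 39 / 100 + 269 / 10 ^+ 5 :> R by lra.
have h := exp_ge6 y0.
have h1 : 148 / 100 + 95 / 10 ^+ 5 <= expR (39 / 100 + 269 / 10 ^+ 5) :> R by lra.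
have h2 : expR (39 / 100 + 269 / 10 ^+ 5) <= expR (pi / 8) :> R by rewrite ler_expR; lra.
have h3 := le_trans h1 h2; have c0 : 0 <= 148 / 100 + 95 / 10 ^+ 5 :> R by lra.
have h4 : (148 / 100 + 95 / 10 ^+ 5) ^+ 8 <= expR (pi / 8) ^+ 8 :> R.
  by rewrite ler_pXn2r// ?nnegrE ?expR_ge0.
have E : q * expR (pi / 8) ^+ 8 = 1.
  by rewrite -expRM_natl -expRD (_ : _ + _ = 0) ?expR0//; field.
have q0 := @eR_gt0 R 1; have h5 := ler_wpM2l (ltW q0) h4; rewrite E in h5.
have h6 : 10 ^+ 5 / 4323 <= (148 / 100 + 95 / 10 ^+ 5) ^+ 8 :> R by lra.
have := le_trans (ler_wpM2l (ltW q0) h6) h5.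
move: q => r; lra.
Qed.

Lemma pow_mono n (x y : R) : 0 <= x -> x <= y -> x ^+ n <= y ^+ n.
Proof. by move=> x0 xy; apply: lerXn2r => //; rewrite nnegrE// (le_trans x0). Qed.

Lemma q_pow_ge n : (43 / 1000 + 2129 / 10 ^+ 7) ^+ n <= q ^+ n.
Proof. by apply: pow_mono; [lra|exact: q_ge]. Qed.

Lemma q_pow_le n : q ^+ n <= (4323 / 10 ^+ 5) ^+ n.
Proof. by apply: pow_mono; [exact: expR_ge0|exact: q_le]. Qed.

(** The terms of the Lambert series [M = 1 + 4 \sum_(k >= 1) q^k / (1 + q^(2 k))], the square of a
    theta constant at the nome [q = exp (- pi)]. *)
Let u k : R := sc (pt 0 k.+1%:Z) + sc (pt 0 (- k.+1%:Z)).

Lemma uE k : u k = 4 * q ^+ k.+1 / (1 + q ^+ k.+1 ^+ 2).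
Proof.
rewrite /u pt0N {2}/sc coshN -/(sc _) pt0_nat /sc /cosh expRN -eRX /eR expRN.
set e := expR _; have e0 : e != 0 by rewrite gt_eqF// expR_gt0.
have e1 : e ^+ 2 + 1 != 0 by rewrite gt_eqF// ltr_wpDl// sqr_ge0.
have e2 : e + e^-1 != 0 by rewrite gt_eqF// addr_gt0 ?invr_gt0 ?expR_gt0.
by field; rewrite ?e0 ?e1 ?e2.
Qed.

Lemma u_ge0 k : 0 <= u k. Proof. by rewrite addr_ge0 ?sc_ge0. Qed.

Lemma M_lim : sums u (M - 1).
Proof.
have h := zsE (@Dn_cvg R 0); have e : sc (pt 0 0) = 1 :> R by rewrite pt00 /sc cosh0 invr1.
by rewrite e in h; exact: h.
Qed.

Lemma inv1D_ge (x : R) : 0 <= x -> 1 - x <= (1 + x)^-1.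
Proof. by move=> x0; rewrite -[leRHS]mul1r ler_pdivlMr; [nra|lra]. Qed.

Lemma inv1D_le (x : R) : 0 <= x -> (1 + x)^-1 <= 1 - x + x ^+ 2.
Proof. by move=> x0; rewrite -[leLHS]mul1r ler_pdivrMr; [nra|lra]. Qed.

Lemma M_ge : 118 / 100 + 332 / 10 ^+ 6 <= M.
Proof.
have H : series u 4 <= M - 1.
  have c := sums_cvg M_lim; rewrite -(sums_lim M_lim).
  apply: nondecreasing_cvgn_le => //; apply/nondecreasing_seqP => n.
  by rewrite seriesSr lerDl u_ge0.
have q0 := @eR_gt0 R 1.
have ug k : 4 * q ^+ k.+1 * (1 - q ^+ k.+1 ^+ 2) <= u k.
  by rewrite uE ler_wpM2l ?mulr_ge0 ?exprn_ge0 ?(ltW q0)// inv1D_ge// sqr_ge0.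
move: H; rewrite /series /= !big_nat_recr//= big_nil add0r.
have := ug 0; have := ug 1; have := ug 2; have := ug 3.
have qa := q_ge; have qb := q_le.
(* The four lower bounds add up to [4 (q + q^2 + q^4 - q^6 - q^9 - q^12)], as [q^3] cancels; each
   remaining power is bounded separately. *)
have p2 := q_pow_ge 2.
have p4 := q_pow_ge 4.
have r6 := q_pow_le 6.
have r9 := q_pow_le 9.
have r12 := q_pow_le 12.
move: (u 0) (u 1) (u 2) (u 3) M p2 p4 r6 r9 r12 qa qb => u0 u1 u2 u3 m.
move: q => r; lra.
Qed.

Lemma M_le : M <= 118 / 100 + 42 / 10 ^+ 5.
Proof.
have q0 := @eR_gt0 R 1; have qa := q_ge; have qb := q_le.
have q1 : 0 < 1 - q by lra.
(* A partial sum plus the geometric majorant of its remainder does not increase with [N]. *)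
have S N : series u N.+1 + 4 * q ^+ N.+2 / (1 - q) <= 4 * q / (1 + q ^+ 2) + 4 * q ^+ 2 / (1 - q).
  elim: N => [|N IH].
    by rewrite /series /= big_nat1 uE expr1.
  apply: le_trans IH; rewrite seriesSr -addrA lerD2l.
  have uN : u N.+1 <= 4 * q ^+ N.+2.
    rewrite uE -[leRHS]mulr1; apply: ler_wpM2l; first by rewrite mulr_ge0// exprn_ge0// ltW.
    by rewrite invf_le1 ?lerDl ?sqr_ge0// ltr_pwDl// sqr_ge0.
  have -> : 4 * q ^+ N.+2 / (1 - q) = 4 * q ^+ N.+2 + 4 * q ^+ N.+3 / (1 - q).
    by rewrite [q ^+ N.+3]exprS; field; rewrite gt_eqF.
  by rewrite lerD2r.
have H : M - 1 <= 4 * q / (1 + q ^+ 2) + 4 * q ^+ 2 / (1 - q).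
  apply: (ler_cvg_to M_lim (cvg_cst _)); near=> N.
  have NE : N = N.-1.+1 by rewrite prednK//; near: N; exact: nbhs_infty_gt.
  rewrite NE; apply: le_trans (S N.-1); rewrite lerDl.
  by rewrite divr_ge0 ?(ltW q1)// mulr_ge0// exprn_ge0// ltW.
have h1 : 4 * q / (1 + q ^+ 2) <= 4 * q * (1 - q ^+ 2 + q ^+ 2 ^+ 2).
  by rewrite ler_wpM2l ?mulr_ge0 ?(ltW q0)// inv1D_le// sqr_ge0.
have h2 : 4 * q ^+ 2 / (1 - q) <= 4 * q ^+ 2 * (1 + 452 / 10 ^+ 4).
  apply: ler_wpM2l; first by rewrite mulr_ge0// sqr_ge0.
  by rewrite -[leLHS]mul1r ler_pdivrMr//; lra.
have r3 := q_pow_ge 3.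
have r2 := q_pow_le 2.
have r5 := q_pow_le 5.
have := le_trans H (lerD h1 h2).
move: M r2 r3 r5 qa qb => m; move: q => r; lra.
Unshelve. all: by end_near. Qed.

Lemma value_Lambda0 : gam = 3 / 2 * M ^+ 2 :> R ->
  (5471 / 10 ^+ 4 <= Lambda0 R < 5472 / 10 ^+ 4).
Proof.
move=> /Lambda0E ->; have ml := M_ge; have mu := M_le.
have pl := @pi_lower R; have pu := @pi_upper R.
have m2 : (118 / 100 + 332 / 10 ^+ 6) ^+ 2 <= M ^+ 2 by rewrite ler_pXn2r// ?nnegrE; lra.
have m3 : M ^+ 2 <= (118 / 100 + 42 / 10 ^+ 5) ^+ 2 by rewrite ler_pXn2r// ?nnegrE; lra.
have c0 : 0 <= (3 + 14 / 100 + 159 / 10 ^+ 5) :> R by lra.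
have d0 : 0 <= (118 / 100 + 332 / 10 ^+ 6) ^+ 2 :> R by lra.
have h1 := ler_pM c0 d0 pl m2.
have h2 := ler_pM (@pi_ge0 R) (sqr_ge0 M) pu m3.
move: (pi * M ^+ 2) h1 h2 => z h1 h2.
have e1 : 5471 = 54 * 100 + 71 :> R by rewrite -natrM -natrD.
have e2 : 5472 = 54 * 100 + 72 :> R by rewrite -natrM -natrD.
by rewrite e1 e2; apply/andP; split; lra.
Qed.

End value_of_Lambda0.

(** * The range *)

Section range.
Context {R : realType}.
Implicit Types (x y r v : R) (t c : R * R).

Lemma sinh_ge_id x : 0 <= x -> x <= sinh x.
Proof.
have H0 : forall t : R, 0 <= t -> 0 <= cosh t - 1 by move=> t _; rewrite subr_ge0 cosh_ge1.
have H1 : forall t : R, 0 <= t -> 0 <= sinh t - t.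
  refine (nonneg_of_derive _ _ H0); first by rewrite sinh0 subrr.
  by move=> t; rewrite /isd; hauto; ring.
by move=> /H1; rewrite subr_ge0.
Qed.

(** Equivalently [cosh x - cos x <= 2 (cosh x - 1)]: the value of [Pf] on the diagonal is at least
    half of that on the axis [y = 0]. *)
Lemma cos_cosh x : 0 <= x -> 1 - cos x <= cosh x - 1.
Proof.
have H0 : forall t : R, 0 <= t -> 0 <= cosh t - cos t.
  by move=> t _; have := cosh_ge1 t; have := cos_le1 t; lra.
have H1 : forall t : R, 0 <= t -> 0 <= sinh t - sin t.
  refine (nonneg_of_derive _ _ H0); first by rewrite sinh0 sin0 subrr.
  by move=> t; rewrite /isd; hauto; ring.
have H2 : forall t : R, 0 <= t -> 0 <= cosh t + cos t - 2.
  refine (nonneg_of_derive _ _ H1); first by rewrite cosh0 cos0; ring.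
  by move=> t; rewrite /isd; hauto; ring.
by move=> /H2; lra.
Qed.

Lemma cosh_small x : 0 <= x <= 1 / 20 -> cosh x <= 103 / 100.
Proof.
move=> /andP[x0 x1]; rewrite /cosh.
have h1 : expR (- x) <= 1 by rewrite expR_le1 oppr_le0.
have h2 := @expR_ge1Dx R (- x); have e0 := expR_gt0 (- x).
have h3 : expR x * expR (- x) = 1 by rewrite -expRD subrr expR0.
have : expR x * (19 / 20) <= expR x * expR (- x) by apply: ler_wpM2l; [exact: expR_ge0|lra].
rewrite h3.
lra.
Qed.

(** The part of [Gf] that is discontinuous at the origin; there it behaves like
    [x^2 / (x^2 + y^2)]. *)
Definition Pf x y : R := x * sinh x / (2 * (cosh x - cos y)).

(** [Pf x y] lies between [Pf x x] and [Pf x 0], and [Pf x x] is at least half of [Pf x 0 = (x / 2)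
    coth (x / 2) <= cosh (x / 2)]. *)
Lemma Pf_diag x y : 0 < x <= 1 / 10 -> `|y| <= x -> 0 <= Pf x y - Pf x x <= 52 / 100.
Proof.
move=> /andP[x0 x1] yx; have s0 := sinh_gt0 x0.
have p2 := @pi_ge2 R.
have cyx : cos x <= cos y.
  have -> : cos y = cos `|y| by have [h|h] := leP 0 y; rewrite ?(ger0_norm h) ?(ltr0_norm h) ?cosN.
  rewrite leNgt; apply/negP => h.
  have yi : `|y| \in `[0, pi] by rewrite in_itv /= normr_ge0 /=; lra.
  have xi : x \in `[0, pi] by rewrite in_itv /=; apply/andP; split; lra.
  by move: h; rewrite ltr_cos// ltNge yx.
have xn0 := negbT (gt_eqF x0); have cy1 := cos_le1 y; have cx := cos_cosh (ltW x0).
have D1 := cosh_sub_cos_gt0 0 xn0; rewrite cos0 in D1.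
have Dx := cosh_sub_cos_gt0 x xn0; have Dy := cosh_sub_cos_gt0 y xn0.
have i1 : (cosh x - cos x)^-1 <= (cosh x - cos y)^-1 by rewrite lef_pV2 ?posrE//; lra.
have i2 : (cosh x - cos y)^-1 <= (cosh x - 1)^-1 by rewrite lef_pV2 ?posrE//; lra.
have i3 : (2 * (cosh x - 1))^-1 <= (cosh x - cos x)^-1.
  by rewrite lef_pV2 ?posrE ?mulr_gt0//; lra.
have PE y' : Pf x y' = x * sinh x / 2 * (cosh x - cos y')^-1 by rewrite /Pf invfM mulrA.
rewrite !PE -mulrBr; set k := x * sinh x / 2.
have k0 : 0 <= k by rewrite /k divr_ge0// mulr_ge0// ltW.
apply/andP; split; first by apply: mulr_ge0 => //; lra.
rewrite invfM in i3.
apply: (@le_trans _ _ (k * (2^-1 * (cosh x - 1)^-1))).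
  by apply: ler_wpM2l => //; lra.
have xh : x = x / 2 + x / 2 by field.
have sh0 : 0 < sinh (x / 2) by apply: sinh_gt0; lra.
have ch : cosh x - 1 = 2 * sinh (x / 2) ^+ 2.
  by rewrite {1}xh coshD; have := cosh_sqr (x / 2); lra.
have sE : sinh x = 2 * sinh (x / 2) * cosh (x / 2) by rewrite {1}xh sinhD; ring.
have -> : k * (2^-1 * (cosh x - 1)^-1) = (x / 2) / sinh (x / 2) * (cosh (x / 2) / 2).
  by rewrite /k ch sE; field; rewrite gt_eqF.
have h1 : (x / 2) / sinh (x / 2) <= 1.
  by rewrite ler_pdivrMr// mul1r; apply: sinh_ge_id; lra.
have h2 : cosh (x / 2) <= 103 / 100 by apply: cosh_small; apply/andP; split; lra.
have c0 := cosh_gt0 (x / 2).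
apply: (@le_trans _ _ (1 * (cosh (x / 2) / 2))); last by lra.
by apply: ler_wpM2r => //; lra.
Qed.

Section with_F.
Variable F : R * R -> R.
Hypothesis FF : is_F F.

Lemma F_swap t : @Q R t -> F (t.2, t.1) = - F t.
Proof.
move=> Qt; have Qs := Qswap Qt.
have [t1|t1] := eqVneq t.1 0; last first.
  rewrite (is_F_Gf FF Qt t1) (is_F_GfN FF Qs) /=; last exact: t1.
  by case: (t).
have [t2|t2] := eqVneq t.2 0.
  case: t t1 t2 {Qt Qs} => a b /= -> ->; case: FF => _ _ ->.
  by rewrite oppr0.
rewrite (is_F_GfN FF Qt t2) (is_F_Gf FF Qs) /=; last exact: t2.
by rewrite opprK.
Qed.

(** Both representations of [F] hold at [(x, x)], and they are opposite there. *)
Lemma Gf_diag x : x != 0 -> @Q R (x, x) -> Gf (x, x) = 0.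
Proof.
move=> x0 Qx; have := is_F_GfN FF Qx x0; rewrite (is_F_Gf FF Qx x0) /=.
by move: (Gf _) => g; lra.
Qed.

Lemma F_antidiag x : @Q R (x, - x) -> F (x, - x) = 0.
Proof.
move=> Qx; have [->|x0] := eqVneq x 0.
  by rewrite oppr0; case: FF.
have Qy : @Q R (- x, - x) by move: Qx => [_ h]; split.
rewrite (is_F_Gf FF Qx x0) -(GfN (x, - x)) /=.
by apply: Gf_diag Qy; rewrite oppr_eq0.
Qed.

Lemma Qnorm (a b : R) : `|a| <= pi -> `|b| <= pi -> @Q R (a, b).
Proof. by rewrite !ler_norml => ? ?; split; rewrite /= in_itv. Qed.

Lemma normQ t : @Q R t -> `|t.1| <= pi /\ `|t.2| <= pi.
Proof. by case; rewrite /= !in_itv /= => ? ?; rewrite !ler_norml. Qed.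

(* Since [Gf (x, x) = 0], near the origin
   [Gf (x, y) = (Pf x y - Pf x x) + (Hser (x, y) - Hser (x, x))]. *)
Lemma F_small : exists2 r, 0 < r <= pi & forall t, @Q R t -> `|t.1| <= r -> `|t.2| <= r ->
  `|F t| <= 54 / 100.
Proof.
have p2 := @pi_ge2 R.
have Q0 : @Q R (0, 0) by apply: Qnorm; rewrite normr0; lra.
(* [Hser (x, y) - Hser (x, x)] costs [1 / 100] twice, which with the [52 / 100] of [Pf_diag] makes
   [54 / 100]. *)
have e1 : 0 < 1 / 100 :> R by lra.
have [d d0 Hd] := within_ball (Hser_cont Q0) e1.
pose r := Num.min (d / 2) (1 / 10).
have r0 : 0 < r by rewrite lt_min; apply/andP; split; lra.
have rd : r < d by apply: (@le_lt_trans _ _ (d / 2)); [rewrite ge_min lexx|lra].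
have r1 : r <= 1 / 10 by rewrite ge_min lexx orbT.
have pos x y : 0 < x <= r -> `|y| <= x -> `|Gf (x, y)| <= 54 / 100.
  move=> /andP[x0 xr] yx.
  have xn : `|x| = x by rewrite gtr0_norm.
  have Qx : @Q R (x, x) by apply: Qnorm; lra.
  have Qy : @Q R (x, y) by apply: Qnorm; lra.
  have E := Gf_diag (negbT (gt_eqF x0)) Qx.
  have := Hd (x, x) Qx; have := Hd (x, y) Qy; rewrite /= !subr0 => h1 h2.
  have {}h1 : `|Hser (x, y) - Hser (0, 0)| <= 1 / 100 by apply: h1; lra.
  have {}h2 : `|Hser (x, x) - Hser (0, 0)| <= 1 / 100 by apply: h2; lra.
  have xx : 0 < x <= 1 / 10 by apply/andP; split; lra.
  have := Pf_diag xx yx; move: E h1 h2; rewrite /Gf /= -/(Pf x x) -/(Pf x y).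
  move: (Pf x y) (Pf x x) (Hser (x, y)) (Hser (x, x)) (Hser (0, 0)) => a b h h' h0.
  move: (pi / 6) (x ^+ 2 / (4 * pi)) => u w E.
  by rewrite !ler_norml => /andP[? ?] /andP[? ?] /andP[? ?]; apply/andP; split; lra.
have main t : @Q R t -> t.1 != 0 -> `|t.1| <= r -> `|t.2| <= `|t.1| -> `|F t| <= 54 / 100.
  move=> Qt t0 tr tt; rewrite (is_F_Gf FF Qt t0).
  have -> : Gf t = Gf (`|t.1|, t.2).
    have [h|h] := leP 0 t.1; first by rewrite ger0_norm//; case: (t).
    by rewrite ltr0_norm// GfN.
  by apply: pos => //; rewrite normr_gt0 t0.
exists r; first by apply/andP; split; lra.
move=> t Qt t1 t2; have [h|h] := leP `|t.2| `|t.1|.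
  have [z|z] := eqVneq t.1 0; last exact: main.
  move: h; rewrite z normr0 normr_le0 => /eqP z2.
  case: t z z2 {Qt t1 t2} => a b /= -> ->; case: FF => _ _ ->.
  by rewrite normr0; lra.
have Qs := Qswap Qt; rewrite -normrN -(F_swap Qt); apply: main => //=; last exact: ltW.
by rewrite -normr_gt0 (le_lt_trans _ h).
Qed.

Hypothesis big : 5471 / 10 ^+ 4 <= F (pi, 0).

Lemma range_F : exists Lp, F (pi, 0) <= Lp /\ F @` @Q R = `[- Lp, Lp]%classic.
Proof.
have p0 := @pi_gt0 R; have [r /andP[r0 rp] Hr] := F_small.
have big' : 54 / 100 < F (pi, 0).
  apply: lt_le_trans big.
  have -> : 5471 = 54 * 100 + 71 :> R by rewrite -natrM -natrD.
  by lra.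
pose B1 := [set t : R * R | r <= `|t.1|]; pose B2 := [set t : R * R | r <= `|t.2|].
have cB1 : closed B1.
  apply: (@closed_comp _ _ (fun t : R * R => `|t.1|) [set y | r <= y]); last exact: closed_ge.
  move=> t _; apply: (@continuous_comp _ _ _ fst (fun x : R => `|x|)); last exact: norm_continuous.
  exact: cvg_fst.
have cB2 : closed B2.
  apply: (@closed_comp _ _ (fun t : R * R => `|t.2|) [set y | r <= y]); last exact: closed_ge.
  move=> t _; apply: (@continuous_comp _ _ _ snd (fun x : R => `|x|)); last exact: norm_continuous.
  exact: cvg_snd.
(* [Q] without a square neighbourhood of the origin: compact, and [F] is continuous on it. On the
   rest of [Q], [|F| <= 54 / 100 < F (pi, 0)]. *)
pose A := @Q R `&` (B1 `|` B2).
have cA : compact A.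
  apply: compact_closedI; last exact: closedU.
  by apply: compact_setX; exact: segment_compact.
have AQ : A `<=` @Q R `\ (0, 0).
  by move=> t [Qt Bt]; split => // t0; move: Bt; rewrite t0 /B1 /B2 /= normr0 leNgt r0 => -[].
have cF : {within @Q R `\ (0, 0), continuous F} by case: FF.
have Api : A (pi, 0).
  split; first by apply: Qnorm; rewrite ?normr0 ?(ger0_norm (ltW p0))// ltW.
  by left; rewrite /B1 /= (ger0_norm (ltW p0)).
have [c cA' cmax] : exists2 c, c \in A & forall t, t \in A -> F t <= F c.
  apply: compact_EVT_max => //; first by exists (pi, 0).
  exact: continuous_subspaceW AQ cF.
have {}cmax t : A t -> F t <= F c by move=> At; apply: cmax; rewrite inE.
have {}cA' : A c by rewrite inE in cA'.
have Lbig := cmax _ Api.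
have Aswap t : A t -> A (t.2, t.1).
  by move=> [Qt [h|h]]; split; try exact: Qswap; [right|left].
have Qc : @Q R c by case: cA'.
exists (F c); split => //; apply/seteqP; split => [_ [t Qt <-]|v].
  rewrite /= in_itv /=; case: (pselect (A t)) => [At|nAt].
    (* The lower bound for [F t] is the upper bound at the mirror image of [t]. *)
    rewrite cmax// andbT; have := cmax _ (Aswap _ At); rewrite F_swap//; lra.
  have t1 : `|t.1| <= r by rewrite leNgt; apply/negP => h; apply: nAt; split => //; left; exact: ltW.
  have t2 : `|t.2| <= r by rewrite leNgt; apply/negP => h; apply: nAt; split => //; right; exact: ltW.
  by have := Hr t Qt t1 t2; rewrite ler_norml => /andP[? ?]; apply/andP; split; lra.
rewrite /= in_itv /= => /andP[v1 v2].
(* The segment from [c] to its mirror image avoids the origin, since [F] vanishes on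
   the antidiagonal. *)
pose g (s : R) : R * R := ((1 - s) * c.1 + s * c.2, (1 - s) * c.2 + s * c.1).
have gQ s : 0 <= s <= 1 -> (@Q R `\ (0, 0)) (g s).
  move=> /andP[s0 s1]; have [n1 n2] := normQ Qc.
  have conv (a b : R) : `|a| <= pi -> `|b| <= pi -> `|(1 - s) * a + s * b| <= pi.
    move=> ha hb; rewrite (le_trans (ler_normD _ _))// !normrM (ger0_norm s0) ger0_norm ?subr_ge0//.
    have h1 : (1 - s) * `|a| <= (1 - s) * pi by apply: ler_wpM2l => //; lra.
    have h2 : s * `|b| <= s * pi by apply: ler_wpM2l.
    lra.
  split; first by apply: Qnorm; apply: conv.
  case=> g1 g2; have cc : c = (c.1, - c.1).
    by case: (c) g1 g2 => a b /= g1 g2; congr pair; lra.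
  have Q' : @Q R (c.1, - c.1) by rewrite -cc.
  by have := F_antidiag Q'; rewrite -cc; lra.
have gc : forall s : R, {for s, continuous g}.
  move=> s; have h (a b : R) := is_derive_cont (dadd (dmul (dadd (dcst 1 s) (dopp (did s)))
    (dcst a s)) (dmul (did s) (dcst b s))).
  exact: (cvg_pair (h c.1 c.2) (h c.2 c.1)).
have Fgc : {within `[0, 1], continuous (F \o g)}.
  apply/subspace_continuousP => s s01 U HU.
  have s01' : 0 <= s <= 1 by move: s01; rewrite /= in_itv.
  have /subspace_continuousP/(_ (g s) (gQ s s01')) Fc := cF.
  have h : nbhs (g s) [set t | (@Q R `\ (0, 0)) t -> U (F t)] := Fc U HU.
  have h' : nbhs s (g @^-1` [set t | (@Q R `\ (0, 0)) t -> U (F t)]) := gc s _ h.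
  suff : nbhs s [set z | `[0, 1]%classic z -> U (F (g z))] by [].
  by apply: filterS h' => z /= hz zI; apply: hz; apply: gQ; move: zI; rewrite /= in_itv.
have g0 : g 0 = c by rewrite /g subr0 !mul1r !mul0r !addr0; case: (c).
have g1 : g 1 = (c.2, c.1) by rewrite /g subrr !mul1r !mul0r !add0r.
have [|s sI sE] := @IVT R (F \o g) 0 1 v ler01 Fgc.
  by rewrite /= g0 g1 F_swap// ge_min le_max v2 v1 orbT.
by exists (g s) => //; have [] := gQ s sI.
Qed.

End with_F.

End range.

Unset Implicit Arguments.

Theorem lemma3p10 (R : realType) (F : R * R -> R) (hF : is_F F) :
  (5471 / 10 ^+ 4 <= Lambda0 R < 5472 / 10 ^+ 4) /\
  exists Lp : R, Lambda0 R <= Lp /\ F @` @Q R = `[- Lp, Lp]%classic.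
Proof.
have p0 := @pi_gt0 R; have pn := negbT (gt_eqF p0).
have Qp : @Q R (pi, pi) by apply: Qnorm; rewrite (ger0_norm (ltW p0)).
have G0 := Gf_diag hF pn Qp.
have L := value_Lambda0 (gamE G0); split => //.
have Q0 : @Q R (pi, 0) by apply: Qnorm; rewrite ?normr0 ?(ger0_norm (ltW p0))// ltW.
have E : Lambda0 R = F (pi, 0) by rewrite (is_F_Gf hF Q0 pn) (Lambda0_Gf G0).
by rewrite E; apply: range_F => //; rewrite -E; case/andP: L.
Qed.
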